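(* Let $(E,\mathcal E)$ be a Borel space, let $\alpha$ be a finite, non-zero measure on $E$, and let $c:E\times E\to[0,\infty)$ be a bounded measurable symmetric function with $c(x,x)=0$ for all $x\in E$. Let $(\eta_t)_{t\ge0}$ be the generalized symmetric inclusion process with formal generator $$Lf(\eta)=\iint\bigl(f(\eta-\delta_x+\delta_y)-f(\eta)\bigr)\,c(x,y)\,(\alpha+\eta)(\mathrm dy)\,\eta(\mathrm dx),$$ and let $(P_t)_{t\ge0}$ be its semigroup. Then: (i) $(\eta_t)_{t\ge0}$ is a consistent Markov process, and thus $$P_tJ_n(f_n,\cdot)(\eta)=J_n\bigl(p_t^{[n]}f_n,\eta\bigr)$$ for all $\eta\in\mathbf N_{<\infty}$, $n\in\mathbb N_0$, $f_n\in\mathcal F_n$ and $t\ge0$. (ii) For every $p\in(0,1)$, the Pascal distribution $\rho$ with parameters $\alpha$ and $p$ is reversible for $(\eta_t)_{t\ge0}$, and thus $$P_tI_n(f_n,\cdot)(\eta)=I_n\bigl(p_t^{[n]}f_n,\eta\bigr)$$ for $\rho$-almost all $\eta\in\mathbf N_{<\infty}$, all $t\ge0$, all $n\in\mathbb N$ and all $f_n\in\mathcal F_n$, where $I_n$ is the generalized orthogonal polynomial with respect to $\rho$.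
   Context: $\mathbf N_{<\infty}$ is the set of finite measures on $(E,\mathcal E)$ taking values in $\mathbb N_0$, with the $\sigma$-algebra $\mathcal N_{<\infty}$ generated by $\eta\mapsto\eta(B)$, $B\in\mathcal E$. Every $\eta\in\mathbf N_{<\infty}$ is $0$ or of the form $\delta_{x_1}+\dots+\delta_{x_m}$. The generalized symmetric inclusion process (gSIP) is the continuous-time pure jump Markov process on $\mathbf N_{<\infty}$ with jump kernel $Q(\eta,B)=\iint\mathbf 1_B(\eta-\delta_x+\delta_y)\,c(x,y)\,(\alpha+\eta)(\mathrm dy)\,\eta(\mathrm dx)$, $B\in\mathcal N_{<\infty}$, obtained by the usual jump-hold construction; its semigroup $(P_t)_{t\ge0}$, $P_tf(\eta)=\mathbb E_\eta[f(\eta_t)]$, is the minimal (and in fact unique) solution of the backward Kolmogorov equation. The number of particles is conserved and the total jump rate is bounded on each $\{\eta:\eta(E)=n\}$, so the process is non-explosive. Consistent: $P_t\mathcal Af(\eta)=\mathcal AP_tf(\eta)$ for all $t\ge0$, $\eta\in\mathbf N_{<\infty}$ and bounded measurable $f:\mathbf N_{<\infty}\to\mathbb R$, where $\mathcal Af(\eta):=\int f(\eta-\delta_x)\,\eta(\mathrm dx)$ (also applied to measurable functions that are bounded on each $\{\eta:\eta(E)=n\}$). Reversible: a probability measure $\rho$ on $\mathbf N_{<\infty}$ with $\int f\,P_tg\,\mathrm d\rho=\int g\,P_tf\,\mathrm d\rho$ for bounded measurable $f,g$ and $t\ge0$. $\mathcal F_n$ ($n\ge1$) is the set of bounded, measurable,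 permutation invariant functions $E^n\to\mathbb R$; $\mathcal F_0:=\mathbb R$. The $n$-particle semigroup acts on $\mathcal F_n$ by $(p_t^{[n]}f_n)(x_1,\dots,x_n):=(P_tf)(\delta_{x_1}+\dots+\delta_{x_n})$ where $f:\mathbf N_{<\infty}\to\mathbb R$ is bounded measurable with $f(\delta_{x_1}+\dots+\delta_{x_n})=f_n(x_1,\dots,x_n)$; $p_t^{[0]}$ is the identity. For $\eta=\sum_{i=1}^m\delta_{x_i}$ the $n$-th factorial measure is $\eta^{(n)}:=\sum\delta_{(x_{i_1},\dots,x_{i_n})}$, the sum over $n$-tuples in $\{1,\dots,m\}^n$ with pairwise different entries (empty sum $=0$). $J_n(f_n,\eta):=\int f_n\,\mathrm d\eta^{(n)}$ for $n\ge1$, $J_0(f_0,\eta):=f_0$. The Pascal distribution with parameters $\alpha$ and $p\in(0,1)$ is the law $\rho$ on $\mathbf N_{<\infty}$ of a point process $\zeta$ such that $\zeta(B_1),\dots,\zeta(B_m)$ are independent for pairwise disjoint $B_1,\dots,B_m\in\mathcal E$ and, for each $B\in\mathcal E$, $\mathbb P(\zeta(B)=k)=(1-p)^{\alpha(B)}\,\alpha(B)(\alpha(B)+1)\cdots(\alpha(B)+k-1)\,\frac{p^k}{k!}$, $k\in\mathbb N_0$ (for $k=0$: $(1-p)^{\alpha(B)}$). Generalized orthogonal polynomials with respect to $\rho$: $\mathcal P_n\subset L^2(\rho)$ is the set of linear combinations of maps $\eta\mapsto\int f_k\,\mathrm d\eta^{\otimes k}$, $0\le k\le n$, $f_k:E^k\to\mathbb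 R$ bounded measurable (constants for $k=0$), $\overline{\mathcal P_n}$ its closure in $L^2(\rho)$; $I_n(f_n,\cdot)$ is the orthogonal projection in $L^2(\rho)$ of $\eta\mapsto\int f_n\,\mathrm d\eta^{\otimes n}$ onto $\overline{\mathcal P_{n-1}}^{\perp}$ (defined up to $\rho$-null sets). *)

(* Defs.v *)
From HB Require Import structures.
From mathcomp Require Import all_boot all_order all_algebra.
From mathcomp Require Import all_classical all_reals all_analysis.
From mathcomp Require Import perm measurable_realfun.

Set Implicit Arguments.
Unset Strict Implicit.
Unset Printing Implicit Defensive.
Import Order.TTheory GRing.Theory Num.Theory.
Import numFieldNormedType.Exports.

Local Open Scope classical_set_scope.
Local Open Scope ring_scope.

(* Measurably isomorphic to a Borel subset of [0, 1]. *)
Definition borel_space (R : realType) d (E : measurableType d) : Prop :=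
  exists phi : E -> R,
    [/\ injective phi, measurable_fun [set: E] phi,
        range phi `<=` `[0, 1]
      & forall A : set E, measurable A -> measurable (phi @` A)].

Definition bounded_measurable (R : realType) d (T : measurableType d)
    (f : T -> R) : Prop :=
  measurable_fun [set: T] f /\ exists M : R, forall x, `|f x| <= M.

Section dirac_sum.
Context (R : realType) d (T : measurableType d).
Local Open Scope ereal_scope.

(* delta_{x_1} + ... + delta_{x_m} for s = [:: x_1; ...; x_m]; repetitions are
   counted, and the default element [point] is never reached. *)
Definition dirac_sum (s : seq T) : set T -> \bar R :=
  msum (fun i : nat => (\d_(nth point s i))%R) (size s).

Variable s : seq T.

HB.instance Definition _ := Measure.on (dirac_sum s).

Lemma dirac_sumE (A : set T) : dirac_sum s A = (\sum_(x <- s) \1_A x)%R%:E.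
Proof.
rewrite /dirac_sum /msum (big_nth point) big_mkord -sumEFin.
by apply: eq_bigr => i _; rewrite indicE.
Qed.

Lemma dirac_sum_fin_num : fin_num_fun (dirac_sum s).
Proof. by move=> A _; rewrite dirac_sumE. Qed.

HB.instance Definition _ :=
  @Measure_isFinite.Build _ T R (dirac_sum s) dirac_sum_fin_num.

End dirac_sum.
Arguments dirac_sum {R d T} s.

Section pow_measure.
Context (R : realType) d (E : measurableType d).
Local Open Scope ereal_scope.

Definition tcons n (xt : E * n.-tuple E) : n.+1.-tuple E :=
  [the n.+1.-tuple E of xt.1 :: xt.2].

Lemma measurable_tcons n : measurable_fun [set: E * n.-tuple E] (@tcons n).
Proof. exact: measurable_cons. Qed.

Section cons_measure.
Variables (mu : {finite_measure set E -> \bar R}) (n : nat).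
Variable nu : {finite_measure set (n.-tuple E) -> \bar R}.

Definition cons_measure : set (n.+1.-tuple E) -> \bar R :=
  pushforward (mu \x nu) (@tcons n).

Let cons_measure0 : cons_measure set0 = 0.
Proof. by rewrite /cons_measure /pushforward preimage_set0 measure0. Qed.

Let cons_measure_ge0 A : 0 <= cons_measure A.
Proof. by rewrite /cons_measure /pushforward measure_ge0. Qed.

Let cons_measure_sigma_additive : semi_sigma_additive cons_measure.
Proof.
have mpre A : measurable A -> measurable (@tcons n @^-1` A).
  by move=> mA; rewrite -[X in measurable X]setTI; exact: measurable_tcons.
move=> F mF tF mUF; rewrite /cons_measure /pushforward preimage_bigcup.
apply: measure_semi_sigma_additive.
- by move=> i; exact: mpre.
- apply/trivIsetP => /= i j _ _ ij; rewrite -preimage_setI.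
  by move/trivIsetP : tF => /(_ _ _ _ _ ij) ->//; rewrite preimage_set0.
- by rewrite -preimage_bigcup; exact: mpre.
Qed.

HB.instance Definition _ := isMeasure.Build _ _ _ cons_measure
  cons_measure0 cons_measure_ge0 cons_measure_sigma_additive.

Lemma cons_measure_fin_num : fin_num_fun cons_measure.
Proof.
apply: lty_fin_num_fun.
rewrite [ltLHS](_ : _ = (mu \x nu) ([set: E] `*` [set: n.-tuple E])); last first.
  by rewrite setXTT.
rewrite product_measure1E//.
by rewrite lte_mul_pinfty// ?fin_num_measure// -ge0_fin_numE// fin_num_measure.
Qed.

HB.instance Definition _ :=
  @Measure_isFinite.Build _ _ R cons_measure cons_measure_fin_num.

End cons_measure.

(* The product measure mu^{\otimes n}; for n = 0 it is the unit mass at the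
   empty tuple. *)
Fixpoint pow_measure (mu : {finite_measure set E -> \bar R}) (n : nat) :
    {finite_measure set (n.-tuple E) -> \bar R} :=
  match n with
  | 0%N => dirac_sum [:: [tuple]]
  | m.+1 => cons_measure mu (pow_measure mu m)
  end.

End pow_measure.
Arguments pow_measure {R d E} mu n.

Section config.
Context (R : realType) d (E : measurableType d).

(* The space N_{<oo}. Library measures also carry values on non-measurable
   sets, so one finite N_0-valued measure of the paper may be represented by
   several elements. These agree on all measurable sets, hence cannot be told
   apart by a measurable set or a measurable function on [config]. *)
Record config : Type := Config {
  config_val :> {finite_measure set E -> \bar R} ;
  config_nat : forall B, measurable B ->
    exists k : nat, config_val B = k%:R%:E }.

Lemma dirac_sum_nat (s : seq E) (B : set E) : measurable B ->
  exists k : nat, dirac_sum s B = k%:R%:E :> \bar R.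
Proof.
move=> _; exists (\sum_(x <- s) (x \in B))%N.
by rewrite dirac_sumE natr_sum.
Qed.

Definition dirac_config (s : seq E) : config := Config (@dirac_sum_nat s).

HB.instance Definition _ := gen_eqMixin config.
HB.instance Definition _ := gen_choiceMixin config.
HB.instance Definition _ := isPointed.Build config (dirac_config [::]).

Definition config_measurable : set (set config) :=
  <<s \bigcup_(B in measurable)
        preimage_set_system [set: config] (fun eta : config => eta B) measurable >>.

Let config_measurable0 : config_measurable set0.
Proof. exact: sigma_algebra0. Qed.

Let config_measurableC (U : set config) :
  config_measurable U -> config_measurable (~` U).
Proof. exact: sigma_algebraC. Qed.

Let config_measurableU (F : (set config)^nat) :
  (forall i, config_measurable (F i)) -> config_measurable (\bigcup_i F i).
Proof. exact: sigma_algebra_bigcup. Qed.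

Definition config_display : measure_display.
Proof. by constructor. Qed.

HB.instance Definition _ :=
  @isMeasurable.Build config_display config config_measurable
    config_measurable0 config_measurableC config_measurableU.

Definition same_measure (mu nu : {finite_measure set E -> \bar R}) : Prop :=
  forall B, measurable B -> mu B = nu B.

(* Some list of atoms, with multiplicity, of eta (unique up to order when E is
   a Borel space). *)
Definition atoms (eta : config) : seq E :=
  xget [::] [set s | same_measure eta (dirac_sum s)].

Definition add_dirac_measure (eta : config) (y : E) : set E -> \bar R :=
  measure_add eta (\d_y).

HB.instance Definition _ (eta : config) (y : E) :=
  Measure.on (add_dirac_measure eta y).

Lemma add_dirac_fin_num (eta : config) (y : E) :
  fin_num_fun (add_dirac_measure eta y).
Proof.
by move=> B mB; rewrite /add_dirac_measure measure_addE fin_numD !fin_num_measure.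
Qed.

HB.instance Definition _ (eta : config) (y : E) :=
  @Measure_isFinite.Build _ E R (add_dirac_measure eta y)
    (@add_dirac_fin_num eta y).

Lemma add_dirac_nat (eta : config) (y : E) (B : set E) : measurable B ->
  exists k : nat, add_dirac_measure eta y B = k%:R%:E.
Proof.
move=> mB; have [k etaB] := config_nat eta mB.
exists (k + (y \in B))%N.
by rewrite /add_dirac_measure measure_addE natrD EFinD -etaB.
Qed.

(* eta + delta_y *)
Definition add_dirac (eta : config) (y : E) : config :=
  Config (@add_dirac_nat eta y).

(* eta - delta_x, with the junk value eta if this is not an element of
   N_{<oo}, i.e. if x is not an atom of eta; below it is only used for
   eta-almost every x. *)
Definition sub_dirac (eta : config) (x : E) : config :=
  xget eta [set zeta | same_measure (add_dirac zeta x) eta].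

(* The operator written as a calligraphic A. *)
Definition sum_removal (f : config -> R) (eta : config) : R :=
  \int[eta]_x f (sub_dirac eta x).

End config.

Section symmetric_inclusion.
Context (R : realType) d (E : measurableType d).
Variables (alpha : {finite_measure set E -> \bar R}) (c : E -> E -> R).
Local Open Scope ereal_scope.
Local Notation N := (config R E).

(* The jump kernel Q. *)
Definition jump_kernel (eta : N) (B : set N) : \bar R :=
  \int[eta]_x \int[measure_add alpha eta]_y
    (\1_B (add_dirac (sub_dirac eta x) y) * c x y)%:E.

Definition jump_rate (eta : N) : R := fine (jump_kernel eta [set: N]).

(* One-step transition probabilities of the embedded chain; configurations
   with rate 0 are absorbing. *)
Definition jump_prob (eta : N) (B : set N) : \bar R :=
  if jump_rate eta == 0%R then (\d_eta)%R B
  else ((jump_rate eta)^-1)%:E * jump_kernel eta B.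

Context dO (Omega : measurableType dO).
Variable Pr : R.-pker N ~> Omega.

(* The data of the jump-hold construction: under Pr eta, Y is a Markov chain
   started at eta with transition probabilities [jump_prob], and e is a
   sequence of independent Exp(1) variables, independent of Y. *)
Record jump_hold_data (Y : nat -> Omega -> N) (e : nat -> Omega -> R) : Prop :=
  JumpHoldData {
  chain_measurable : forall n, measurable_fun [set: Omega] (Y n) ;
  clock_measurable : forall n, measurable_fun [set: Omega] (e n) ;
  clock_gt0 : forall n w, (0 < e n w)%R ;
  chain_start : forall eta B, measurable B ->
    Pr eta (Y 0%N @^-1` B) = (\d_eta)%R B ;
  chain_step : forall eta n (B : nat -> set N) D,
    (forall i, measurable (B i)) -> measurable D ->
    Pr eta ((\bigcap_(i < n.+1) (Y i @^-1` B i)) `&` (Y n.+1 @^-1` D)) =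
    \int[Pr eta]_(w in \bigcap_(i < n.+1) (Y i @^-1` B i))
      jump_prob (Y n w) D ;
  clock_law : forall eta n (B : nat -> set N) (C : nat -> set R),
    (forall i, measurable (B i)) -> (forall i, measurable (C i)) ->
    Pr eta ((\bigcap_(i < n) (Y i @^-1` B i)) `&`
            (\bigcap_(i < n) (e i @^-1` C i))) =
    Pr eta (\bigcap_(i < n) (Y i @^-1` B i)) *
    \prod_(i < n) exponential_prob 1%R (C i) }.

Section path.
Variables (Y : nat -> Omega -> N) (e : nat -> Omega -> R).

Definition holding_time (i : nat) (w : Omega) : \bar R :=
  if jump_rate (Y i w) == 0%R then +oo else (e i w / jump_rate (Y i w))%:E.

(* The time of the n-th jump, with value 0 for n = 0. *)
Definition jump_time (n : nat) (w : Omega) : \bar R :=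
  \sum_(i < n) holding_time i w.

(* The configuration between the n-th and the n+1-st jump is Y n. At times
   after an explosion, which has probability zero, the value is junk. *)
Definition jump_path (t : R) (w : Omega) : N :=
  Y (xget 0%N [set n | jump_time n w <= t%:E < jump_time n.+1 w]) w.

End path.

(* X is a Markov process under the family Pr, with respect to its natural
   filtration. *)
Definition markov_process (X : R -> Omega -> N) : Prop :=
  (forall t, (0 <= t)%R -> measurable_fun [set: Omega] (X t)) /\
  forall (eta : N) (s t : R) (A : set Omega) (B : set N),
    (0 <= s)%R -> (0 <= t)%R ->
    <<s [set A' | exists2 u, (0 <= u <= s)%R &
                  exists2 B' : set N, measurable B' & A' = X u @^-1` B'] >> A ->
    measurable B ->
    Pr eta (A `&` (X (s + t)%R @^-1` B)) =
    \int[Pr eta]_(w in A) Pr (X s w) (X t @^-1` B).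

Definition gSIP (X : R -> Omega -> N) : Prop :=
  (exists Y e, jump_hold_data Y e /\ X = jump_path Y e) /\ markov_process X.

End symmetric_inclusion.

Section semigroup.
Context (R : realType) d (E : measurableType d) dO (Omega : measurableType dO).
Local Notation N := (config R E).
Variables (Pr : R.-pker N ~> Omega) (X : R -> Omega -> N).

(* P_t f(eta) = E_eta[f(X_t)] *)
Definition semigroup (t : R) (f : N -> R) (eta : N) : R :=
  \int[Pr eta]_w f (X t w).

Definition consistent : Prop :=
  forall (t : R) (eta : N) (f : N -> R), 0 <= t -> bounded_measurable f ->
    semigroup t (sum_removal f) eta = sum_removal (semigroup t f) eta.

Definition reversible (rho : probability N R) : Prop :=
  forall (t : R) (f g : N -> R), 0 <= t ->
    bounded_measurable f -> bounded_measurable g ->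
    \int[rho]_eta (f eta * semigroup t g eta) =
    \int[rho]_eta (g eta * semigroup t f eta).

(* The function space F_n. Functions on E^n are functions on n-tuples; since
   there is exactly one 0-tuple, F_0 is R. *)
Definition symmetric_fun n (f : n.-tuple E -> R) : Prop :=
  bounded_measurable f /\
  forall (s : 'S_n) (x : n.-tuple E), f [tuple tnth x (s i) | i < n] = f x.

(* A bounded measurable function on N whose value at
   delta_{x_1} + ... + delta_{x_n} is f (x_1, ..., x_n). *)
Definition lift_fun n (f : n.-tuple E -> R) : N -> R :=
  xget (fun=> 0) [set F | bounded_measurable F /\
                          forall x : n.-tuple E, F (dirac_config R x) = f x].

(* The n-particle semigroup p_t^{[n]}. *)
Definition particle_semigroup n (t : R) (f : n.-tuple E -> R)
    (x : n.-tuple E) : R :=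
  if n == 0%N then f x else semigroup t (lift_fun f) (dirac_config R x).

End semigroup.

Section factorial.
Context (R : realType) d (E : measurableType d).

Definition injective_tuples n (s : seq E) : seq (n.-tuple E) :=
  [seq [tuple tnth (in_tuple s) (i j) | j < n] |
     i : {ffun 'I_n -> 'I_(size s)} <- enum {ffun 'I_n -> 'I_(size s)}
     & injectiveb i].

Definition factorial_measure n (eta : config R E) :
    {finite_measure set (n.-tuple E) -> \bar R} :=
  dirac_sum (injective_tuples n (atoms eta)).

(* J_n; for n = 0 the factorial measure is the unit mass at the empty tuple. *)
Definition J n (f : n.-tuple E -> R) (eta : config R E) : R :=
  \int[factorial_measure n eta]_x f x.

End factorial.

Section pascal.
Context (R : realType) d (E : measurableType d).
Local Open Scope ereal_scope.

Definition pascal (alpha : {finite_measure set E -> \bar R}) (p : R)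
    (rho : probability (config R E) R) : Prop :=
  (forall (m : nat) (B : 'I_m -> set E) (C : 'I_m -> set (\bar R)),
     (forall i, measurable (B i)) -> trivIset [set: 'I_m] B ->
     (forall i, measurable (C i)) ->
     rho (\bigcap_i [set eta : config R E | C i (eta (B i))]) =
     \prod_(i < m) rho [set eta : config R E | C i (eta (B i))]) /\
  (forall (B : set E) (k : nat), measurable B ->
     rho [set eta : config R E | eta B = k%:R%:E] =
     (((1 - p) `^ fine (alpha B)) *
      (\prod_(j < k) (fine (alpha B) + j%:R)) * (p ^+ k / k`!%:R))%R%:E).

End pascal.

Section orthogonal_polynomials.
Context (R : realType) d (E : measurableType d).
Local Notation N := (config R E).

Definition monomial n (f : n.-tuple E -> R) (eta : N) : R :=
  \int[pow_measure eta n]_x f x.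

(* The space P_n. *)
Definition polynomials (n : nat) : set (N -> R) :=
  [set g | exists (m : nat) (a : 'I_m -> R) (F : 'I_m -> N -> R),
     (forall i, exists k (f : k.-tuple E -> R),
        [/\ (k <= n)%N, bounded_measurable f & F i = monomial f]) /\
     g = fun eta => \sum_(i < m) a i * F i eta].

Variable rho : probability N R.

Definition L2_closure (V : set (N -> R)) : set (N -> R) :=
  [set f | f \in Lfun rho 2%:E /\ forall eps : R, 0 < eps ->
     exists2 g, V g & (Lnorm rho 2%:E (fun eta => (f eta - g eta)%:E) < eps%:E)%E].

Definition orthogonal_complement (V : set (N -> R)) : set (N -> R) :=
  [set f | f \in Lfun rho 2%:E /\
     forall g, V g -> \int[rho]_eta (f eta * g eta) = 0].

(* g is a version of the orthogonal projection in L^2(rho) of f onto W. *)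
Definition orthogonal_projection (W : set (N -> R)) (f g : N -> R) : Prop :=
  W g /\ forall h, W h -> \int[rho]_eta ((f eta - g eta) * h eta) = 0.

(* g is a version of I_n(f, .), for n >= 1. *)
Definition orthogonal_polynomial n (f : n.-tuple E -> R) (g : N -> R) : Prop :=
  orthogonal_projection
    (orthogonal_complement (L2_closure (polynomials n.-1)))
    (monomial f) g.

End orthogonal_polynomials.

(* Main.v *)
(** On the configurations with n particles the jump rate is bounded, hence P_t is
the limit of (1 + (t/k) L)^k, and identities pass from L to P_t. Written on lists
of atoms, L commutes with the removal operator A, which gives consistency. The
functional G = J_n(f, .) is determined by its values at configurations with n
particles through A G(eta) = (eta(E) - n) G(eta); this equation is preserved by
P_t, which gives the intertwining (i).

The Pascal distribution satisfies, for nonnegative H,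
  iint H(eta, x) eta(dx) rho(deta)
    = p iint H(eta + delta_x, x) (alpha + eta)(dx) rho(deta),
so that L, all its Euler steps and P_t are symmetric with respect to rho.

J_n(f, .) and the integral M_n(f, .) of f with respect to the n-th power of eta
differ by terms of lower degree. By (i), P_t preserves the polynomials of degree
at most n - 1, and by symmetry also their orthogonal complement W; moreover
P_t M_n(f, .) - M_n(p_t f, .) has degree at most n - 1. Hence for w in W
  <P_t I_n(f), w> = <M_n(f), P_t w> = <P_t M_n(f), w> = <M_n(p_t f), w>
    = <I_n(p_t f), w>. *)

Require Import Defs.
From HB Require Import structures.
From mathcomp Require Import all_boot all_order all_algebra.
From mathcomp Require Import all_classical all_reals all_analysis.
From mathcomp Require Import measurable_realfun finmap perm ring lra zify.

Set Implicit Arguments.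
Unset Strict Implicit.
Unset Printing Implicit Defensive.
Import Order.TTheory GRing.Theory Num.Theory.
Import numFieldNormedType.Exports.

Local Open Scope classical_set_scope.
Local Open Scope ring_scope.

(** * Countably additive functionals *)

Section sigma_functional.
Context (R : realType) d (X : measurableType d).
Local Open Scope ereal_scope.

(** The process is given by its paths, so the bridge to the generator is a comparison over a short
    time [h]: outside an event of probability O([h ^ 2]) the path makes at most one jump, and one
    Euler step reproduces the mean of that single jump up to the same order. Euler steps contract as
    soon as [h] times the rate is at most 1, so the errors of [k] steps add up to O(1/[k]). The rate
    may grow quadratically with the number of particles; hence every estimate is made on one sector,
    and functions are only asked to be bounded there. Two obstacles shape the rest. A configuration
    may have several representatives that agree on measurable sets; adding and removing atoms is
    therefore controlled up to [same_measure], which measurable functions do not see. And the terms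
    of lower degree between [J f] and [monomial f] repeat arguments of [f], so they need not be
    symmetric; the intertwining is proved for every bounded measurable [f], with [J_restriction] in
    the place of the particle semigroup. *)

Definition nonneg_measurable (f : X -> \bar R) : Prop :=
  (forall x, 0 <= f x) /\ measurable_fun [set: X] f.

(* Iterated integrals over kernels are handled as functionals: these compose
   without constructing the composed measures, and two of them agree as soon as
   they agree on indicators. *)
Record sigma_functional (T : (X -> \bar R) -> \bar R) : Prop :=
  SigmaFunctional {
  sigma_functional_ge0 : forall f, nonneg_measurable f -> 0 <= T f ;
  sigma_functionalZ : forall (k : R) f, (0 <= k)%R -> nonneg_measurable f ->
    T (fun x => k%:E * f x) = k%:E * T f ;
  sigma_functional_series : forall f : nat -> X -> \bar R,
    (forall n, nonneg_measurable (f n)) ->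
    T (fun x => \sum_(n <oo) f n x) = \sum_(n <oo) T (f n) }.

Lemma nonneg_measurable_indic (D : set X) : measurable D ->
  nonneg_measurable (fun x => (\1_D x)%:E).
Proof.
move=> mD; split => [x|]; first by rewrite lee_fin.
exact/measurable_EFinP/measurable_indic.
Qed.

Lemma nonneg_measurable0 : nonneg_measurable (fun=> 0).
Proof. by split. Qed.

Lemma nonneg_measurableZ (k : R) f : (0 <= k)%R -> nonneg_measurable f ->
  nonneg_measurable (fun x => k%:E * f x).
Proof.
move=> k0 [f0 mf]; split => [x|]; first by rewrite mule_ge0// lee_fin.
exact: measurable_funeM.
Qed.

Lemma nonneg_measurable_series (f : nat -> X -> \bar R) :
  (forall n, nonneg_measurable (f n)) ->
  nonneg_measurable (fun x => \sum_(n <oo) f n x).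
Proof.
move=> hf; split => [x|].
  by apply: nneseries_ge0 => n _ _; exact: (hf n).1.
apply: ge0_emeasurable_sum => n; first by move=> x _ _; exact: (hf n).1.
by move=> _; exact: (hf n).2.
Qed.

Section properties.
Variables (T : (X -> \bar R) -> \bar R) (hT : sigma_functional T).

Lemma sigma_functional0 : T (fun=> 0) = 0.
Proof.
rewrite -[RHS](mul0e (T (fun=> 0))) -(sigma_functionalZ hT)//.
by congr T; apply/funext => x; rewrite mul0e.
Qed.

(** The series axiom is applied to [f], [g], 0, 0, and so on. *)
Lemma sigma_functionalD f g : nonneg_measurable f -> nonneg_measurable g ->
  T (fun x => f x + g x) = T f + T g.
Proof.
move=> hf hg.
pose h n := match n with 0%N => f | 1%N => g | _ => fun=> 0 end.
have hh n : nonneg_measurable (h n).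
  by case: n => [//|[//|n]]; exact: nonneg_measurable0.
have E (S : (X -> \bar R) -> \bar R) : S (fun=> 0) = 0 ->
    (forall k, nonneg_measurable k -> 0 <= S k) ->
    \sum_(n <oo) S (h n) = S f + S g.
  move=> S0 Sge; rewrite (nneseries_split _ 2%N); last first.
    by move=> k _; exact/Sge/hh.
  rewrite add0n big_mkord !big_ord_recr big_ord0/= add0e eseries0 ?adde0//.
  by case=> [//|[//|n]] _ _ /=.
rewrite -(E T) ?sigma_functional0//; last exact: sigma_functional_ge0.
rewrite -(sigma_functional_series hT)//; congr T; apply/funext => x.
by rewrite (E (fun k => k x))// => k [].
Qed.

Lemma sigma_functional_sum I (s : seq I) (f : I -> X -> \bar R) :
  (forall i, nonneg_measurable (f i)) ->
  T (fun x => \sum_(i <- s) f i x) = \sum_(i <- s) T (f i).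
Proof.
move=> hf; elim: s => [|i s IH].
  rewrite big_nil -[RHS]sigma_functional0; congr T.
  by apply/funext => x; rewrite big_nil.
rewrite big_cons -IH -sigma_functionalD//.
  by congr T; apply/funext => x; rewrite big_cons.
split => [x|]; first by apply: sume_ge0 => j _; exact: (hf j).1.
by apply: emeasurable_sum => j; exact: (hf j).2.
Qed.

(** The proof that [T] is countably additive is an argument, so that the measure structure below can
    be attached to the term. Non-measurable sets get the value 0. *)
Definition functional_measure of sigma_functional T :=
  fun D : set X => if pselect (measurable D) is left _
    then T (fun x => (\1_D x)%:E) else 0.

Local Notation mu := (functional_measure hT).

Lemma functional_measureE D : measurable D -> mu D = T (fun x => (\1_D x)%:E).
Proof. by rewrite /functional_measure; case: pselect. Qed.

Let mu0 : mu set0 = 0.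
Proof.
rewrite functional_measureE// -[RHS]sigma_functional0; congr T.
by apply/funext => x; rewrite indic0.
Qed.

Let mu_ge0 D : 0 <= mu D.
Proof.
rewrite /functional_measure; case: pselect => // mD.
exact/(sigma_functional_ge0 hT)/nonneg_measurable_indic.
Qed.

Let mu_sigma_additive : semi_sigma_additive mu.
Proof.
move=> F mF tF mUF.
rewrite functional_measureE//.
rewrite (_ : T _ = \sum_(n <oo) mu (F n)); last first.
  under eq_eseriesr do rewrite functional_measureE//.
  rewrite -(sigma_functional_series hT).
    congr T; apply/funext => x.
    by rewrite indic_bigcup.
  by move=> n; exact: nonneg_measurable_indic.
by apply: is_cvg_nneseries => n _ _; exact: mu_ge0.
Qed.

HB.instance Definition _ := isMeasure.Build _ _ _ mu mu0 mu_ge0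
  mu_sigma_additive.

End properties.

Import HBSimple HBNNSimple.

(** A nonnegative measurable function is a countable sum of nonnegative simple functions, and a
    simple function is a finite combination of indicators. *)
Lemma eq_sigma_functional (T1 T2 : (X -> \bar R) -> \bar R) :
  sigma_functional T1 -> sigma_functional T2 ->
  (forall D, measurable D ->
    T1 (fun x => (\1_D x)%:E) = T2 (fun x => (\1_D x)%:E)) ->
  forall f, nonneg_measurable f -> T1 f = T2 f.
Proof.
move=> h1 h2 h12 f [f0 mf].
have simple (h : {sfun X >-> R}) : (forall x, 0 <= h x)%R ->
    T1 (EFin \o h) = T2 (EFin \o h).
  move=> hge.
  (* The coefficient is [r] itself on the range of [h]; the maximum with 0 makes the summand
     nonnegative for every real index, as [sigma_functional_sum] requires. *)
  have hE : EFin \o h = fun x => \sum_(r <- fset_set (range h))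
      (Num.max r 0)%:E * (\1_(h @^-1` [set r]) x)%:E.
    apply/funext => x /=; rewrite fimfunE fsbig_finite//=.
    rewrite -sumEFin; apply: eq_big_seq => r.
    rewrite in_fset_set// => /set_mem[y _ hyr].
    by rewrite -EFinM max_l// -hyr.
  have ok r : nonneg_measurable (fun x =>
      (Num.max r 0)%:E * (\1_(h @^-1` [set r]) x)%:E).
    apply: nonneg_measurableZ; first by rewrite le_max lexx orbT.
    exact: nonneg_measurable_indic.
  rewrite hE (sigma_functional_sum h1)// (sigma_functional_sum h2)//.
  apply: eq_bigr => r _.
  have r0 : (0 <= Num.max r 0)%R by rewrite le_max lexx orbT.
  have mr : nonneg_measurable (fun x => (\1_(h @^-1` [set r]) x)%:E).
    exact: nonneg_measurable_indic.
  by rewrite (sigma_functionalZ h1)// (sigma_functionalZ h2)// h12.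
pose g := nnsfun_approx measurableT mf.
(* The increments of the increasing simple approximations: their partial sums telescope to [g n]. *)
pose h n : {sfun X >-> R} := if n is m.+1 then ((g m.+1 : {sfun X >-> R}) - (g m : {sfun X >-> R}))%R
  else (g 0%N : {sfun X >-> R}).
have hge n x : (0 <= h n x)%R.
  case: n => [|n] /=; first exact: fun_ge0.
  rewrite subr_ge0; move: (nd_nnsfun_approx measurableT mf (leqnSn n)) => /lefP; exact.
have hsum n x : (\sum_(0 <= k < n.+1) h k x)%R = g n x.
  elim: n => [|n IH]; first by rewrite big_nat1.
  rewrite big_nat_recr//= IH.
  by rewrite -[X in (_ + X)%R]/(g n.+1 x - g n x)%R addrC subrK.
have fE : f = fun x => \sum_(n <oo) (h n x)%:E.
  apply/funext => x; apply/esym/cvg_lim => //.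
  rewrite -cvg_shiftS /=.
  under eq_cvg do rewrite sumEFin hsum.
  by apply: (cvg_nnsfun_approx measurableT mf) => //.
have hok n : nonneg_measurable (EFin \o h n).
  by split => [x|]; [rewrite lee_fin|exact/measurable_EFinP].
rewrite fE (sigma_functional_series h1 hok) (sigma_functional_series h2 hok).
by apply: eq_eseriesr => n _; exact: simple.
Qed.

(** Uniqueness of measures that agree on a generating pi-system. Finiteness is asked on the members
    of the cover [g], so [T1] may be merely sigma-finite. *)
Lemma sigma_functional_unique (G : set (set X)) (g : (set X)^nat)
    (T1 T2 : (X -> \bar R) -> \bar R) :
  sigma_functional T1 -> sigma_functional T2 ->
  measurable = <<s G >> -> setI_closed G -> (forall i, G (g i)) ->
  \bigcup_i g i = setT ->
  (forall D, G D -> T1 (fun x => (\1_D x)%:E) = T2 (fun x => (\1_D x)%:E)) ->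
  (forall i, T1 (fun x => (\1_(g i) x)%:E) < +oo) ->
  forall f, nonneg_measurable f -> T1 f = T2 f.
Proof.
move=> h1 h2 mG GI Gg gT hG gfin.
have mGD D : G D -> measurable D by move=> GD; rewrite mG; exact: sub_sigma_algebra.
apply: (eq_sigma_functional h1 h2) => D mD.
have := @measure_unique _ _ _ G g mG GI Gg gT (functional_measure h1)
  (functional_measure h2).
move=> /(_ _ _ D mD); rewrite /= !functional_measureE//; apply.
  by move=> A GA; rewrite !functional_measureE ?hG//; exact: mGD.
by move=> k; rewrite functional_measureE//; exact: mGD.
Qed.

Lemma sigma_functional_integral (mu : {measure set X -> \bar R}) :
  sigma_functional (fun f => \int[mu]_x f x).
Proof.
split.
- by move=> f [f0 _]; exact: integral_ge0.
- by move=> k f k0 [f0 mf]; rewrite ge0_integralZl_EFin.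
- move=> f hf; rewrite integral_nneseries//.
  + by move=> n; exact: (hf n).2.
  + by move=> n x _; exact: (hf n).1.
Qed.

End sigma_functional.

(** * Operations on countably additive functionals *)

Section sigma_functional_constructions.
Context (R : realType).
Local Open Scope ereal_scope.

Lemma nonneg_measurable_comp d1 d2 (X : measurableType d1) (Y : measurableType d2)
    (phi : X -> Y) (f : Y -> \bar R) :
  measurable_fun [set: X] phi -> nonneg_measurable f ->
  nonneg_measurable (fun x => f (phi x)).
Proof.
by move=> mphi [f0 mf]; split => //; exact: measurableT_comp.
Qed.

Lemma nonneg_measurableM d1 (X : measurableType d1) (f g : X -> \bar R) :
  nonneg_measurable f -> nonneg_measurable g ->
  nonneg_measurable (fun x => f x * g x).
Proof.
move=> [f0 mf] [g0 mg]; split => [x|]; first exact: mule_ge0.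
exact: emeasurable_funM.
Qed.

Lemma sigma_functional_comp d1 d2 (X : measurableType d1) (Y : measurableType d2)
    (phi : X -> Y) (T : (X -> \bar R) -> \bar R) :
  measurable_fun [set: X] phi -> sigma_functional T ->
  sigma_functional (fun f : Y -> \bar R => T (fun x => f (phi x))).
Proof.
move=> mphi hT; split.
- by move=> f hf; apply/(sigma_functional_ge0 hT)/nonneg_measurable_comp.
- by move=> k f k0 hf; rewrite (sigma_functionalZ hT)//; exact: nonneg_measurable_comp.
- move=> f hf; rewrite (sigma_functional_series hT)// => n.
  exact: nonneg_measurable_comp.
Qed.

Lemma sigma_functional_eval d1 (X : measurableType d1) (x : X) :
  sigma_functional (fun f : X -> \bar R => f x).
Proof. by split => // f [f0 _]; exact: f0. Qed.

Lemma sigma_functional_add d1 (X : measurableType d1)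
    (S T : (X -> \bar R) -> \bar R) :
  sigma_functional S -> sigma_functional T ->
  sigma_functional (fun f => S f + T f).
Proof.
move=> hS hT; split.
- by move=> f hf; rewrite adde_ge0 ?(sigma_functional_ge0 hS)
    ?(sigma_functional_ge0 hT).
- move=> k f k0 hf; rewrite (sigma_functionalZ hS)// (sigma_functionalZ hT)//.
  by rewrite ge0_muleDr ?(sigma_functional_ge0 hS) ?(sigma_functional_ge0 hT).
- move=> f hf; rewrite (sigma_functional_series hS)// (sigma_functional_series hT)//.
  rewrite nneseriesD// => n _ _; first exact/(sigma_functional_ge0 hS)/hf.
  exact/(sigma_functional_ge0 hT)/hf.
Qed.

Lemma sigma_functional_scale d1 (X : measurableType d1) (r : R)
    (T : (X -> \bar R) -> \bar R) :
  (0 <= r)%R -> sigma_functional T -> sigma_functional (fun f => r%:E * T f).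
Proof.
move=> r0 hT; split.
- by move=> f hf; rewrite mule_ge0 ?lee_fin ?(sigma_functional_ge0 hT).
- by move=> k f k0 hf; rewrite (sigma_functionalZ hT)// muleCA.
- move=> f hf; rewrite (sigma_functional_series hT)// nneseriesZl// => n _.
  exact/(sigma_functional_ge0 hT)/hf.
Qed.

Lemma sigma_functional_evals d1 (X : measurableType d1) (s : seq X) :
  sigma_functional (fun f : X -> \bar R => \sum_(x <- s) f x).
Proof.
elim: s => [|x s IH].
  rewrite (_ : (fun _ => _) = fun=> 0); last by apply/funext => f; rewrite big_nil.
  split => //; first by move=> *; rewrite mule0.
  by move=> f _; rewrite eseries0.
rewrite (_ : (fun _ => _) = (fun f => f x + \sum_(y <- s) f y)); last first.
  by apply/funext => f; rewrite big_cons.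
exact/sigma_functional_add/IH/sigma_functional_eval.
Qed.

(** Here [S f x] stands for the integral of [f] against a kernel at [x], and the conclusion is the
    composition of [T] with that kernel. *)
Lemma sigma_functional_kernel d1 d2 (X : measurableType d1) (Y : measurableType d2)
    (S : (Y -> \bar R) -> X -> \bar R) (T : (X -> \bar R) -> \bar R) :
  (forall f, nonneg_measurable f -> measurable_fun [set: X] (S f)) ->
  (forall x, sigma_functional (S ^~ x)) -> sigma_functional T ->
  sigma_functional (fun f => T (S f)).
Proof.
move=> mS hS hT.
have okS f : nonneg_measurable f -> nonneg_measurable (S f).
  by move=> hf; split; [move=> x; exact: (sigma_functional_ge0 (hS x))|exact: mS].
split.
- by move=> f hf; apply/(sigma_functional_ge0 hT)/okS.
- move=> k f k0 hf; rewrite -(sigma_functionalZ hT)//; last exact: okS.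
  by congr T; apply/funext => x; rewrite (sigma_functionalZ (hS x)).
- move=> f hf; rewrite -(sigma_functional_series hT); last by move=> n; exact: okS.
  by congr T; apply/funext => x; rewrite (sigma_functional_series (hS x)).
Qed.

Lemma sigma_functional_mul d1 (X : measurableType d1) (g : X -> \bar R)
    (T : (X -> \bar R) -> \bar R) :
  nonneg_measurable g -> sigma_functional T ->
  sigma_functional (fun f => T (fun x => g x * f x)).
Proof.
move=> hg hT.
apply: (sigma_functional_kernel (S := fun f x => g x * f x)) => //.
  by move=> f hf; exact: (nonneg_measurableM hg hf).2.
move=> x; split.
- by move=> f [f0 _]; rewrite mule_ge0// hg.1.
- by move=> k f _ _; rewrite muleCA.
- move=> f hf; apply/esym; case: (g x) (hg.1 x) => [r r0| _|//].
    rewrite nneseriesZl// => n _; exact: (hf n).1.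
  (* An infinite weight: either all terms vanish at [x], or one positive term makes both sides
     infinite. *)
  have fx0 n : 0 <= f n x by exact: (hf n).1.
  have le_series (u : nat -> \bar R) n : (forall k, 0 <= u k) ->
      u n <= \sum_(k <oo) u k.
    move=> u0; rewrite (@nneseriesD1 _ u n)// leeDl//.
    by apply: nneseries_ge0 => k _ _.
  have [h0|] := pselect (forall n, f n x = 0).
    by rewrite !eseries0 ?mule0// => n _ _; rewrite h0 ?mule0.
  move=> /existsNP[n /eqP fn0].
  have fnpos : 0 < f n x by rewrite lt_neqAle eq_sym fn0 fx0.
  rewrite gt0_mulye; last first.
    by rewrite (lt_le_trans fnpos)//; exact: (le_series (f ^~ x)).
  apply/eqP; rewrite eq_le leey/=.
  rewrite -[leLHS](gt0_mulye fnpos).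
  by apply: (le_series (fun n => +oo * f n x)) => k; rewrite mule_ge0.
Qed.

Lemma integral_indic_comp d1 d2 (X : measurableType d1) (Y : measurableType d2)
    (mu : {measure set X -> \bar R}) (phi : X -> Y) (C : set Y) :
  measurable_fun [set: X] phi -> measurable C ->
  \int[mu]_x (\1_C (phi x))%:E = mu (phi @^-1` C).
Proof.
move=> mphi mC; transitivity (\int[mu]_x (\1_(phi @^-1` C) x)%:E) => //.
by rewrite integral_indic ?setIT// -[X in measurable X]setTI; exact: mphi.
Qed.

End sigma_functional_constructions.

(** * Measurability on the space of configurations *)

Section config_measurability.
Context (R : realType) d (E : measurableType d).
Local Notation N := (config R E).
Local Open Scope ereal_scope.

Lemma same_measure_sym (mu nu : {finite_measure set E -> \bar R}) :
  same_measure mu nu -> same_measure nu mu.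
Proof. by move=> h B mB; rewrite h. Qed.

Lemma same_measure_trans (mu nu xi : {finite_measure set E -> \bar R}) :
  same_measure mu nu -> same_measure nu xi -> same_measure mu xi.
Proof. by move=> h k B mB; rewrite h// k. Qed.

(** The sets that do not separate representatives form a sigma-algebra, and the generators of the
    measurable sets are among them. *)
Lemma config_measurable_same (A : set N) (eta zeta : N) :
  measurable A -> same_measure eta zeta -> A eta -> A zeta.
Proof.
move=> mA; move: eta zeta.
suff: measurable `<=` [set A : set N | forall eta zeta : N,
    same_measure eta zeta -> A eta -> A zeta] by exact.
apply: smallest_sub; [split => //=|].
- by move=> B hB eta zeta ez [_ nB]; split => // /(hB _ _ (same_measure_sym ez)).
- by move=> F hF eta zeta ez [i _ Fi]; exists i => //; exact: hF Fi.
- move=> _ [B mB [C mC <-]] eta zeta ez [_ /= etaC]; split => //=.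
  by rewrite -ez.
Qed.

Lemma measurable_fun_same d' (T : measurableType d') (f : N -> T)
    (eta zeta : N) :
  measurable [set f eta] ->
  measurable_fun [set: N] f -> same_measure eta zeta -> f eta = f zeta.
Proof.
move=> m1 mf ez; apply/esym.
have : measurable (f @^-1` [set f eta]) by rewrite -[X in measurable X]setTI; exact: mf.
by move=> /config_measurable_same /(_ ez); apply.
Qed.

Lemma measurable_fun_sameR (f : N -> R) (eta zeta : N) :
  measurable_fun [set: N] f -> same_measure eta zeta -> f eta = f zeta.
Proof. by apply: measurable_fun_same. Qed.

Lemma measurable_fun_samee (f : N -> \bar R) (eta zeta : N) :
  measurable_fun [set: N] f -> same_measure eta zeta -> f eta = f zeta.
Proof. by apply: measurable_fun_same; exact: emeasurable_set1. Qed.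

Lemma measurable_config_eval (B : set E) : measurable B ->
  measurable_fun [set: N] (fun eta : N => eta B).
Proof.
move=> mB _ C mC; rewrite setTI; apply: sub_sigma_algebra.
by exists B => //; exists C => //; rewrite setTI.
Qed.

Lemma measurable_fun_config d' (X : measurableType d') (D : set X) (f : X -> N) :
  (forall B, measurable B -> measurable_fun D (fun x => f x B)) ->
  measurable_fun D f.
Proof.
move=> hf mD; move: (mD).
apply: (@measurability _ _ X N D f _ erefl) => _ [_ [B mB [C mC <-]]] <-.
by rewrite setTI; exact: (hf B mB).
Qed.

Lemma measurable_dirac_config n :
  measurable_fun [set: n.-tuple E] (fun x : n.-tuple E => dirac_config R x).
Proof.
apply: measurable_fun_config => B mB.
rewrite (_ : (fun _ => _) =
    fun x : n.-tuple E => (\sum_(i < n) \1_B (tnth x i))%:E); last first.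
  by apply/funext => x; rewrite /= dirac_sumE big_tuple.
apply/measurable_EFinP; apply: measurable_sum => i.
apply: measurableT_comp; first exact: measurable_indic.
exact: measurable_tnth.
Qed.

Lemma measurable_add_dirac d' (X : measurableType d') (eta : X -> N) (y : X -> E) :
  measurable_fun [set: X] eta -> measurable_fun [set: X] y ->
  measurable_fun [set: X] (fun x => add_dirac (eta x) (y x)).
Proof.
move=> meta my; apply: measurable_fun_config => B mB.
rewrite (_ : (fun _ => _) = fun x => eta x B + (\1_B (y x))%:E); last first.
  by apply/funext => x; rewrite /= /add_dirac_measure measure_addE.
apply: emeasurable_funD.
  exact: (measurableT_comp (measurable_config_eval mB) meta).
apply/measurable_EFinP.
exact: (measurableT_comp (measurable_indic mB) my).
Qed.

(** * Integrals against a configuration depending on a parameter *)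

Section integral_config.
Context d' (X : measurableType d').
Variables (eta : X -> N) (meta : measurable_fun [set: X] eta).

(** The total mass of [eta x] need not be bounded in [x]. Cutting by particle number displays the
    kernel as a series of uniformly finite ones, hence as s-finite, which is what measurability of
    the integral rests on. *)
Let part (n : nat) (x : X) : {measure set E -> \bar R} :=
  if eta x setT == n%:R%:E then (eta x : {measure set E -> \bar R}) else mzero.

Let part_measurable n B : measurable B ->
  measurable_fun [set: X] (part n ^~ B).
Proof.
move=> mB.
rewrite [F in measurable_fun _ F](_ : _ = fun x => if eta x setT == n%:R%:E then eta x B else 0); last first.
  by apply/funext => x; rewrite /part; case: ifP.
have mev C : measurable C -> measurable_fun [set: X] (fun x => eta x C).
  by move=> mC; exact: (measurableT_comp (measurable_config_eval mC) meta).
apply: measurable_fun_ifT => //; last exact: mev.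
apply: measurable_fun_eqe => //; exact: mev.
Qed.

HB.instance Definition _ n := isKernel.Build _ _ _ _ R (part n) (@part_measurable n).

Let part_uub n : measure_fam_uub (part n).
Proof.
exists (n.+1)%:R => x; rewrite /part; case: ifPn => [/eqP h|_].
  by rewrite [ltLHS]h lte_fin ltr_nat.
by rewrite /mzero/= lte_fin.
Qed.

HB.instance Definition _ n := @Kernel_isFinite.Build _ _ _ _ R (part n) (part_uub n).

Definition config_kernel of measurable_fun [set: X] eta :=
  fun x => (eta x : {measure set E -> \bar R}).

Let ck_measurable B : measurable B ->
  measurable_fun [set: X] (config_kernel meta ^~ B).
Proof.
by move=> mB; exact: (measurableT_comp (measurable_config_eval mB) meta).
Qed.

HB.instance Definition _ := isKernel.Build _ _ _ _ R (config_kernel meta) ck_measurable.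

Let ck_sfinite : exists s : (R.-fker X ~> E)^nat,
  forall x B, measurable B -> config_kernel meta x B = kseries s x B.
Proof.
exists (fun n => [the R.-fker X ~> E of part n]) => x B mB.
rewrite /config_kernel /kseries/= /mseries.
(* Only the piece whose index is the total mass [k] contributes to the series. *)
have [k etak] := config_nat (eta x) measurableT.
rewrite (@nneseries_split _ _ 0 k.+1)//.
rewrite add0n big_mkord big_ord_recr /= eseries0 ?adde0.
  rewrite big1 ?add0e; first by rewrite /part etak eqxx.
  move=> i _; rewrite /part etak ifF//; apply/negbTE.
  by rewrite eqe eqr_nat eq_sym neq_ltn ltn_ord.
move=> i ki _; rewrite /part etak ifF//; apply/negbTE.
by rewrite eqe eqr_nat neq_ltn ki.
Qed.

HB.instance Definition _ :=
  @Kernel_isSFinite.Build _ _ _ _ R (config_kernel meta) ck_sfinite.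

Lemma measurable_integral_config (F : X * E -> \bar R) :
  (forall z, 0 <= F z) -> measurable_fun [set: X * E] F ->
  measurable_fun [set: X] (fun x => \int[eta x]_y F (x, y)).
Proof.
by move=> F0 mF;
  exact: (measurable_fun_integral_sfinite_kernel F (config_kernel meta)).
Qed.

End integral_config.

End config_measurability.

(** * Measurable enumeration of the atoms *)

Section borel_config.
Context (R : realType) d (E : measurableType d).
Hypothesis E_borel : borel_space R E.
Local Notation N := (config R E).
Local Open Scope ereal_scope.

Lemma borel_set1 (x : E) : measurable [set x].
Proof.
have [phi [phi_inj mphi _ _]] := E_borel.
rewrite (_ : [set x] = phi @^-1` [set phi x]).
  by rewrite -[X in measurable X]setTI; exact: mphi.
by apply/seteqP; split => [y ->//|y /phi_inj ->].
Qed.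

Lemma borel_diagonal : measurable [set z : E * E | z.1 = z.2].
Proof.
have [phi [phi_inj mphi _ _]] := E_borel.
rewrite (_ : [set _ | _] =
    (fun z => phi z.1 - phi z.2)%R @^-1` [set 0%R]); last first.
  apply/seteqP; split => [z /= ->|z /= /eqP]; first by rewrite subrr.
  by rewrite subr_eq0 => /eqP /phi_inj.
rewrite -[X in measurable X]setTI.
by apply: measurable_funB => //; apply: measurableT_comp.
Qed.

(** Jumps conserve the number of particles, so the dynamics stays in a sector; all uniform bounds
    below are taken on one of them. *)
Definition sector (n : nat) : set N := [set eta | eta setT = n%:R%:E].

Lemma measurable_sector n : measurable (sector n).
Proof.
rewrite -[X in measurable X]setTI.
have := @measurable_config_eval R _ E _ measurableT measurableT [set n%:R%:E].
exact.
Qed.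

Lemma dirac_sum_setT (s : seq E) : dirac_sum s setT = (size s)%:R%:E :> \bar R.
Proof.
rewrite dirac_sumE; congr EFin.
under eq_bigr do rewrite indicT.
by rewrite big_const_seq count_predT iter_addr_0.
Qed.

Lemma sector_dirac (s : seq E) : sector (size s) (dirac_config R s).
Proof. exact: dirac_sum_setT. Qed.

Lemma sector_ex (eta : N) : exists n, sector n eta.
Proof. by have [n etan] := config_nat eta measurableT; exists n. Qed.

Section order_statistics.
Variable phi : E -> R.
Hypotheses (phi_inj : injective phi) (mphi : measurable_fun [set: E] phi)
  (phi01 : range phi `<=` `[0%R, 1%R])
  (phi_img : forall A : set E, measurable A -> measurable (phi @` A)).

Let ray (t : R) : set E := phi @^-1` `]-oo, t].

Let mray t : measurable (ray t).
Proof. by rewrite -[X in measurable X]setTI; exact: mphi. Qed.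

Let le_ray (eta : N) s t : (s <= t)%R -> eta (ray s) <= eta (ray t).
Proof.
move=> st; apply: le_measure; [exact/mem_set/mray|exact/mem_set/mray|].
move=> x; rewrite /ray /= !in_itv/= => /le_trans; exact.
Qed.

(* The atoms of eta are recovered, measurably in eta, as the quantiles of its
   image under phi. *)
Definition order_statistic (eta : N) (i : nat) : R :=
  inf [set t | i%:R%:E < eta (ray t)].

(** The defining property of a quantile. Its nontrivial direction says that the infimum is attained,
    which is right continuity of the distribution function of the image of [eta] under [phi]. The
    inclusion of the range in [0, 1] makes the set of candidates bounded below and nonempty. *)
Let order_statistic_le n (eta : N) i t : sector n eta -> (i < n)%N ->
  (order_statistic eta i <= t)%R <-> i%:R%:E < eta (ray t).
Proof.
move=> etan lin.
have lb : has_lbound [set t | i%:R%:E < eta (ray t)].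
  exists 0%R => s /= hs; rewrite leNgt; apply/negP => s0.
  move: hs; rewrite (_ : ray s = set0) ?measure0 ?lte_fin ?ltr0n// .
    by rewrite ltNge ler0n.
  apply/seteqP; split => // x; rewrite /ray /= in_itv/= => xs.
  have /= := phi01 (imageT phi x).
  by rewrite in_itv/= => /andP[/le_trans/(_ xs)]; rewrite leNgt s0.
split; last by move=> h; apply: ge_inf.
move=> qt.
have ne : [set t | i%:R%:E < eta (ray t)] !=set0.
  exists 1%R => /=; rewrite (_ : ray 1 = setT).
    by rewrite etan lte_fin ltr_nat.
  apply/seteqP; split => // x _; rewrite /ray /= in_itv/=.
  by have /= := phi01 (imageT phi x); rewrite in_itv/= => /andP[].
pose F k := ray (t + k.+1%:R^-1).
have capF : \bigcap_k F k = ray t.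
  apply/seteqP; split => [x hx|x].
    rewrite /ray /= in_itv/=; apply/ler_addgt0Pr => e e0.
    have /= := hx (Num.truncn e^-1) I.
    rewrite /F /ray /= in_itv/= => /le_trans; apply.
    rewrite lerD2l -[leRHS]invrK lef_pV2 ?posrE ?invr_gt0//.
    by rewrite ltW// truncnS_gt.
  move=> hx k _; move: hx; rewrite /F /ray /= !in_itv/= => /le_trans; apply.
  by rewrite lerDl.
have cvF : eta \o F @ \oo --> eta (ray t).
  rewrite -capF; apply: nonincreasing_cvg_mu => //.
  - by rewrite ltey_eq fin_num_measure//; exact: mray.
  - by move=> k; exact: mray.
  - by rewrite capF; exact: mray.
  - move=> k l kl; apply/subsetPset => x; rewrite /F /ray /= !in_itv/= => /le_trans.
    by apply; rewrite lerD2l lef_pV2 ?posrE// ler_nat ltnS.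
(* Values are integers, so exceeding [i] means being at least [i.+1], a closed condition that
   survives the limit in [k]. *)
have Fi k : i.+1%:R%:E <= eta (F k).
  have k0 : (0 < k.+1%:R^-1 :> R)%R by rewrite invr_gt0.
  have [s /= si sq] := inf_adherent k0 (conj ne lb).
  have [m etam] := config_nat eta (mray s).
  apply: (@le_trans _ _ (eta (ray s))).
    by move: si; rewrite etam lte_fin ltr_nat lee_fin ler_nat.
  apply: le_ray; rewrite (le_trans (ltW sq))// lerD2r; exact: qt.
have : i.+1%:R%:E <= eta (ray t).
  by apply: (cvge_to_ge cvF); near=> k; exact: Fi.
by apply: lt_le_trans; rewrite lte_fin ltr_nat.
Unshelve. all: by end_near. Qed.

Let count_lt (m n : nat) : (\sum_(i < n) ~~ (i < m))%N = (n - m)%N.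
Proof.
elim: n => [|n IH]; first by rewrite big_ord0.
by rewrite big_ord_recr/= IH; case: ltnP => /=; lia.
Qed.

(** The image of [eta] under [phi] is the sum of the Dirac masses at its [n] quantiles; open
    half-lines suffice to check this. *)
Let integral_order_statistic n (eta : N) (f : R -> \bar R) : sector n eta ->
  nonneg_measurable f ->
  \int[eta]_x f (phi x) = \sum_(q <- [seq order_statistic eta i | i <- iota 0 n]) f q.
Proof.
move=> etan hf.
pose T1 (f : R -> \bar R) := \int[eta]_x f (phi x).
have h1 : sigma_functional T1.
  exact: (sigma_functional_comp mphi (sigma_functional_integral eta)).
have h2 := @sigma_functional_evals R _ _ [seq order_statistic eta i | i <- iota 0 n].
have U := @sigma_functional_unique R _ _ (@RGenOInfty.G R)
  (fun k => `](- k%:R)%R, +oo[%classic) _ _ h1 h2.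
apply: U => //.
- exact: RGenOInfty.measurableE.
- move=> _ _ [x ->] [y ->]; exists (Num.max x y).
  by apply/seteqP; split => [z|z]; rewrite /= !in_itv/= !andbT gt_max => /andP.
- by move=> k; eexists; reflexivity.
- apply/seteqP; split => // x _; exists (Num.truncn `|x|).+1 => //=.
  rewrite in_itv/= andbT ltrNl (le_lt_trans (ler_norm _))// normrN.
  exact: truncnS_gt.
- move=> _ [t ->]; rewrite /T1.
  rewrite integral_indic_comp//.
  (* With [g] atoms up to level [t], the quantiles above [t] are those with index [g] to [n - 1]. *)
  have [g etag] := config_nat eta (mray t).
  have gn : (g <= n)%N.
    rewrite -(ler_nat R) -lee_fin -etag -etan.
    by apply: le_measure => //; exact/mem_set.
  transitivity ((n - g)%:R%:E : \bar R).
    have /= := measureU eta (mray t) (measurableC (mray t)) (setICr _).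
    rewrite setUv etan etag natrB// EFinB => ->.
    rewrite addeAC subee// add0e; congr (config_val eta _).
    apply/seteqP; split => x; rewrite /ray /= !in_itv/= andbT.
      by rewrite leNgt => ->.
    by rewrite leNgt => /negP; rewrite negbK.
  rewrite big_map -count_lt natr_sum -sumEFin.
  rewrite -[in RHS](subn0 n) -/(index_iota 0 n) big_mkord.
  apply: eq_bigr => i _; congr EFin; rewrite indicE; congr (nat_of_bool _)%:R.
  apply/negP/idP => h.
    apply/mem_set => /=; rewrite in_itv/= andbT ltNge; apply/negP => h'; apply: h.
    by move/(order_statistic_le _ etan (ltn_ord i)) : h'; rewrite etag lte_fin ltr_nat.
  move=> ig; move/set_mem : h; rewrite /= in_itv/= andbT ltNge => /negP; apply.
  by apply/(order_statistic_le _ etan (ltn_ord i)); rewrite etag lte_fin ltr_nat.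
- move=> k; rewrite /T1 integral_indic_comp// ltey_eq fin_num_measure//.
  by rewrite -[X in measurable X]setTI; exact: mphi.
Qed.

Definition order_atom (eta : N) (i : nat) : E :=
  xget point [set x | phi x = order_statistic eta i].

(** The image of [eta] gives the range of [phi] its full mass [n]. If one of the [n] quantiles
    missed the range, at most [n - 1] of them could account for that mass. *)
Let order_atomE n (eta : N) i : sector n eta -> (i < n)%N ->
  phi (order_atom eta i) = order_statistic eta i.
Proof.
move=> etan lin; rewrite /order_atom; case: xgetP => [x -> //|no].
have mr : measurable (range phi) by exact: phi_img.
have := integral_order_statistic etan (nonneg_measurable_indic R mr).
rewrite integral_indic_comp//.
rewrite (_ : phi @^-1` _ = setT); last first.
  by apply/seteqP; split => // x _; exists x.
rewrite /= etan big_map sumEFin -[in iota 0 n](subn0 n) -/(index_iota 0 n) big_mkord.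
case=> sumE.
have : (n%:R <= n%:R :> R)%R by [].
rewrite {2}sumE (bigD1 (Ordinal lin))//= indicE memNset; last first.
  by move=> [x _ hx]; exact: (no x).
rewrite add0r leNgt => /negP[].
apply: (@le_lt_trans _ _ (\sum_(j < n | j != Ordinal lin) 1)%R).
  by apply: ler_sum => j _; rewrite indicE; case: (_ \in _).
rewrite sumr_const ltr_nat cardC1 card_ord.
by case: (n) lin.
Qed.

Let order_atom_same n (eta : N) : sector n eta ->
  same_measure eta (dirac_sum [seq order_atom eta i | i <- iota 0 n]).
Proof.
move=> etan B mB; rewrite /= dirac_sumE big_map.
have := integral_order_statistic etan (nonneg_measurable_indic R (phi_img mB)).
rewrite integral_indic_comp//; last exact: phi_img.
rewrite (_ : phi @^-1` _ = B); last first.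
  by apply/seteqP; split => [x [y By /phi_inj <-]//|x Bx]; exists x.
move=> ->; rewrite big_map sumEFin; congr EFin; apply: eq_big_seq => i.
rewrite mem_iota/= add0n => lin; rewrite !indicE; congr (nat_of_bool _)%:R.
rewrite -(order_atomE etan lin); apply/idP/idP => /set_mem h; apply/mem_set.
  by case: h => x Bx /phi_inj <-.
by exists (order_atom eta i).
Qed.

(** Since [phi] is injective with measurable images, membership of the atom in [B] is membership of
    the quantile in the image of [B], and the quantile is measurable by [order_statistic_le]. *)
Let measurable_order_atom n i : (i < n)%N ->
  measurable_fun (sector n) (order_atom ^~ i).
Proof.
move=> lin mD B mB.
rewrite (_ : _ `&` _ = sector n `&` (order_statistic ^~ i) @^-1` (phi @` B)); last first.
  apply/seteqP; split => eta [etan] /=.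
    by move=> Ba; split => //=; exists (order_atom eta i); rewrite // (order_atomE etan).
  move=> [x Bx hx]; split => //=.
  suff -> : order_atom eta i = x by [].
  by apply: phi_inj; rewrite hx (order_atomE etan lin).
suff: measurable_fun (sector n) (order_statistic ^~ i).
  by apply => //; exact: phi_img.
apply: (measurability _ (@RGenOInfty.measurableE R)) => _ [_ [t ->]] <-.
rewrite (_ : _ `&` _ = sector n `\` [set eta | i%:R%:E < eta (ray t)]); last first.
  apply/seteqP; split => eta [etan] /=; rewrite in_itv/= andbT.
    move=> h; split => // /(order_statistic_le t etan lin).2.
    by rewrite leNgt h.
  by move=> h; split => //; rewrite ltNge; apply/negP => /(order_statistic_le t etan lin).1.
apply: measurableD; first exact: measurable_sector.
rewrite -[X in measurable X]setTI.
by apply: measurable_lte => //; exact: measurable_config_eval.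
Qed.

Lemma measurable_sort_ex : exists s : forall n, N -> n.-tuple E, forall n,
  measurable_fun [set: N] (s n) /\
  forall eta, sector n eta -> same_measure eta (dirac_sum (s n eta)).
Proof.
(* Off the sector the tuple is constant, which makes it measurable on the whole space. *)
exists (fun n (eta : N) =>
  [tuple (if eta setT == n%:R%:E then order_atom eta i else point) | i < n]) => n.
split.
  apply/measurable_fun_tnthP => i.
  apply: (eq_measurable_fun (fun eta : N =>
    if eta setT == n%:R%:E then order_atom eta i else point)).
    by move=> eta _ /=; rewrite tnth_mktuple.
  apply: measurable_fun_if => //.
    by apply: measurable_fun_eqe => //; exact: measurable_config_eval.
  rewrite setTI (_ : _ @^-1` _ = sector n); first exact: measurable_order_atom.
  by apply/seteqP; split => eta /eqP.
move=> eta etan; apply: (same_measure_trans (order_atom_same etan)).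
move=> B mB; congr (dirac_sum _ B); rewrite etan eqxx.
by rewrite /= -[in LHS](val_enum_ord n) -map_comp.
Qed.

End order_statistics.

Lemma measurable_sort : exists s : forall n, N -> n.-tuple E, forall n,
  measurable_fun [set: N] (s n) /\
  forall eta, sector n eta -> same_measure eta (dirac_sum (s n eta)).
Proof.
by have [phi [phi_inj mphi phi01 phi_img]] := E_borel; exact: measurable_sort_ex phi_img.
Qed.

Lemma same_atoms (eta : N) : same_measure eta (dirac_sum (atoms eta)).
Proof.
have [s hs] := measurable_sort; have [n etan] := sector_ex eta.
have ex : exists t, same_measure eta (dirac_sum t).
  by exists (s n eta); exact: (hs n).2.
exact: (@xgetPex _ [::] [set t | same_measure eta (dirac_sum t)] ex).
Qed.

Lemma dirac_sum_set1 (s : seq E) x :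
  dirac_sum s [set x] = (count_mem x s)%:R%:E :> \bar R.
Proof.
rewrite dirac_sumE -sum1_count natr_sum [in RHS]big_mkcond /=; congr EFin.
apply: eq_bigr => y _; rewrite indicE.
by case: eqP => [->|/eqP xy]; [rewrite mem_set|rewrite memNset//; exact/eqP].
Qed.

(** Multiplicities are read off on singletons, which are measurable in a Borel space. *)
Lemma same_dirac_sum_perm (s s' : seq E) :
  same_measure (dirac_sum s : {finite_measure set E -> \bar R}) (dirac_sum s') ->
  perm_eq s s'.
Proof.
move=> ss; apply/allP => x _; apply/eqP.
have /= := ss _ (borel_set1 x); rewrite !dirac_sum_set1 => -[] /eqP.
by rewrite eqr_nat => /eqP.
Qed.

Lemma perm_same_dirac_sum (s s' : seq E) : perm_eq s s' ->
  same_measure (dirac_sum s : {finite_measure set E -> \bar R}) (dirac_sum s').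
Proof. by move=> ss B mB; rewrite /= !dirac_sumE (perm_big _ ss). Qed.

Lemma size_atoms (eta : N) n : sector n eta -> size (atoms eta) = n.
Proof.
move=> etan; apply/eqP; rewrite -(eqr_nat R) -eqe -etan.
by rewrite (same_atoms eta measurableT) /= dirac_sum_setT.
Qed.

(** On each sector [g] factors through the measurable enumeration of the atoms, so measurability can
    be tested on tuples. *)
Lemma measurable_config_tuple d' (T : measurableType d') (g : N -> T) :
  (forall eta zeta : N, same_measure eta zeta -> g eta = g zeta) ->
  (forall n, measurable_fun [set: n.-tuple E]
    (fun x : n.-tuple E => g (dirac_config R x))) ->
  measurable_fun [set: N] g.
Proof.
move=> gsame mg; have [s hs] := measurable_sort.
have -> : [set: N] = \bigcup_n sector n.
  by apply/seteqP; split => // eta _; have [n etan] := sector_ex eta; exists n.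
apply/measurable_fun_bigcup => n; first exact: measurable_sector.
apply: (eq_measurable_fun (fun eta => g (dirac_config R (s n eta)))).
  by move=> eta /set_mem etan; apply: gsame; apply: same_measure_sym; exact: (hs n).2.
apply: (@measurable_funS _ _ _ _ setT) => //.
exact: (measurableT_comp (mg n) (hs n).1).
Qed.

End borel_config.

(** * Removals, jumps and factorial sums on lists *)

Section removal_sums.
Context (T : eqType) (R : comNzRingType).
Implicit Types (s u : seq T) (x y z : T).

Lemma sum_rem (g : T -> R) s x : x \in s ->
  \sum_(z <- rem x s) g z = \sum_(z <- s) g z - g x.
Proof.
by move=> xs; rewrite [in RHS](perm_big _ (perm_to_rem xs)) big_cons/= [RHS]addrC addKr.
Qed.

(** Both sides are the full double sum over [s] minus its diagonal. *)
Lemma sum_rem_swap (g : T -> T -> R) s :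
  \sum_(x <- s) \sum_(z <- rem x s) g x z =
  \sum_(z <- s) \sum_(x <- rem z s) g x z.
Proof.
rewrite (eq_big_seq (fun x => \sum_(z <- s) g x z - g x x)); last first.
  by move=> x xs; rewrite sum_rem.
rewrite [RHS](eq_big_seq (fun z => \sum_(x <- s) g x z - g z z)); last first.
  by move=> x xs; rewrite (sum_rem (g ^~ x)).
by rewrite !sumrB exchange_big.
Qed.

Lemma perm_rem s s' x : perm_eq s s' -> perm_eq (rem x s) (rem x s').
Proof.
move=> ss; have [xs|xs] := boolP (x \in s); last first.
  by rewrite !rem_id// -(perm_mem ss).
rewrite -(perm_cons x) (perm_trans _ (perm_to_rem (_ : x \in s')))//.
  by rewrite (perm_trans _ ss)// perm_sym perm_to_rem.
by rewrite -(perm_mem ss).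
Qed.

Lemma perm_rem_cons s x z : x \in s -> z \in rem x s ->
  [/\ perm_eq (rem z s) (x :: rem z (rem x s)), x \in rem z s &
      perm_eq (rem x (rem z s)) (rem z (rem x s))].
Proof.
move=> xs zs; have zs' : z \in s by exact: mem_rem zs.
have h : perm_eq (rem z s) (x :: rem z (rem x s)).
  rewrite -(perm_cons z) (perm_trans (_ : perm_eq _ s))//.
    by rewrite perm_sym perm_to_rem.
  rewrite (perm_trans (perm_to_rem xs))// (perm_trans (_ : perm_eq _ (x :: z :: rem z (rem x s))))//.
    by rewrite perm_cons perm_to_rem.
  by rewrite (perm_catCA [:: x] [:: z]).
have xrem : x \in rem z s by rewrite (perm_mem h) mem_head.
split => //; rewrite -(perm_cons x) (perm_trans _ h)// perm_sym perm_to_rem//.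
Qed.

Section generator_commutation.
Variables (I : T -> (T -> R) -> R) (c : T -> T -> R) (phi : seq T -> R).
Hypothesis c_sym : forall x y, c x y = c y x.
Hypothesis phi_perm : forall s s', perm_eq s s' -> phi s = phi s'.
Hypothesis I_linear : forall x u,
  I x (fun y => phi u + \sum_(z <- u) phi (y :: rem z u)) =
  phi u * I x (fun=> 1) + \sum_(z <- u) I x (fun y => phi (y :: rem z u)).

Definition seq_removal (psi : seq T -> R) s := \sum_(x <- s) psi (rem x s).

(** The gain part of the generator on lists of atoms. [I x psi] abstracts the integral of
    [psi y * c x y] against alpha, and the second sum is the attraction by the particles; as in the
    generator, [y] also runs through [x] itself. The value at the constant 1 is the total rate. *)
Definition seq_jump (psi : seq T -> R) s := \sum_(x <- s)
  (I x (fun y => psi (y :: rem x s)) + \sum_(y <- s) psi (y :: rem x s) * c x y).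

Let b x s := I x (fun=> 1) + \sum_(y <- s) c x y.

Let seq_jump1 s : seq_jump (fun=> 1) s = \sum_(x <- s) b x s.
Proof.
by apply: eq_bigr => x _; congr (_ + _); apply: eq_bigr => y _; rewrite mul1r.
Qed.

Let seq_removal_cons y u :
  seq_removal phi (y :: u) = phi u + \sum_(z <- u) phi (y :: rem z u).
Proof.
rewrite /seq_removal big_cons /= eqxx; congr (_ + _).
apply: eq_big_seq => z zu; apply: phi_perm => /=.
by case: eqP => [->|_//]; exact: perm_to_rem.
Qed.

(** Let [x] jump and [z] be removed. Both orders give the same term, except that once [z] is gone
    [x] can no longer jump onto it. The defect is [phi (rem x s) * c x z - c x z * phi (rem z s)],
    and its sum over all pairs vanishes because [c] is symmetric. *)
Lemma seq_removal_generator s :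
  seq_jump (seq_removal phi) s - seq_jump (fun=> 1) s * seq_removal phi s =
  seq_removal (fun u => seq_jump phi u - seq_jump (fun=> 1) u * phi u) s.
Proof.
pose X x z := I x (fun y => phi (y :: rem z (rem x s))).
pose Y x z := \sum_(y <- s) phi (y :: rem z (rem x s)) * c x y.
(* The summand [phi (rem x s) * b x s] removes the very particle that has jumped; it returns in
   [lhs2] as the term where the removed particle is [x], and cancels. *)
have lhs1 : seq_jump (seq_removal phi) s =
    \sum_(x <- s) (phi (rem x s) * b x s + \sum_(z <- rem x s) (X x z + Y x z)).
  apply: eq_bigr => x _.
  rewrite (_ : (fun y => seq_removal phi (y :: rem x s)) = fun y =>
      phi (rem x s) + \sum_(z <- rem x s) phi (y :: rem z (rem x s))); last first.
    by apply/funext => y; rewrite seq_removal_cons.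
  rewrite I_linear big_split/= /b mulrDr -!addrA; congr (_ + _).
  rewrite addrCA; congr (_ + _).
  rewrite (eq_bigr (fun y => phi (rem x s) * c x y +
      \sum_(z <- rem x s) phi (y :: rem z (rem x s)) * c x y)); last first.
    by move=> y _; rewrite seq_removal_cons mulrDl mulr_suml.
  by rewrite big_split/= -mulr_sumr /Y exchange_big.
have lhs2 : seq_jump (fun=> 1) s * seq_removal phi s = \sum_(x <- s)
    (phi (rem x s) * b x s + \sum_(z <- rem x s) b x s * phi (rem z s)).
  rewrite seq_jump1 mulr_suml; apply: eq_big_seq => x xs.
  rewrite -mulr_sumr (sum_rem (fun z => phi (rem z s)))//.
  by rewrite mulrBr addrCA [phi _ * _]mulrC subrr addr0.
have rhs : seq_removal (fun u => seq_jump phi u - seq_jump (fun=> 1) u * phi u) s =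
    \sum_(x <- s) \sum_(z <- rem x s) (X x z + (Y x z - phi (rem x s) * c x z) -
      (b x s - c x z) * phi (rem z s)).
  rewrite sum_rem_swap; apply: eq_big_seq => z zs.
  rewrite seq_jump1 mulr_suml -sumrB; apply: eq_big_seq => x xz.
  have xs := mem_rem xz; have [zxs pxz] : z \in rem x s /\
      perm_eq (rem x (rem z s)) (rem z (rem x s)).
    by have [_ ? ?] := perm_rem_cons zs xz; rewrite perm_sym.
  have E y : phi (y :: rem x (rem z s)) = phi (y :: rem z (rem x s)).
    by apply: phi_perm; rewrite perm_cons.
  congr (_ + _ - _).
  - by rewrite /X; congr (I x _); apply/funext => y.
  - rewrite (eq_bigr (fun y => phi (y :: rem z (rem x s)) * c x y)); last first.
      by move=> y _; rewrite E.
    rewrite (sum_rem (fun y => phi (y :: rem z (rem x s)) * c x y))//.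
    congr (_ - _ * _); apply: phi_perm.
    by rewrite perm_sym perm_to_rem.
  - by rewrite /b (sum_rem (c x))// addrA.
rewrite lhs1 lhs2 rhs -sumrB.
apply/eqP; rewrite -subr_eq0 -sumrB.
rewrite (eq_bigr (fun x => \sum_(z <- rem x s)
    (phi (rem x s) * c x z - c x z * phi (rem z s)))); last first.
  move=> x _; rewrite opprD addrACA subrr add0r -!sumrB.
  by apply: eq_bigr => z _; ring.
rewrite (eq_bigr (fun x => \sum_(z <- rem x s) phi (rem x s) * c x z -
    \sum_(z <- rem x s) c x z * phi (rem z s))); last by move=> x _; rewrite sumrB.
rewrite sumrB [X in X - _]sum_rem_swap subr_eq0; apply/eqP.
by apply: eq_bigr => z _; apply: eq_bigr => x _; rewrite mulrC c_sym.
Qed.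

End generator_commutation.

(** * Selections with and without replacement *)

Section factorial_sums.
Variable x0 : T.

(** Ordered selections without replacement, the list form of the factorial measure; [power_sum] is
    the version with replacement, for the power of the measure. The recursion lets identities be
    proved by drawing one entry at a time. *)
Fixpoint factorial_sum n (F : seq T -> R) s : R :=
  if n is m.+1 then
    \sum_(x <- s) factorial_sum m (fun u => F (x :: u)) (rem x s)
  else F [::].

Fixpoint power_sum n (F : seq T -> R) s : R :=
  if n is m.+1 then \sum_(x <- s) power_sum m (fun u => F (x :: u)) s
  else F [::].

Lemma eq_factorial_sum n (F G : seq T -> R) s :
  (forall u, size u = n -> F u = G u) -> factorial_sum n F s = factorial_sum n G s.
Proof.
elim: n F G s => [|n IH] F G s FG /=; first exact: FG.
by apply: eq_bigr => x _; apply: IH => u un; rewrite FG//= un.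
Qed.

Lemma eq_power_sum n (F G : seq T -> R) s :
  (forall u, size u = n -> F u = G u) -> power_sum n F s = power_sum n G s.
Proof.
elim: n F G => [|n IH] F G FG /=; first exact: FG.
by apply: eq_bigr => x _; apply: IH => u un; rewrite FG//= un.
Qed.

Lemma perm_factorial_sum n (F : seq T -> R) s s' :
  perm_eq s s' -> factorial_sum n F s = factorial_sum n F s'.
Proof.
elim: n F s s' => [//|n IH] F s s' ss /=.
by rewrite (perm_big _ ss)/=; apply: eq_bigr => x _; apply/IH/perm_rem.
Qed.

Lemma factorial_sumZ n (a : R) (F : seq T -> R) s :
  factorial_sum n (fun u => a * F u) s = a * factorial_sum n F s.
Proof.
elim: n F s => [//|n IH] F s /=.
by rewrite mulr_sumr; apply: eq_bigr => x _; rewrite -IH.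
Qed.

(** A selection of [n] entries survives the removal of any of the [size s - n] entries outside
    it. *)
Lemma factorial_sum_removal n (F : seq T -> R) s :
  \sum_(z <- s) factorial_sum n F (rem z s) =
  ((size s)%:R - n%:R) * factorial_sum n F s.
Proof.
elim: n F s => [|n IH] F s /=.
  by rewrite subr0 big_const_seq count_predT iter_addr_0 mulr_natl.
transitivity (\sum_(x <- s) \sum_(z <- rem x s)
    factorial_sum n (fun u => F (x :: u)) (rem z (rem x s))).
  rewrite [RHS]sum_rem_swap; apply: eq_big_seq => z zs; apply: eq_big_seq => x xz.
  by apply: perm_factorial_sum; have [_ _] := perm_rem_cons zs xz; rewrite perm_sym.
rewrite mulr_sumr; apply: eq_big_seq => x xs; rewrite IH size_rem//.
congr (_ * _); rewrite -subn1 natrB; last by case: (s) xs.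
by rewrite -[in RHS]natr1; ring.
Qed.

(** An entry [x] drawn independently of a selection is either new or one of the [n] selected
    ones. *)
Lemma sum_factorial_sum n (H : T -> seq T -> R) s :
  \sum_(x <- s) factorial_sum n (H x) s =
  \sum_(x <- s) factorial_sum n (H x) (rem x s) +
  \sum_(j < n) factorial_sum n (fun u => H (nth x0 u j) u) s.
Proof.
elim: n H s => [|n IH] H s /=; first by rewrite big_ord0 addr0.
rewrite exchange_big/=.
rewrite (eq_big_seq (fun z => factorial_sum n (fun u => H z (z :: u)) (rem z s) +
  (\sum_(x <- rem z s) factorial_sum n (fun u => H x (z :: u)) (rem x (rem z s)) +
   \sum_(j < n) factorial_sum n (fun u => H (nth x0 u j) (z :: u)) (rem z s)))); last first.
  move=> z zs; rewrite -(IH (fun x u => H x (z :: u))).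
  by rewrite (perm_big _ (perm_to_rem zs)) big_cons.
rewrite !big_split/= addrCA; congr (_ + _).
  rewrite [RHS]sum_rem_swap; apply: eq_big_seq => z zs; apply: eq_big_seq => x xz.
  by apply: perm_factorial_sum; have [_ _] := perm_rem_cons zs xz; rewrite perm_sym.
by rewrite big_ord_recl/= exchange_big.
Qed.

Lemma factorial_sum_size n (F : seq T -> R) s :
  (forall u v, perm_eq u v -> F u = F v) -> size s = n ->
  factorial_sum n F s = n`!%:R * F s.
Proof.
elim: n F s => [|n IH] F s Fp /=; first by move/size0nil ->; rewrite mul1r.
move=> sn; rewrite (eq_big_seq (fun=> n`!%:R * F s)); last first.
  move=> x xs; rewrite IH.
  - by congr (_ * _); apply: Fp; rewrite perm_sym perm_to_rem.
  - by move=> u v uv; apply: Fp; rewrite perm_cons.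
  - by rewrite size_rem// sn.
rewrite big_const_seq count_predT iter_addr_0 sn -mulrnAl -mulrnA.
by rewrite factS mulnC.
Qed.

Definition reindex_seq (l : seq nat) (w : seq T) := [seq nth x0 w j | j <- l].

Lemma reindex_seq_iota n w : size w = n -> reindex_seq (iota 0 n) w = w.
Proof. by move=> <-; rewrite /reindex_seq map_nth_iota0 ?take_size. Qed.

(* A triple (a, k, l) encodes the term a * sum k (F \o reindex_seq l). *)
Definition lower_terms n (e : seq (R * nat * seq nat)) :=
  forall t, t \in e ->
    [/\ (t.1.2 < n)%N, size t.2 = n & all (ltn^~ t.1.2) t.2].

Definition expand (sum : nat -> (seq T -> R) -> seq T -> R) e F s :=
  \sum_(t <- e) t.1.1 * sum t.1.2 (fun w => F (reindex_seq t.2 w)) s.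

(** Puts a fresh variable in front of a term; the former variables move up by one. *)
Let shift (t : R * nat * seq nat) := (t.1.1, t.1.2.+1, 0%N :: map S t.2).

Let lower_shift n e : lower_terms n e -> lower_terms n.+1 (map shift e).
Proof.
move=> he _ /mapP[t te ->]; have [kn ln la] := he t te.
split => //=; first by rewrite size_map ln.
by rewrite all_map; apply: sub_all la.
Qed.

(** The terms in which the additional first entry coincides with the [j]-th of [n] distinct
    variables. *)
Let diag n : seq (R * nat * seq nat) :=
  [seq (1, n, val j :: iota 0 n) | j <- enum 'I_n].

Let lower_diag n : lower_terms n.+1 (diag n).
Proof.
move=> _ /mapP[j _ ->]; split => //=; first by rewrite size_iota.
by rewrite ltn_ord; apply/allP => i; rewrite mem_iota.
Qed.

(** The same coincidence inside the terms of [e]: the first entry repeats the variable at position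
    [j], so the number of variables does not grow. *)
Let dup n (e : seq (R * nat * seq nat)) : seq (R * nat * seq nat) :=
  [seq (t.1.1, t.1.2, nth 0%N t.2 (val j) :: t.2) | j <- enum 'I_n, t <- e].

Let lower_dup n e : lower_terms n e -> lower_terms n.+1 (dup n e).
Proof.
move=> he _ /allpairsP[[j u] /= [_ ue ->]].
have [kn ln la] := he u ue; split => //=; [exact: ltnW|by rewrite ln|].
by rewrite la andbT; move/allP: la; apply; rewrite mem_nth// ln.
Qed.

Let lower_cat n e e' : lower_terms n e -> lower_terms n e' -> lower_terms n (e ++ e').
Proof. by move=> he he' t; rewrite mem_cat => /orP[/he|/he']. Qed.

Let opp (e : seq (R * nat * seq nat)) := [seq (- t.1.1, t.1.2, t.2) | t <- e].

Let lower_opp n e : lower_terms n e -> lower_terms n (opp e).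
Proof. by move=> he _ /mapP[t /he ? ->]. Qed.

Let expand_cat sum e e' F s :
  expand sum (e ++ e') F s = expand sum e F s + expand sum e' F s.
Proof. by rewrite /expand big_cat. Qed.

Let expand_opp sum e F s : expand sum (opp e) F s = - expand sum e F s.
Proof. by rewrite /expand big_map -sumrN; apply: eq_bigr => t _; rewrite mulNr. Qed.

Let expand_diag sum n F s : expand sum (diag n) F s =
  \sum_(j < n) sum n (fun w => F (reindex_seq (val j :: iota 0 n) w)) s.
Proof.
by rewrite /expand big_map big_enum/=; apply: eq_bigr => j _; rewrite mul1r.
Qed.

Let expand_dup sum n e F s : expand sum (dup n e) F s =
  \sum_(j < n) \sum_(t <- e) t.1.1 *
    sum t.1.2 (fun w => F (reindex_seq (nth 0%N t.2 (val j) :: t.2) w)) s.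
Proof. by rewrite /expand big_allpairs_dep big_enum. Qed.

Let expand_shift_power e F s : expand power_sum (map shift e) F s =
  \sum_(x <- s) expand power_sum e (fun u => F (x :: u)) s.
Proof.
rewrite /expand big_map exchange_big/=; apply: eq_bigr => t _.
rewrite mulr_sumr; apply: eq_bigr => x _; congr (_ * _).
by apply: eq_power_sum => u _; rewrite /reindex_seq -map_comp.
Qed.

Let head_dup n j (F : seq T -> R) u : size u = n -> (j < n)%N ->
  F (nth x0 u j :: u) = F (reindex_seq (j :: iota 0 n) u).
Proof. by move=> un jn; rewrite -[in RHS]un /= -/(reindex_seq _ _) reindex_seq_iota. Qed.

Lemma factorial_sum_expansion n : exists e, lower_terms n e /\
  forall F s, factorial_sum n F s = power_sum n F s + expand power_sum e F s.
Proof.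
elim: n => [|n [e [he IH]]].
  by exists [::]; split => // F s; rewrite /expand big_nil addr0.
exists (map shift e ++ (opp (diag n) ++ opp (dup n e))); split.
  apply: lower_cat; first exact: lower_shift.
  by apply: lower_cat; apply: lower_opp; [exact: lower_diag|exact: lower_dup].
move=> F s; rewrite !expand_cat !expand_opp expand_diag expand_dup expand_shift_power.
(* Adding the diagonal sums to both sides turns the left one into a sum over unrestricted [x], to
   which the induction hypothesis applies. *)
apply: (addIr (\sum_(j < n) factorial_sum n (fun u => F (nth x0 u j :: u)) s)).
rewrite -(sum_factorial_sum n (fun x u => F (x :: u))).
rewrite (eq_bigr _ (fun x _ => IH _ _)) big_split/= -[RHS]addrA; congr (_ + _).
rewrite -!addrA -[LHS]addr0; congr (_ + _); apply/esym.
rewrite addrA -opprD addrC -big_split/= -sumrB big1// => j _.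
(* The diagonal sums are factorial sums of degree [n] themselves; their own expansions are the
   [diag] and [dup] terms. *)
rewrite (eq_factorial_sum (G := fun w => F (reindex_seq (val j :: iota 0 n) w))).
  rewrite IH; apply/eqP; rewrite subr_eq0; apply/eqP; congr (_ + _).
  apply: eq_big_seq => t /he [_ tn _]; congr (_ * _); apply: eq_power_sum => u _.
  rewrite -head_dup ?size_map ?ltn_ord//; congr (F (_ :: _)).
  by rewrite (nth_map 0%N) ?tn ?ltn_ord.
by move=> u un; exact: head_dup.
Qed.

Lemma power_sum_expansion n : exists e, lower_terms n e /\
  forall F s, power_sum n F s = factorial_sum n F s + expand factorial_sum e F s.
Proof.
elim: n => [|n [e [he IH]]].
  by exists [::]; split => // F s; rewrite /expand big_nil addr0.
(* In this direction the coincidence arises inside a factorial sum with [t.1.2] variables, so the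
   new entry may equal any of these, not only those listed in [t.2]. *)
pose dup' := [seq (t.1.1, t.1.2, j :: t.2) | t <- e, j <- iota 0 t.1.2].
exists (diag n ++ (map shift e ++ dup')); split.
  apply: lower_cat; [exact: lower_diag|apply: lower_cat; first exact: lower_shift].
  move=> _ /allpairsPdep[t [j [/he[kn ln la] + ->]]]; rewrite mem_iota/= add0n => jk.
  by split => //=; [exact: ltnW|rewrite ln|rewrite jk].
move=> F s; rewrite !expand_cat expand_diag /=.
rewrite (eq_bigr _ (fun x _ => IH _ _)) big_split/=.
rewrite (sum_factorial_sum n (fun x u => F (x :: u))) -[LHS]addrA; congr (_ + (_ + _)).
  apply: eq_bigr => j _; apply: eq_factorial_sum => u un; exact: head_dup.
rewrite /expand exchange_big/= big_map big_allpairs_dep/= -big_split/=.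
apply: eq_bigr => t _; rewrite -mulr_sumr.
rewrite (sum_factorial_sum _ (fun x u => F (x :: reindex_seq t.2 u))) mulrDr.
congr (_ + _).
  congr (_ * _); apply: eq_bigr => x _; apply: eq_factorial_sum => u _.
  by rewrite /reindex_seq/= -map_comp.
rewrite mulr_sumr -(big_mkord xpredT (fun j => t.1.1 *
  factorial_sum t.1.2 (fun u => F (reindex_seq (j :: t.2) u)) s)).
by rewrite /index_iota subn0.
Qed.

End factorial_sums.

End removal_sums.

(** Strong induction on the size: the factor vanishes at size [k] only, so elsewhere the value is
    determined by shorter lists. Below size [k] the recursion starts at the empty list, where the
    sum is empty and the value must be 0. *)
Lemma eq_factorial_sum_removal (T : eqType) (R : numDomainType) k
    (g h : seq T -> R) :
  (forall s, \sum_(z <- s) g (rem z s) = ((size s)%:R - k%:R) * g s) ->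
  (forall s, \sum_(z <- s) h (rem z s) = ((size s)%:R - k%:R) * h s) ->
  (forall s, size s = k -> g s = h s) -> forall s, g s = h s.
Proof.
move=> hg hh gh s; have [m] := ubnP (size s).
elim: m s => [//|m IH] s sm; have [sk|sk] := eqVneq (size s) k; first exact: gh.
apply: (@mulfI _ ((size s)%:R - k%:R)); first by rewrite subr_eq0 eqr_nat.
rewrite -hg -hh; apply: eq_big_seq => z zs; apply: IH.
by rewrite size_rem//; case: (s) zs sm.
Qed.

(** * Adding and removing atoms *)

Section atoms_integral.
Context (R : realType) d (T : measurableType d).
Variables (mu : {finite_measure set T -> \bar R}) (s : seq T).

Lemma ge0_integral_atoms (F : T -> \bar R) :
  same_measure mu (dirac_sum s) -> nonneg_measurable F ->
  (\int[mu]_x F x = \sum_(x <- s) F x)%E.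
Proof.
move=> es okF; have U := eq_sigma_functional (sigma_functional_integral mu)
  (sigma_functional_evals R s).
apply: U => // D mD.
by rewrite integral_indic// setIT [LHS]es//= dirac_sumE sumEFin.
Qed.

Lemma Rintegral_atoms (F : T -> R) :
  same_measure mu (dirac_sum s) -> measurable_fun [set: T] F ->
  \int[mu]_x F x = \sum_(x <- s) F x.
Proof.
move=> es mF; rewrite /Rintegral integralE.
have mFe : measurable_fun [set: T] (fun x => (F x)%:E) by exact/measurable_EFinP.
rewrite !(ge0_integral_atoms es); last 2 first.
- by split; [move=> x; exact: funeneg_ge0|exact: measurable_funeneg].
- by split; [move=> x; exact: funepos_ge0|exact: measurable_funepos].
rewrite (eq_bigr (fun x => (Num.max (F x) 0)%:E)); last first.
  by move=> x _; rewrite funeposE EFin_max.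
rewrite [X in (_ - X)%E](eq_bigr (fun x => (Num.max (- F x) 0)%:E)); last first.
  by move=> x _; rewrite funenegE EFin_max EFinN.
rewrite !sumEFin -EFinB/= -sumrB; apply: eq_bigr => x _.
have [h|h] := leP 0 (F x); first by rewrite max_r ?oppr_le0// subr0.
by rewrite max_l ?oppr_ge0 ?ltW// sub0r opprK.
Qed.

End atoms_integral.

Section config_calculus.
Context (R : realType) d (E : measurableType d).
Hypothesis E_borel : borel_space R E.
Local Notation N := (config R E).
Implicit Types (eta zeta : N) (s u : seq E).

Lemma same_add_dirac eta zeta y : same_measure eta zeta ->
  same_measure (add_dirac eta y) (add_dirac zeta y).
Proof.
by move=> ez B mB; rewrite /= /add_dirac_measure !measure_addE/= ez.
Qed.

Lemma same_add_dirac_cons eta s y : same_measure eta (dirac_sum s) ->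
  same_measure (add_dirac eta y) (dirac_sum (y :: s)).
Proof.
move=> es B mB; rewrite /= /add_dirac_measure measure_addE/= es//= !dirac_sumE.
by rewrite big_cons EFinD addeC.
Qed.

Lemma same_sub_dirac eta s x : same_measure eta (dirac_sum s) -> x \in s ->
  same_measure (sub_dirac eta x) (dirac_sum (rem x s)).
Proof.
move=> es xs.
have ex : exists zeta : N, same_measure (add_dirac zeta x) eta.
  exists (dirac_config R (rem x s)) => B mB; rewrite es//= .
  rewrite (perm_same_dirac_sum R (perm_to_rem xs) mB)/=.
  exact: (@same_add_dirac_cons (dirac_config R (rem x s))).
have /= h : same_measure (add_dirac (sub_dirac eta x) x) eta.
  exact: (@xgetPex _ eta [set zeta | same_measure (add_dirac zeta x) eta] ex).
move=> B mB; have := h B mB; rewrite es//= (perm_same_dirac_sum R (perm_to_rem xs) mB)/=.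
rewrite /add_dirac_measure measure_addE/= !dirac_sumE big_cons EFinD.
move=> /(congr1 (fun z => z - (\1_B x)%:E)%E).
by rewrite addeK// addeAC subee// add0e.
Qed.

Lemma same_sub_add_dirac eta x : same_measure (sub_dirac (add_dirac eta x) x) eta.
Proof.
have es := same_atoms E_borel eta.
have h := @same_sub_dirac _ _ x (same_add_dirac_cons x es) (mem_head _ _).
apply: (same_measure_trans h); rewrite /= eqxx; exact: same_measure_sym.
Qed.

Lemma config_set1_gt0 eta s x : same_measure eta (dirac_sum s) ->
  (0 < eta [set x])%E = (x \in s).
Proof.
move=> es; rewrite (es _ (borel_set1 E_borel x))/= dirac_sum_set1 lte_fin ltr0n.
by rewrite -has_count has_pred1.
Qed.

(** Replaces the choice in [sub_dirac] by a formula whose measurability in [eta] and [x] jointly can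
    be checked. The second branch is the junk value: a point of mass 0 cannot carry a removed
    atom. *)
Lemma sub_dirac_eval eta x B : measurable B ->
  sub_dirac eta x B =
  (if 0 < eta [set x] then eta B - (\1_B x)%:E else eta B)%E.
Proof.
move=> mB; have es := same_atoms E_borel eta.
rewrite (config_set1_gt0 _ es); case: ifPn => xs.
  rewrite (same_sub_dirac es xs)// es//= (perm_same_dirac_sum R (perm_to_rem xs) mB)/=.
  by rewrite !dirac_sumE big_cons EFinD addeAC subee// add0e.
rewrite /sub_dirac; case: xgetP => // zeta _ hz.
have := config_set1_gt0 x es; rewrite (negbTE xs) -(hz _ (borel_set1 E_borel x))/=.
rewrite /add_dirac_measure measure_addE/= /dirac indicE mem_set//.
by move=> /negbT/negP[]; apply: (lt_le_trans lte01); rewrite leeDr ?measure_ge0.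
Qed.

Lemma measurable_sub_dirac d' (X : measurableType d') (eta : X -> N) (x : X -> E) :
  measurable_fun [set: X] eta -> measurable_fun [set: X] x ->
  measurable_fun [set: X] (fun z => sub_dirac (eta z) (x z)).
Proof.
move=> meta mx; apply: measurable_fun_config => B mB.
rewrite (_ : (fun _ => _) = fun z =>
  if (0 < eta z [set x z])%E then (eta z B - (\1_B (x z))%:E)%E else eta z B); last first.
  by apply/funext => z; exact: sub_dirac_eval.
have mev : measurable_fun [set: X] (fun z => eta z B).
  exact: (measurableT_comp (measurable_config_eval mB) meta).
apply: measurable_fun_ifT => //.
- apply: measurable_fun_lte => //.
  (* The mass of a moving singleton is the integral of the indicator of the diagonal, which is
     measurable in a Borel space. *)
  rewrite (_ : (fun _ => _) = fun z =>
      \int[eta z]_y (\1_[set w : E * E | w.1 = w.2] (x z, y))%:E)%E; last first.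
    apply/funext => z.
    have m1 := borel_set1 E_borel (x z).
    transitivity (\int[eta z]_y (\1_[set x z] y)%:E)%E.
      by rewrite integral_indic ?setIT.
    apply: eq_integral => y _.
    rewrite !indicE; congr (_%:R%:E); congr nat_of_bool.
    by apply/idP/idP => /set_mem /= h; apply/mem_set => /=; rewrite h.
  apply: (@measurable_integral_config R d E d' X eta meta (fun w : X * E =>
     (\1_[set w : E * E | w.1 = w.2] (x w.1, w.2))%:E)) => //.
  apply/measurable_EFinP.
  apply: (measurableT_comp (measurable_indic (borel_diagonal E_borel))).
  apply: measurable_fun_pair => //; exact: measurableT_comp mx _.
- apply: emeasurable_funB => //; apply/measurable_EFinP.
  exact: (measurableT_comp (measurable_indic mB) mx).
Qed.

Lemma perm_config (f : N -> R) s s' : measurable_fun [set: N] f ->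
  perm_eq s s' -> f (dirac_config R s) = f (dirac_config R s').
Proof.
by move=> mf ss; apply: measurable_fun_sameR => //; exact: perm_same_dirac_sum.
Qed.

Lemma same_config (f : N -> R) eta s : measurable_fun [set: N] f ->
  same_measure eta (dirac_sum s) -> f eta = f (dirac_config R s).
Proof. by move=> mf es; exact: measurable_fun_sameR. Qed.

Lemma sector_of_same eta s : same_measure eta (dirac_sum s) -> sector (size s) eta.
Proof. by move=> es; rewrite /sector/= es//= dirac_sum_setT. Qed.

Lemma sector_atoms eta : sector (size (atoms eta)) eta.
Proof. exact/sector_of_same/same_atoms. Qed.

Lemma measurable_cons_config s :
  measurable_fun [set: E] (fun y => dirac_config R (y :: s)).
Proof.
apply: measurable_fun_config => B mB.
rewrite (_ : (fun _ => _) = fun y => (\1_B y + \sum_(x <- s) \1_B x)%R%:E).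
  apply/measurable_EFinP; apply: measurable_funD => //; exact: measurable_indic.
by apply/funext => y; rewrite /= dirac_sumE big_cons.
Qed.

(** The natural domain of the removal and jump operators: they enlarge a bound by a factor depending
    on the particle number, so they do not preserve boundedness but do preserve this class. *)
Definition sector_bounded (f : N -> R) : Prop :=
  measurable_fun [set: N] f /\
  forall n, exists M, forall eta, sector n eta -> `|f eta| <= M.

Lemma sector_bounded_bounded f : bounded_measurable f -> sector_bounded f.
Proof. by move=> [mf [M fM]]; split => // n; exists M. Qed.

Lemma sector_bounded_cst (a : R) : sector_bounded (fun=> a).
Proof. by split => // n; exists `|a|. Qed.

Lemma sector_boundedD f g : sector_bounded f -> sector_bounded g ->
  sector_bounded (fun eta => f eta + g eta).
Proof.
move=> [mf fb] [mg gb]; split; first exact: measurable_funD.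
move=> n; have [M fM] := fb n; have [K gK] := gb n; exists (M + K) => eta etan.
by rewrite (le_trans (ler_normD _ _))// lerD ?fM ?gK.
Qed.

Lemma sector_boundedM f g : sector_bounded f -> sector_bounded g ->
  sector_bounded (fun eta => f eta * g eta).
Proof.
move=> [mf fb] [mg gb]; split; first exact: measurable_funM.
move=> n; have [M fM] := fb n; have [K gK] := gb n; exists (M * K) => eta etan.
by rewrite normrM ler_pM ?fM ?gK.
Qed.

Lemma sector_boundedZ (a : R) f : sector_bounded f ->
  sector_bounded (fun eta => a * f eta).
Proof. exact/sector_boundedM/sector_bounded_cst. Qed.

Lemma sector_boundedB f g : sector_bounded f -> sector_bounded g ->
  sector_bounded (fun eta => f eta - g eta).
Proof.
move=> hf hg; have := sector_boundedD hf (sector_boundedZ (-1) hg).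
by under eq_fun do rewrite mulN1r.
Qed.

Lemma sector_bounded_sum I (l : seq I) (F : I -> N -> R) :
  (forall i, sector_bounded (F i)) ->
  sector_bounded (fun eta => \sum_(i <- l) F i eta).
Proof.
move=> hF; elim: l => [|i l IH].
  by under eq_fun do rewrite big_nil; exact: sector_bounded_cst.
by under eq_fun do rewrite big_cons; exact: sector_boundedD.
Qed.

Definition restrict_sector n (f : N -> R) (eta : N) : R :=
  if eta setT == n%:R%:E then f eta else 0.

Lemma restrict_sectorE n f eta : sector n eta -> restrict_sector n f eta = f eta.
Proof. by rewrite /restrict_sector /sector /= => ->; rewrite eqxx. Qed.

Lemma bounded_restrict_sector n f : sector_bounded f ->
  bounded_measurable (restrict_sector n f).
Proof.
move=> [mf fb]; split.
  apply: measurable_fun_ifT => //.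
  by apply: measurable_fun_eqe => //; exact: measurable_config_eval.
have [M fM] := fb n; exists (Num.max M 0) => eta; rewrite /restrict_sector.
case: ifPn => [/eqP etan|_]; last by rewrite normr0 le_max lexx orbT.
by rewrite le_max fM.
Qed.

Lemma bounded_cons_config f s : sector_bounded f ->
  bounded_measurable (fun y => f (dirac_config R (y :: s))).
Proof.
move=> [mf fb]; split; first exact: (measurableT_comp mf (measurable_cons_config s)).
have [M fM] := fb (size s).+1; exists M => y; apply: fM.
exact: (sector_dirac R (y :: s)).
Qed.

Lemma bounded_measurable_integrable d' (T : measurableType d')
    (mu : {finite_measure set T -> \bar R}) (f : T -> R) :
  bounded_measurable f -> mu.-integrable setT (EFin \o f).
Proof.
move=> [mf [M fM]]; apply: measurable_bounded_integrable => //.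
  by rewrite ltey_eq fin_num_measure.
exists M; split; first exact: num_real.
by move=> K MK x _; exact: le_trans (fM x) (ltW MK).
Qed.

Lemma bounded_measurableM d' (T : measurableType d') (f g : T -> R) :
  bounded_measurable f -> bounded_measurable g ->
  bounded_measurable (fun x => f x * g x).
Proof.
move=> [mf [M fM]] [mg [K gK]]; split; first exact: measurable_funM.
by exists (M * K) => x; rewrite normrM ler_pM.
Qed.

Lemma bounded_measurableD d' (T : measurableType d') (f g : T -> R) :
  bounded_measurable f -> bounded_measurable g ->
  bounded_measurable (fun x => f x + g x).
Proof.
move=> [mf [M fM]] [mg [K gK]]; split; first exact: measurable_funD.
by exists (M + K) => x; rewrite (le_trans (ler_normD _ _))// lerD.
Qed.

Lemma bounded_measurable_cst d' (T : measurableType d') (a : R) :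
  bounded_measurable (fun _ : T => a).
Proof. by split => //; exists `|a|. Qed.

Lemma sum_removalE f eta s : measurable_fun [set: N] f ->
  same_measure eta (dirac_sum s) ->
  sum_removal f eta = \sum_(x <- s) f (dirac_config R (rem x s)).
Proof.
move=> mf es; rewrite /sum_removal (Rintegral_atoms es); last first.
  by apply: (measurableT_comp mf); exact: measurable_sub_dirac.
by apply: eq_big_seq => x xs; apply: same_config => //; exact: same_sub_dirac.
Qed.

End config_calculus.

(** * The jump operator and its Euler steps *)

Lemma perm_seq_jump (T : eqType) (R : comNzRingType) (I : T -> (T -> R) -> R)
    (c : T -> T -> R) (psi : seq T -> R) s s' :
  (forall u u', perm_eq u u' -> psi u = psi u') -> perm_eq s s' ->
  seq_jump I c psi s = seq_jump I c psi s'.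
Proof.
move=> hpsi ss; rewrite /seq_jump (perm_big _ ss); apply: eq_bigr => x _.
have eqy y : psi (y :: rem x s) = psi (y :: rem x s').
  by apply: hpsi; rewrite perm_cons perm_rem.
congr (_ + _); first by congr (I x _); apply/funext.
by rewrite (perm_big _ ss); apply: eq_bigr => y _; rewrite eqy.
Qed.

Lemma ler_sum_size (T : Type) (R : numDomainType) (s : seq T) (F : T -> R) K :
  (forall x, F x <= K) -> \sum_(x <- s) F x <= (size s)%:R * K.
Proof.
move=> FK; apply: (@le_trans _ _ (\sum_(x <- s) K)); first exact: ler_sum.
by rewrite big_const_seq count_predT iter_addr_0 mulr_natl.
Qed.

Section jump_operators.
Context (R : realType) d (E : measurableType d).
Hypothesis E_borel : borel_space R E.
Variables (alpha : {finite_measure set E -> \bar R}) (c : E -> E -> R).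
Hypothesis mc : measurable_fun [set: E * E] (fun xy : E * E => c xy.1 xy.2).
Hypothesis c0 : forall x y, 0 <= c x y.
Hypothesis cb : exists M : R, forall x y, c x y <= M.
Local Notation N := (config R E).
Implicit Types (eta zeta : N) (s u : seq E) (f g : N -> R).

Lemma measurable_intensity x : measurable_fun [set: E] (c x).
Proof. exact: (measurableT_comp mc (measurable_pair1 x)). Qed.

Lemma bounded_intensity x : bounded_measurable (c x).
Proof.
split; first exact: measurable_intensity.
by have [M cM] := cb; exists M => y; rewrite ger0_norm.
Qed.

Definition alpha_mean x (psi : E -> R) : R := \int[alpha]_y (psi y * c x y).

Lemma alpha_meanD x psi psi' : bounded_measurable psi -> bounded_measurable psi' ->
  alpha_mean x (fun y => psi y + psi' y) = alpha_mean x psi + alpha_mean x psi'.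
Proof.
move=> hp hp'; rewrite /alpha_mean -RintegralD//.
- by apply: eq_Rintegral => y _; rewrite mulrDl.
- exact/bounded_measurable_integrable/bounded_measurableM/bounded_intensity.
- exact/bounded_measurable_integrable/bounded_measurableM/bounded_intensity.
Qed.

Lemma alpha_meanZ x a psi : bounded_measurable psi ->
  alpha_mean x (fun y => a * psi y) = a * alpha_mean x psi.
Proof.
move=> hp; rewrite /alpha_mean -RintegralZl//.
- by apply: eq_Rintegral => y _; rewrite mulrA.
- exact/bounded_measurable_integrable/bounded_measurableM/bounded_intensity.
Qed.

Lemma alpha_mean_sum x I (l : seq I) (psi : I -> E -> R) :
  (forall i, bounded_measurable (psi i)) ->
  alpha_mean x (fun y => \sum_(i <- l) psi i y) = \sum_(i <- l) alpha_mean x (psi i).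
Proof.
move=> hp; elim: l => [|i l IH].
  rewrite big_nil; transitivity (\int[alpha]_y cst 0 y).
    by apply: eq_Rintegral => y _; rewrite big_nil mul0r.
  by rewrite Rintegral_cst// mul0r.
rewrite big_cons -IH -alpha_meanD//.
  by congr alpha_mean; apply/funext => y; rewrite big_cons.
elim: l {IH} => [|j l IH].
  by under eq_fun do rewrite big_nil; exact: bounded_measurable_cst.
by under eq_fun do rewrite big_cons; exact: bounded_measurableD.
Qed.

(** The gain part of the generator on real functions, evaluated on a list of atoms so that the list
    identities apply. [jump_integral] is the same operator written as an integral, for measurability
    and for the integration against rho. *)
Definition jump_mean f eta : R :=
  seq_jump alpha_mean c (fun s => f (dirac_config R s)) (atoms eta).

Lemma jump_meanE f eta s : measurable_fun [set: N] f ->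
  same_measure eta (dirac_sum s) ->
  jump_mean f eta = seq_jump alpha_mean c (fun s => f (dirac_config R s)) s.
Proof.
move=> mf es; apply: perm_seq_jump => [u u'|]; first exact: perm_config.
apply: (same_dirac_sum_perm (R := R) E_borel).
exact: (same_measure_trans (same_measure_sym (same_atoms E_borel eta)) es).
Qed.

Lemma jump_meanD f g eta : sector_bounded f -> sector_bounded g ->
  jump_mean (fun zeta => f zeta + g zeta) eta = jump_mean f eta + jump_mean g eta.
Proof.
move=> hf hg; rewrite /jump_mean /seq_jump -big_split/=; apply: eq_bigr => x _.
rewrite alpha_meanD; [|exact: bounded_cons_config..].
rewrite addrACA; congr (_ + _); rewrite -big_split/=.
by apply: eq_bigr => y _; rewrite mulrDl.
Qed.

Lemma jump_meanZ a f eta : sector_bounded f ->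
  jump_mean (fun zeta => a * f zeta) eta = a * jump_mean f eta.
Proof.
move=> hf; rewrite /jump_mean /seq_jump mulr_sumr; apply: eq_bigr => x _.
rewrite alpha_meanZ; last exact: bounded_cons_config.
rewrite mulrDr; congr (_ + _); rewrite mulr_sumr.
by apply: eq_bigr => y _; rewrite mulrA.
Qed.

Lemma jump_meanB f g eta : sector_bounded f -> sector_bounded g ->
  jump_mean (fun zeta => f zeta - g zeta) eta = jump_mean f eta - jump_mean g eta.
Proof.
move=> hf hg; rewrite -mulN1r -jump_meanZ// -jump_meanD//; last exact: sector_boundedZ.
by congr (jump_mean _ _); apply/funext => zeta; rewrite mulN1r.
Qed.

Lemma jump_mean_sector f g n eta : sector n eta ->
  (forall zeta, sector n zeta -> f zeta = g zeta) -> jump_mean f eta = jump_mean g eta.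
Proof.
move=> etan fg; apply: eq_big_seq => x xs.
have eqy y : f (dirac_config R (y :: rem x (atoms eta))) =
           g (dirac_config R (y :: rem x (atoms eta))).
  apply: fg; have := sector_dirac R (y :: rem x (atoms eta)).
  rewrite /= size_rem// (size_atoms E_borel etan).
  by rewrite prednK// -(size_atoms E_borel etan); case: (atoms eta) xs.
congr (_ + _); first by congr alpha_mean; apply/funext.
by apply: eq_bigr => y _; rewrite eqy.
Qed.

Lemma jump_mean_ge0 f n eta : sector n eta ->
  (forall zeta, sector n zeta -> 0 <= f zeta) -> 0 <= jump_mean f eta.
Proof.
move=> etan f0.
(* Only values on the sector enter, so [f] may be replaced by its positive part. *)
rewrite (@jump_mean_sector f (fun zeta => Num.max (f zeta) 0) n)//; last first.
  by move=> zeta /f0 ?; rewrite max_l.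
have max0 zeta : 0 <= Num.max (f zeta) 0 by rewrite le_max lexx orbT.
apply: sumr_ge0 => x _; apply: addr_ge0.
  by apply: Rintegral_ge0 => y _; rewrite mulr_ge0.
by apply: sumr_ge0 => y _; rewrite mulr_ge0.
Qed.

Section jump_integral.
Local Open Scope ereal_scope.

Definition jump_integral (F : N -> \bar R) eta : \bar R :=
  \int[eta]_x \int[measure_add alpha eta]_y
    (F (add_dirac (sub_dirac eta x) y) * (c x y)%:E).

Lemma jump_kernelE eta (B : set N) :
  jump_kernel alpha c eta B = jump_integral (fun zeta => (\1_B zeta)%:E) eta.
Proof. by []. Qed.

Lemma measurable_integral_add d' (X : measurableType d') (eta : X -> N)
    (G : X * E -> \bar R) :
  measurable_fun [set: X] eta -> nonneg_measurable G ->
  measurable_fun [set: X] (fun x => \int[measure_add alpha (eta x)]_y G (x, y)).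
Proof.
move=> meta [G0 mG].
rewrite (_ : (fun _ => _) =
    fun x => \int[alpha]_y G (x, y) + \int[eta x]_y G (x, y)); last first.
  apply/funext => x; rewrite ge0_integral_measure_add//.
  exact: measurableT_comp mG (measurable_pair1 x).
apply: emeasurable_funD; first exact: measurable_fun_fubini_tonelli_F.
exact: measurable_integral_config.
Qed.

Lemma nonneg_measurable_jump (F : N -> \bar R) d' (X : measurableType d')
    (eta : X -> N) (x y : X -> E) :
  measurable_fun [set: X] eta -> measurable_fun [set: X] x ->
  measurable_fun [set: X] y -> nonneg_measurable F ->
  nonneg_measurable
    (fun z => F (add_dirac (sub_dirac (eta z) (x z)) (y z)) * (c (x z) (y z))%:E).
Proof.
move=> meta mx my hF; apply: nonneg_measurableM.
  apply: nonneg_measurable_comp hF; apply: measurable_add_dirac => //.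
  exact: measurable_sub_dirac.
split; first by move=> z; rewrite lee_fin.
apply/measurable_EFinP.
exact: (measurableT_comp mc (measurable_fun_pair mx my)).
Qed.

Lemma measurable_jump_integral (F : N -> \bar R) : nonneg_measurable F ->
  measurable_fun [set: N] (jump_integral F).
Proof.
move=> hF.
have hG : nonneg_measurable (fun z : (N * E) * E =>
    F (add_dirac (sub_dirac z.1.1 z.1.2) z.2) * (c z.1.2 z.2)%:E).
  by apply: nonneg_measurable_jump => //; exact: measurableT_comp.
have mG := @measurable_integral_add _ (N * E)%type fst _ measurable_fst hG.
have h := @measurable_integral_config R d E _ N id (@measurable_id _ _ _) (fun z =>
  \int[measure_add alpha z.1]_y
    (F (add_dirac (sub_dirac z.1 z.2) y) * (c z.2 y)%:E)).
apply: (h _ mG) => z.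
by apply: integral_ge0 => y _; exact: (hG.1 (z, y)).
Qed.

Lemma sigma_functional_jump_integral eta :
  sigma_functional (fun F => jump_integral F eta).
Proof.
apply: (sigma_functional_kernel (S := fun F x =>
  \int[measure_add alpha eta]_y (F (add_dirac (sub_dirac eta x) y) * (c x y)%:E))
  (T := fun F => \int[eta]_x F x)).
- move=> F hF; apply: (@measurable_integral_add _ E (fun=> eta)
    (fun z => F (add_dirac (sub_dirac eta z.1) z.2) * (c z.1 z.2)%:E)) => //.
  exact: nonneg_measurable_jump.
- move=> x; have mcx : nonneg_measurable (fun y => (c x y)%:E).
    split; first by move=> y; rewrite lee_fin.
    exact/measurable_EFinP/measurable_intensity.
  have ma : measurable_fun [set: E] (fun y => add_dirac (sub_dirac eta x) y).
    exact: measurable_add_dirac.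
  have := sigma_functional_comp ma (sigma_functional_mul mcx
    (sigma_functional_integral (measure_add alpha eta))).
  congr sigma_functional; apply/funext => F; apply: eq_integral => y _.
  by rewrite muleC.
- exact: sigma_functional_integral.
Qed.

Lemma jump_integral_EFin f eta : (forall zeta, (0 <= f zeta)%R) ->
  sector_bounded f -> jump_integral (EFin \o f) eta = (jump_mean f eta)%:E.
Proof.
move=> f0 hf; have es := same_atoms E_borel eta.
have [mf _] := hf.
have hF : nonneg_measurable (EFin \o f).
  by split; [move=> z; rewrite lee_fin|exact/measurable_EFinP].
rewrite /jump_integral (ge0_integral_atoms es); last first.
  split.
    move=> x; apply: integral_ge0 => y _; rewrite mule_ge0// lee_fin//.
  apply: (@measurable_integral_add _ E (fun=> eta)
    (fun z => (f (add_dirac (sub_dirac eta z.1) z.2))%:E * (c z.1 z.2)%:E)) => //.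
  exact: (nonneg_measurable_jump (F := EFin \o f)).
rewrite -sumEFin; apply: eq_big_seq => x xs.
have eqy y : f (add_dirac (sub_dirac eta x) y) = f (dirac_config R (y :: rem x (atoms eta))).
  by apply: same_config => //; apply: same_add_dirac_cons; exact: same_sub_dirac.
under eq_integral do rewrite /= eqy.
have hcf := bounded_cons_config (rem x (atoms eta)) hf.
have ok : nonneg_measurable (fun y =>
    (f (dirac_config R (y :: rem x (atoms eta))))%:E * (c x y)%:E).
  split; first by move=> y; rewrite mule_ge0// lee_fin.
  by apply/measurable_EFinP/measurable_funM; [exact: hcf.1|exact: measurable_intensity].
rewrite ge0_integral_measure_add//; [|by move=> y _; exact: ok.1|exact: ok.2].
rewrite (ge0_integral_atoms es)// EFinD; congr (_ + _); last by rewrite -sumEFin.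
rewrite /alpha_mean /Rintegral fineK//; apply: integrable_fin_num => //.
exact/bounded_measurable_integrable/bounded_measurableM/bounded_intensity.
Qed.

End jump_integral.

Lemma jump_rateE eta : jump_rate alpha c eta = jump_mean (fun=> 1) eta.
Proof.
rewrite /jump_rate jump_kernelE.
rewrite (_ : (fun zeta : N => (\1_[set: N] zeta)%:E) = EFin \o (fun=> 1)); last first.
  by apply/funext => zeta; rewrite indicT.
rewrite jump_integral_EFin//; exact: sector_bounded_cst.
Qed.

Lemma jump_rate_ge0 eta : 0 <= jump_rate alpha c eta.
Proof.
have [n etan] := sector_ex eta.
by rewrite jump_rateE; apply: (jump_mean_ge0 etan).
Qed.

Lemma jump_rate_bound : exists r : nat -> R, (forall n, 0 <= r n) /\
  forall n eta, sector n eta -> jump_rate alpha c eta <= r n.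
Proof.
have [M cM] := cb.
have M0 : 0 <= M by rewrite (le_trans (c0 point point)).
(* Each of the [n] particles jumps at rate at most [M] times the mass of alpha plus [n]. *)
exists (fun n => n%:R * (M * fine (alpha setT) + n%:R * M)); split => [n|n eta etan].
  by rewrite mulr_ge0// addr_ge0// mulr_ge0// fine_ge0.
rewrite jump_rateE /jump_mean /seq_jump -(size_atoms E_borel etan).
apply: ler_sum_size => x; apply: lerD.
  rewrite /alpha_mean -Rintegral_cst//; apply: le_Rintegral => //.
  - apply: bounded_measurable_integrable; apply: bounded_measurableM.
      exact: bounded_measurable_cst.
    exact: bounded_intensity.
  - by apply: (bounded_measurable_integrable alpha); exact: bounded_measurable_cst.
  - by move=> y _; rewrite mul1r.
by apply: ler_sum_size => y; rewrite mul1r.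
Qed.

(** Positivity applied to [M + f] and [M - f]; the jump mean of a constant is that constant times
    the rate. *)
Lemma jump_mean_norm f n M eta : sector n eta -> sector_bounded f ->
  (forall zeta, sector n zeta -> `|f zeta| <= M) ->
  `|jump_mean f eta| <= M * jump_rate alpha c eta.
Proof.
move=> etan hf fM; rewrite jump_rateE -jump_meanZ; last exact: sector_bounded_cst.
have hM : sector_bounded (fun zeta : N => M * 1 : R) by exact: sector_bounded_cst.
rewrite ler_norml; apply/andP; split.
  rewrite -subr_ge0 opprK -jump_meanD//; apply: (jump_mean_ge0 etan) => zeta /fM.
  by rewrite mulr1 ler_norml => /andP[+ _]; rewrite -subr_ge0 opprK.
rewrite -subr_ge0 -jump_meanB//; apply: (jump_mean_ge0 etan) => zeta /fM.
by rewrite mulr1 ler_norml subr_ge0 => /andP[].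
Qed.

Lemma sector_bounded_jump_mean f : sector_bounded f -> sector_bounded (jump_mean f).
Proof.
move=> hf; have [mf fb] := hf; split; last first.
  move=> n; have [M fM] := fb n; have [r [r0 rn]] := jump_rate_bound.
  exists (`|M| * r n) => eta etan.
  rewrite (le_trans (jump_mean_norm etan hf fM))// (le_trans (ler_norm _))//.
  by rewrite normrM [X in _ * X]ger0_norm ?jump_rate_ge0// ler_wpM2l ?rn.
(* Measurability comes from [jump_integral], which takes nonnegative functions; hence the split into
   positive and negative parts. *)
have pos (g : N -> R) : (forall zeta, 0 <= g zeta) -> sector_bounded g ->
    measurable_fun [set: N] (jump_mean g).
  move=> g0 hg; rewrite (_ : jump_mean g = fine \o jump_integral (EFin \o g)).
    apply: measurableT_comp => //; apply: measurable_jump_integral.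
    split; first by move=> z; rewrite lee_fin.
    by apply/measurable_EFinP; exact: hg.1.
  by apply/funext => eta; rewrite /= jump_integral_EFin.
have hmax (g : N -> R) : sector_bounded g -> sector_bounded (fun zeta => Num.max (g zeta) 0).
  move=> [mg gb]; split.
    by apply: (@measurable_maxr _ _ _ setT g (cst 0)).
  move=> n; have [M gM] := gb n; exists M => zeta /gM h.
  have [_|_] := leP 0 (g zeta); first by [].
  by rewrite normr0 (le_trans _ h).
have hNf : sector_bounded (fun zeta => - f zeta).
  by have := sector_boundedZ (-1) hf; under eq_fun do rewrite mulN1r.
rewrite (_ : jump_mean f = (fun eta => jump_mean (fun zeta => Num.max (f zeta) 0) eta -
    jump_mean (fun zeta => Num.max (- f zeta) 0) eta)).
  by apply: measurable_funB; apply: pos; try exact: hmax; move=> zeta;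
    rewrite le_max lexx orbT.
apply/funext => eta; rewrite -jump_meanB; [|exact: hmax..].
congr (jump_mean _ _); apply/funext => zeta.
have [h|h] := leP 0 (f zeta); first by rewrite max_r ?oppr_le0// subr0.
by rewrite max_l ?oppr_ge0 ?ltW// sub0r opprK.
Qed.

Lemma sector_bounded_jump_rate : sector_bounded (jump_rate alpha c : N -> R).
Proof.
rewrite (_ : jump_rate alpha c = jump_mean (fun=> 1)); last first.
  by apply/funext => eta; exact: jump_rateE.
exact/sector_bounded_jump_mean/sector_bounded_cst.
Qed.

End jump_operators.

(** * Euler steps: positivity, contraction, commutation with removals *)

Section euler_step.
Context (R : realType) d (E : measurableType d).
Hypothesis E_borel : borel_space R E.
Variables (alpha : {finite_measure set E -> \bar R}) (c : E -> E -> R).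
Hypothesis mc : measurable_fun [set: E * E] (fun xy : E * E => c xy.1 xy.2).
Hypothesis c0 : forall x y, 0 <= c x y.
Hypothesis cb : exists M : R, forall x y, c x y <= M.
Local Notation N := (config R E).
Local Notation jump_mean := (jump_mean alpha c).
Local Notation rate := (jump_rate alpha c).
Implicit Types (eta zeta : N) (s u : seq E) (f g : N -> R).

Definition euler_step (h : R) f eta : R :=
  f eta + h * (jump_mean f eta - rate eta * f eta).

Lemma sector_bounded_euler_step h f :
  sector_bounded f -> sector_bounded (euler_step h f).
Proof.
move=> hf; apply: sector_boundedD => //; apply: sector_boundedZ.
apply: sector_boundedB; first exact: sector_bounded_jump_mean.
by apply: sector_boundedM => //; exact: sector_bounded_jump_rate.
Qed.

Lemma sector_bounded_euler_iter h k f :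
  sector_bounded f -> sector_bounded (iter k (euler_step h) f).
Proof. by move=> hf; elim: k => //= k; exact: sector_bounded_euler_step. Qed.

Lemma euler_stepB h f g eta : sector_bounded f -> sector_bounded g ->
  euler_step h (fun zeta => f zeta - g zeta) eta = euler_step h f eta - euler_step h g eta.
Proof. by move=> hf hg; rewrite /euler_step jump_meanB//; ring. Qed.

(** Under the step size condition the coefficient [1 - h * rate eta] of [f eta] is nonnegative. *)
Lemma euler_step_ge0 h f n eta : 0 <= h -> h * rate eta <= 1 -> sector n eta ->
  (forall zeta, sector n zeta -> 0 <= f zeta) -> 0 <= euler_step h f eta.
Proof.
move=> h0 h1 etan f0.
rewrite (_ : euler_step h f eta = (1 - h * rate eta) * f eta + h * jump_mean f eta);
  last by rewrite /euler_step; ring.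
rewrite addr_ge0 ?mulr_ge0 ?f0 ?subr_ge0//.
by apply: (jump_mean_ge0 E_borel) f0.
Qed.

(** An operator that preserves positivity and fixes constants contracts the supremum norm. This is
    the stability of the scheme. *)
Lemma euler_step_norm h f n M eta : 0 <= h -> h * rate eta <= 1 -> sector n eta ->
  sector_bounded f -> (forall zeta, sector n zeta -> `|f zeta| <= M) ->
  `|euler_step h f eta| <= M.
Proof.
move=> h0 h1 etan hf fM.
have hM := sector_bounded_cst E M.
have EM : euler_step h (fun=> M) eta = M.
  rewrite /euler_step.
  rewrite (_ : jump_mean (fun=> M) eta = M * rate eta); first by ring.
  rewrite (jump_rateE E_borel)// -jump_meanZ//; last exact: sector_bounded_cst.
  by rewrite mulr1.
have fN : sector_bounded (fun zeta => M - f zeta) by exact: sector_boundedB.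
have fN' : sector_bounded (fun zeta => f zeta - (- M)).
  by apply: sector_boundedB => //; exact: sector_bounded_cst.
have hM' := sector_bounded_cst E (- M).
have EM' : euler_step h (fun=> - M) eta = - M.
  have := euler_stepB h eta (sector_bounded_cst E 0) hM.
  rewrite EM (_ : (fun=> _) = fun=> - M); last by apply/funext => z; rewrite sub0r.
  move=> ->; have /= := euler_stepB h eta hM hM; rewrite !subrr => ->.
  by rewrite sub0r.
rewrite ler_norml; apply/andP; split.
  rewrite -subr_ge0 -EM' -euler_stepB//; apply: (euler_step_ge0 h0 h1 etan) => zeta /fM.
  by rewrite ler_norml => /andP[+ _]; rewrite -subr_ge0.
rewrite -subr_ge0 -[X in X - _]EM -euler_stepB//.
apply: (euler_step_ge0 h0 h1 etan) => zeta /fM.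
by rewrite ler_norml subr_ge0 => /andP[].
Qed.

Lemma sector_bounded_removal f : sector_bounded f -> sector_bounded (sum_removal f).
Proof.
move=> hf; have [mf fb] := hf; split; last first.
  (* Removing one atom leads to the sector below; for [n = 0] the sum over atoms is empty, so the
     truncated predecessor does no harm. *)
  move=> n; have [M fM] := fb n.-1; exists (n%:R * M) => eta etan.
  rewrite (sum_removalE E_borel mf (same_atoms E_borel eta)).
  rewrite (le_trans (ler_norm_sum _ _ _))// -(size_atoms E_borel etan).
  rewrite big_seq (le_trans (_ : _ <= \sum_(x <- atoms eta | x \in atoms eta) M))//.
    apply: ler_sum => x xs; apply: fM.
    have := sector_dirac R (rem x (atoms eta)).
    by rewrite size_rem// (size_atoms E_borel etan).
  rewrite -big_seq big_const_seq count_predT iter_addr_0 mulr_natl//.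
have pos g : (forall zeta, 0 <= g zeta) -> measurable_fun [set: N] g ->
    measurable_fun [set: N] (sum_removal g).
  move=> g0 mg.
  rewrite (_ : sum_removal g = fine \o
    (fun eta => \int[eta]_x (g (sub_dirac eta x))%:E)%E)//.
  apply: measurableT_comp => //.
  have H := @measurable_integral_config R d E _ N id (@measurable_id _ _ _)
    (fun z : N * E => (g (sub_dirac z.1 z.2))%:E).
  apply: H; first by move=> z; rewrite lee_fin.
  apply/measurable_EFinP; apply: (measurableT_comp mg).
  exact: (measurable_sub_dirac E_borel).
rewrite (_ : sum_removal f = (fun eta => sum_removal (fun zeta => Num.max (f zeta) 0) eta -
    sum_removal (fun zeta => Num.max (- f zeta) 0) eta)).
  have mp : measurable_fun [set: N] (fun zeta => Num.max (f zeta) 0).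
    by apply: (@measurable_maxr _ _ _ setT f (cst 0)).
  have mn : measurable_fun [set: N] (fun zeta => Num.max (- f zeta) 0).
    apply: (@measurable_maxr _ _ _ setT (fun zeta => - f zeta) (cst 0)) => //.
    exact: measurable_funN.
  by apply: measurable_funB; apply: pos => // zeta; rewrite le_max lexx orbT.
apply/funext => eta; have es := same_atoms E_borel eta.
rewrite !(sum_removalE E_borel _ es)//; last 2 first.
- apply: (@measurable_maxr _ _ _ setT (fun zeta => - f zeta) (cst 0)) => //.
  exact: measurable_funN.
- by apply: (@measurable_maxr _ _ _ setT f (cst 0)).
rewrite -sumrB; apply: eq_bigr => x _; set a := f _.
have [h|h] := leP 0 a; first by rewrite max_r ?oppr_le0// subr0.
by rewrite max_l ?oppr_ge0 ?ltW// sub0r opprK.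
Qed.

Hypothesis csym : forall x y, c x y = c y x.

Lemma sum_removal_euler_step h f : sector_bounded f ->
  sum_removal (euler_step h f) = euler_step h (sum_removal f).
Proof.
move=> hf; have [mf _] := hf; apply/funext => eta.
have es := same_atoms E_borel eta; set s := atoms eta in es *.
pose phi u := f (dirac_config R u).
have dd u : same_measure (dirac_config R u) (dirac_sum u) by [].
have jE (g : N -> R) u : measurable_fun setT g ->
    jump_mean g (dirac_config R u) = seq_jump (alpha_mean alpha c) c (fun s => g (dirac_config R s)) u.
  by move=> mg; exact: (jump_meanE E_borel alpha c mg (dd u)).
rewrite (sum_removalE E_borel (sector_bounded_euler_step h hf).1 es) /euler_step.
rewrite big_split/= -(sum_removalE E_borel mf es); congr (_ + _).
rewrite -mulr_sumr; congr (_ * _).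
have mr := (sector_bounded_removal hf).1.
rewrite (jump_rateE E_borel)// !(jump_meanE E_borel alpha c _ es)//.
rewrite (sum_removalE E_borel mf es).
rewrite -[X in _ = _ - _ * X]/(seq_removal phi s).
rewrite (_ : (fun u => sum_removal f (dirac_config R u)) = seq_removal phi); last first.
  by apply/funext => u; rewrite (sum_removalE E_borel mf (dd u)).
rewrite (seq_removal_generator csym); last 2 first.
- by move=> u u'; exact: perm_config.
- move=> x u; rewrite alpha_meanD//; last 2 first.
  + exact: bounded_measurable_cst.
  + have H l v : bounded_measurable (fun y => \sum_(z <- l) phi (y :: rem z v)).
      elim: l => [|z l IH].
        by under eq_fun do rewrite big_nil; exact: bounded_measurable_cst.
      under eq_fun do rewrite big_cons; apply: bounded_measurableD => //.
      exact: bounded_cons_config.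
    exact: H.
  congr (_ + _); last first.
    by rewrite alpha_mean_sum// => z; exact: bounded_cons_config.
  rewrite -alpha_meanZ//; last exact: bounded_measurable_cst.
  by congr (alpha_mean _ _ _ _); apply/funext => y; rewrite mulr1.
apply: eq_bigr => x _.
by rewrite (jump_rateE E_borel)// !jE.
Qed.

Lemma sum_removal_euler_iter h k f : sector_bounded f ->
  sum_removal (iter k (euler_step h) f) = iter k (euler_step h) (sum_removal f).
Proof.
move=> hf; elim: k => [//|k IH] /=; rewrite -IH sum_removal_euler_step//.
exact: sector_bounded_euler_iter.
Qed.

End euler_step.

(** * The first jumps *)

Section total_mass_one.
Context (R : realType) d (T : measurableType d) (P : {measure set T -> \bar R}).
Hypothesis P1 : P setT = 1%E.

Lemma prob1_ae (G : set T) : measurable G -> P G = 1%E -> {ae P, forall w, G w}.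
Proof.
move=> mG PG; exists (~` G); split => //; first exact: measurableC.
have /= := measureU P mG (measurableC mG) (setICr G).
rewrite setUv P1 PG => /(congr1 (fun x => x - 1)%E).
by rewrite subee// addeAC subee// add0e.
Qed.

Lemma bounded_integrable1 (f : T -> R) : bounded_measurable f ->
  P.-integrable setT (EFin \o f).
Proof.
move=> [mf [M fM]]; apply: measurable_bounded_integrable => //.
  by rewrite P1 ltry.
exists M; split; first exact: num_real.
by move=> K MK x _; exact: le_trans (fM x) (ltW MK).
Qed.

Lemma Rintegral_cst1 (a : R) : \int[P]_x a = a.
Proof. by rewrite Rintegral_cst// P1 mulr1. Qed.

Lemma Rintegral_bounded_norm (f : T -> R) M : measurable_fun setT f ->
  (forall x, `|f x| <= M) -> `|\int[P]_x f x| <= M.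
Proof.
move=> mf fM; have bf : bounded_measurable f by split => //; exists M.
rewrite (le_trans (le_normr_Rintegral _ _))//; first exact: bounded_integrable1.
rewrite -[leRHS]Rintegral_cst1; apply: le_Rintegral => //.
- by apply: bounded_integrable1; split; [exact: measurableT_comp|exists M => x; rewrite normr_id].
- by apply: bounded_integrable1; exact: bounded_measurable_cst.
Qed.

Lemma ae_eq_Rintegral (f g : T -> R) : measurable_fun setT f -> measurable_fun setT g ->
  {ae P, forall w, f w = g w} -> \int[P]_x f x = \int[P]_x g x.
Proof.
move=> mf mg fg; rewrite /Rintegral; congr fine.
apply: ae_eq_integral => //; [exact/measurable_EFinP|exact/measurable_EFinP|].
by apply: filterS fg => w fgw _; rewrite fgw.
Qed.

(** The coupling bound: two variables that agree off the event [B] have means that differ by at most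
    a multiple of its probability. *)
Lemma Rintegral_ae_dist (f g : T -> R) (B : set T) (K : R) : 0 <= K ->
  bounded_measurable f -> bounded_measurable g -> measurable B ->
  {ae P, forall w, `|f w - g w| <= K * \1_B w} ->
  `|\int[P]_x f x - \int[P]_x g x| <= K * fine (P B).
Proof.
move=> K0 bf bg mB h.
have bN : bounded_measurable (fun w => f w - g w).
  have := bounded_measurableD bf (bounded_measurableM (bounded_measurable_cst T (-1)) bg).
  by under eq_fun do rewrite mulN1r.
have PBfin : P B \is a fin_num.
  rewrite ge0_fin_numE// (@le_lt_trans _ _ (P setT))//; last by rewrite P1 ltry.
  by apply: le_measure => //; exact/mem_set.
rewrite -RintegralB//; [|exact: bounded_integrable1..].
rewrite (le_trans (le_normr_Rintegral _ _))//; first exact: bounded_integrable1.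
rewrite -lee_fin /Rintegral fineK; last first.
  apply: integrable_fin_num => //; apply: bounded_integrable1.
  by split; [exact: measurableT_comp bN.1|case: bN.2 => M hM; exists M => x; rewrite normr_id].
rewrite EFinM fineK//.
have <- : (\int[P]_w (\1_B w)%:E)%E = P B by rewrite integral_indic// setIT.
rewrite -ge0_integralZl_EFin//; last exact/measurable_EFinP/measurable_indic.
apply: ae_ge0_le_integral => //.
- exact/measurable_EFinP/(measurableT_comp _ bN.1).
- by move=> x _; rewrite mule_ge0// lee_fin.
- by apply: measurable_funeM; exact/measurable_EFinP/measurable_indic.
- by apply: filterS h => w hw _; rewrite -EFinM lee_fin.
Qed.

End total_mass_one.

(** * The embedded chain, the clocks and the path up to the second jump *)

Section jump_chain.
Context (R : realType) d (E : measurableType d).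
Hypothesis E_borel : borel_space R E.
Variables (alpha : {finite_measure set E -> \bar R}) (c : E -> E -> R).
Hypothesis mc : measurable_fun [set: E * E] (fun xy : E * E => c xy.1 xy.2).
Hypothesis c0 : forall x y, 0 <= c x y.
Hypothesis cb : exists M : R, forall x y, c x y <= M.
Local Notation N := (config R E).
Local Notation jump_mean := (jump_mean alpha c).
Local Notation rate := (jump_rate alpha c).
Context dO (Omega : measurableType dO) (Pr : R.-pker N ~> Omega).
Variables (Y : nat -> Omega -> N) (e : nat -> Omega -> R).
Hypothesis hd : jump_hold_data alpha c Pr Y e.
Let X := jump_path alpha c Y e.
Hypothesis mX : forall t, 0 <= t -> measurable_fun [set: Omega] (X t).
Implicit Types (eta zeta : N) (f g : N -> R).

Let mY n : measurable_fun setT (Y n). Proof. exact: (chain_measurable hd). Qed.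
Let me n : measurable_fun setT (e n). Proof. exact: (clock_measurable hd). Qed.
Let Pr1 eta : Pr eta setT = 1%E. Proof. exact: prob_kernel. Qed.

Let mYpre n D : measurable D -> measurable (Y n @^-1` D).
Proof. by move=> mD; rewrite -[X in measurable X]setTI; exact: mY. Qed.

Let mepre n D : measurable D -> measurable (e n @^-1` D).
Proof. by move=> mD; rewrite -[X in measurable X]setTI; exact: me. Qed.

Lemma measurable_jump_rate : measurable_fun [set: N] rate.
Proof. by have [] := sector_bounded_jump_rate E_borel alpha mc c0 cb. Qed.

Lemma measurable_jump_prob D : measurable D ->
  measurable_fun [set: N] (fun zeta => jump_prob alpha c zeta D).
Proof.
move=> mD; apply: measurable_fun_ifT.
- by apply: measurable_fun_eqr => //; exact: measurable_jump_rate.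
- exact/measurable_EFinP/measurable_indic.
- apply: emeasurable_funM; last first.
    exact: (measurable_jump_integral E_borel alpha mc c0 (nonneg_measurable_indic R mD)).
  apply/measurable_EFinP.
  rewrite (_ : (fun _ => _) = (fun zeta => (rate zeta) `^ (-1))).
    exact: (measurableT_comp (measurable_powR _) measurable_jump_rate).
  apply/funext => zeta; rewrite powR_inv1//; exact: (jump_rate_ge0 E_borel).
Qed.

(** The singleton of [eta] need not be measurable in the space of representatives, so the initial
    condition is expressed through measurable functions [u] of the configuration. *)
Lemma start_ae d' (T : measurableType d') eta (u : N -> T) :
  measurable_fun [set: N] u -> measurable [set u eta] ->
  {ae Pr eta, forall w, u (Y 0%N w) = u eta}.
Proof.
move=> mu m1; have mB : measurable (u @^-1` [set u eta]).
  by rewrite -[X in measurable X]setTI; exact: mu.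
apply: (prob1_ae (Pr1 eta) (G := Y 0%N @^-1` (u @^-1` [set u eta]))).
  exact: mYpre.
by rewrite (chain_start hd)// diracE mem_set.
Qed.

Lemma jump_prob_ge0 zeta D : measurable D -> (0 <= jump_prob alpha c zeta D)%E.
Proof.
move=> mD; rewrite /jump_prob; case: ifP => _; first exact: measure_ge0.
rewrite mule_ge0// ?lee_fin ?invr_ge0 ?(jump_rate_ge0 E_borel)//.
have [h _ _] := sigma_functional_jump_integral E_borel alpha mc c0 zeta.
exact: (h _ (nonneg_measurable_indic R mD)).
Qed.

Lemma step_law eta n D : measurable D ->
  Pr eta (Y n.+1 @^-1` D) = (\int[Pr eta]_w jump_prob alpha c (Y n w) D)%E.
Proof.
move=> mD; have := chain_step hd eta n (B := fun=> setT) (fun=> measurableT) mD.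
have -> : \bigcap_(i < n.+1) (Y i @^-1` setT) = setT.
  by apply/seteqP; split => // w _ i _.
by rewrite setTI.
Qed.

Lemma first_jump_law eta D : measurable D ->
  Pr eta (Y 1%N @^-1` D) = jump_prob alpha c eta D.
Proof.
move=> mD; rewrite step_law//.
rewrite (ge0_ae_eq_integral (g := cst (jump_prob alpha c eta D)))//.
- by rewrite integral_cst// Pr1 mule1.
- exact: (measurableT_comp (measurable_jump_prob mD) (mY 0)).
- by move=> w _; exact: jump_prob_ge0.
- by move=> w _; exact: jump_prob_ge0.
- have := start_ae (eta := eta) (measurable_jump_prob mD) (emeasurable_set1 _).
  by apply: filterS => w h _.
Qed.

Lemma jump_integral_restrict n eta : sector n eta ->
  jump_integral alpha c (fun zeta => (\1_(sector n) zeta)%:E) eta = (rate eta)%:E.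
Proof.
move=> etan.
have hs : sector_bounded (\1_(sector n) : N -> R).
  apply: sector_bounded_bounded; split.
    by apply: measurable_indic; exact: measurable_sector.
  by exists 1 => z; rewrite indicE; case: (_ \in _); rewrite ?normr1 ?normr0.
rewrite (jump_integral_EFin E_borel alpha mc c0 cb (f := \1_(sector n)))//.
rewrite (jump_rateE E_borel)//; congr EFin; apply: (jump_mean_sector E_borel _ _ etan).
by move=> z zn; rewrite indicE mem_set.
Qed.

Lemma jump_prob_sector n eta : sector n eta ->
  jump_prob alpha c eta (sector n) = 1%E.
Proof.
move=> etan; rewrite /jump_prob; case: ifPn => r0; first by rewrite diracE mem_set.
by rewrite jump_kernelE jump_integral_restrict// -EFinM mulVf.
Qed.

Lemma chain_sector n eta k : sector n eta -> Pr eta (Y k @^-1` sector n) = 1%E.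
Proof.
have ms := @measurable_sector R d E n.
move=> etan; elim: k => [|k IH]; first by rewrite (chain_start hd)// diracE mem_set.
rewrite step_law//.
rewrite (ge0_ae_eq_integral (g := cst 1%E))//.
- by rewrite integral_cst// Pr1 mule1.
- exact: (measurableT_comp (measurable_jump_prob ms) (mY k)).
- by move=> w _; exact: jump_prob_ge0.
- have := prob1_ae (Pr1 eta) (mYpre k ms) IH.
  by apply: filterS => w h _; exact: jump_prob_sector.
Qed.

(** Almost surely the whole chain stays in the sector, so it does not matter which index [jump_path]
    selects, its default included. *)
Lemma path_sector_ae n eta t : sector n eta -> {ae Pr eta, forall w, sector n (X t w)}.
Proof.
move=> etan.
have h k : {ae Pr eta, forall w, sector n (Y k w)}.
  apply: (prob1_ae (Pr1 eta) (G := Y k @^-1` sector n)); last exact: chain_sector.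
  by apply: mYpre; exact: measurable_sector.
have : \forall w \ae Pr eta, forall k, sector n (Y k w) by apply/ae_foralln.
by apply: filterS => w hw; exact: hw.
Qed.

Lemma exponential_prob_ge0_le (x : R) : 0 <= x -> exponential_prob 1 `[0, x] = (1 - expR (- x))%:E.
Proof.
rewrite le_eqVlt => /predU1P[<-|x0].
  by rewrite set_itv1 /exponential_prob integral_set1 oppr0 expR0 subrr.
by rewrite exponential_prob_itv0c// mulN1r EFinB.
Qed.

Let one_sub_exp_bounds (x : R) : 0 <= x ->
  0 <= 1 - expR (- x) <= x /\ x - (1 - expR (- x)) <= x ^+ 2.
Proof.
move=> x0; have h1 := expR_ge1Dx (- x); have h2 := expR_ge1Dx x.
have e1 : expR (- x) <= 1 by rewrite expR_le1 oppr_le0.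
split; first by apply/andP; split; lra.
have : expR (- x) <= 1 - x + x ^+ 2; last by lra.
have x1 : 0 < 1 + x by lra.
(* The product of [1 + x] and [1 - x + x ^+ 2] is [1 + x ^+ 3], hence at least 1. *)
rewrite expRN; apply: (@le_trans _ _ (1 + x)^-1).
  by rewrite lef_pV2 ?posrE ?expR_gt0.
rewrite -(ler_pM2l x1) mulfV ?gt_eqF//.
have : 0 <= x ^+ 3 by rewrite exprn_ge0.
by nra.
Qed.

Lemma exponential_probT : exponential_prob 1 [set: R] = 1%E.
Proof. by rewrite /exponential_prob integral_exponential_pdf. Qed.

Lemma clock_joint_law eta D C0 C1 : measurable D -> measurable C0 -> measurable C1 ->
  Pr eta (Y 1%N @^-1` D `&` (e 0%N @^-1` C0 `&` e 1%N @^-1` C1)) =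
  (Pr eta (Y 1%N @^-1` D) * (exponential_prob 1 C0 * exponential_prob 1 C1))%E.
Proof.
move=> mD mC0 mC1.
pose B i := if i == 1%N then D else setT.
pose C i := if i == 0%N then C0 else C1.
have mB i : measurable (B i) by rewrite /B; case: ifP.
have mC i : measurable (C i) by rewrite /C; case: ifP.
have := clock_law hd eta 2 mB mC.
have -> : \bigcap_(i < 2) (Y i @^-1` B i) = Y 1%N @^-1` D.
  apply/seteqP; split => [w /(_ 1%N)|w Dw i]; first by apply.
  by case: i => [|[|]].
have -> : \bigcap_(i < 2) (e i @^-1` C i) = e 0%N @^-1` C0 `&` e 1%N @^-1` C1.
  apply/seteqP; split => [w h|w [h0 h1] i]; first by split; [exact: (h 0%N)|exact: (h 1%N)].
  by case: i => [|[|]].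
by rewrite big_ord_recl big_ord1.
Qed.

Section path.
Variables (t : R) (w : Omega).

Lemma holding_time_ge0 i : (0 <= holding_time alpha c Y e i w)%E.
Proof.
rewrite /holding_time; case: ifP => _; first exact: leey.
rewrite lee_fin divr_ge0// ?(jump_rate_ge0 E_borel)//.
exact/ltW/(clock_gt0 hd).
Qed.

(** Jump times are monotone, so the intervals between them are disjoint and the index chosen in
    [jump_path] is forced. *)
Lemma jump_pathE k :
  (jump_time alpha c Y e k w <= t%:E < jump_time alpha c Y e k.+1 w)%E ->
  X t w = Y k w.
Proof.
have mono m n : (m <= n)%N -> (jump_time alpha c Y e m w <= jump_time alpha c Y e n w)%E.
  move=> /subnKC <-; elim: (n - m)%N => [|i IH]; first by rewrite addn0.
  rewrite addnS; apply: (le_trans IH).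
  rewrite /jump_time big_ord_recr/= leeDl//; exact: holding_time_ge0.
move=> kt; rewrite /X /jump_path; congr (Y _ w).
case: xgetP => [m _ /= mt|/(_ k)//].
move: kt mt => /andP[kt tk] /andP[mt tm].
case: (ltngtP m k) => // [mk|km].
  by have := lt_le_trans tm (le_trans (mono _ _ mk) kt); rewrite ltxx.
by have := lt_le_trans tk (le_trans (mono _ _ km) mt); rewrite ltxx.
Qed.

Lemma path_before_first_jump : 0 <= t -> rate (Y 0%N w) * t < e 0%N w ->
  X t w = Y 0%N w.
Proof.
move=> t0 h; apply: jump_pathE; rewrite /jump_time big_ord0 big_ord1 lee_fin t0/=.
rewrite /holding_time; case: ifPn => [_|r0]; first exact: ltry.
by rewrite lte_fin ltr_pdivlMr 1?mulrC// lt_neqAle eq_sym r0 (jump_rate_ge0 E_borel).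
Qed.

Lemma path_after_first_jump : 0 <= t -> e 0%N w <= rate (Y 0%N w) * t ->
  rate (Y 1%N w) * t < e 1%N w -> X t w = Y 1%N w.
Proof.
move=> t0 h0 h1; apply: jump_pathE.
have e0 := clock_gt0 hd 0 w.
have r0 : 0 < rate (Y 0%N w).
  rewrite lt_neqAle eq_sym (jump_rate_ge0 E_borel)// andbT; apply/eqP => r0.
  by move: h0; rewrite r0 mul0r leNgt e0.
have H0 : holding_time alpha c Y e 0 w = (e 0%N w / rate (Y 0%N w))%:E.
  by rewrite /holding_time gt_eqF.
rewrite /jump_time big_ord1 big_ord_recl big_ord1 /= H0 lee_fin.
rewrite ler_pdivrMr// mulrC h0/=.
apply: (@lt_le_trans _ _ (holding_time alpha c Y e 1 w)); last first.
  by rewrite leeDr// lee_fin divr_ge0 ?ltW.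
rewrite /holding_time; case: ifPn => [_|r1]; first exact: ltry.
by rewrite lte_fin ltr_pdivlMr 1?mulrC// lt_neqAle eq_sym r1 (jump_rate_ge0 E_borel).
Qed.

End path.

Section local_estimate.
Variables (f : N -> R) (M : R) (n : nat) (eta : N) (h rn : R).
Hypotheses (mf : measurable_fun [set: N] f) (fM : forall zeta, `|f zeta| <= M).
Hypotheses (etan : sector n eta) (h0 : 0 <= h).
Hypothesis rate_le : forall zeta, sector n zeta -> rate zeta <= rn.

Let r := rate eta.
Let r0 : 0 <= r. Proof. exact: (jump_rate_ge0 E_borel). Qed.
Let rrn : r <= rn. Proof. exact: rate_le. Qed.
Let M0 : 0 <= M. Proof. exact: le_trans (fM point). Qed.
Let rh0 : 0 <= r * h. Proof. exact: mulr_ge0. Qed.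
Let rnh0 : 0 <= rn * h. Proof. by rewrite mulr_ge0// (le_trans r0). Qed.
Let bf : bounded_measurable f. Proof. by split => //; exists M. Qed.
Let sf : sector_bounded f. Proof. exact: sector_bounded_bounded. Qed.

(** The first clock, run at speed [r], rings by time [h]; [q] below is the probability of this
    event. If [r = 0] the event is empty, because clocks are positive. *)
Let A := e 0%N @^-1` `[0, r * h].
Let q := 1 - expR (- (r * h)).
Let mA : measurable A. Proof. by apply: mepre. Qed.
Let B := e 0%N @^-1` `[0, rn * h] `&` e 1%N @^-1` `[0, rn * h].
Let mB : measurable B. Proof. by apply: measurableI; apply: mepre. Qed.

Let inA w : A w <-> e 0%N w <= r * h.
Proof. by rewrite /A /= in_itv/= ltW// (clock_gt0 hd). Qed.

Let PrB : fine (Pr eta B) <= (rn * h) ^+ 2.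
Proof.
have := clock_joint_law eta measurableT (measurable_itv `[0, rn * h]) (measurable_itv `[0, rn * h]).
rewrite preimage_setT setTI -/B Pr1 mul1e => ->.
have [/andP[q0 qle] _] := one_sub_exp_bounds rnh0.
by rewrite exponential_prob_ge0_le// -EFinM/= expr2 ler_pM.
Qed.

(** The mean of [g] after the first jump, with the absorbing convention of [jump_prob]. *)
Let jm (g : N -> R) := if r == 0 then g eta else r^-1 * jump_mean g eta.

Let jmD (a : R) : jm (fun zeta => f zeta + a) = jm f + a.
Proof.
rewrite /jm; case: ifPn => [//|rn0].
rewrite jump_meanD//; last exact: sector_bounded_cst.
rewrite mulrDr; congr (_ + _).
rewrite (_ : (fun=> a) = (fun zeta : N => a * 1 : R)); last first.
  by apply/funext => z; rewrite mulr1.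
rewrite jump_meanZ//; last exact: sector_bounded_cst.
by rewrite -(jump_rateE E_borel)// mulrCA mulVf ?mulr1.
Qed.

(** The first clock is independent of the first jump. Both sides are countably additive in [g], so
    the product formula for indicators is enough. *)
Let first_jump_mean_ge0 (g : N -> R) : bounded_measurable g -> (forall z, 0 <= g z) ->
  \int[Pr eta]_w (\1_A w * g (Y 1%N w)) = q * jm g.
Proof.
move=> bg g0; have sg := sector_bounded_bounded bg.
have [/andP[q0 _] _] := one_sub_exp_bounds rh0.
pose T1 (F : N -> \bar R) := (\int[Pr eta]_w ((\1_A w)%:E * F (Y 1%N w)))%E.
pose T2 (F : N -> \bar R) :=
  (q%:E * (if r == 0%R then F eta else r^-1%:E * jump_integral alpha c F eta))%E.
have h1 : sigma_functional T1.
  apply: (sigma_functional_comp (T := fun F => (\int[Pr eta]_w ((\1_A w)%:E * F w))%E)) => //.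
  apply: sigma_functional_mul; last exact: sigma_functional_integral.
  exact: nonneg_measurable_indic.
have h2 : sigma_functional T2.
  apply: sigma_functional_scale => //.
  case: (r == 0); first exact: sigma_functional_eval.
  apply: sigma_functional_scale; first by rewrite invr_ge0.
  exact: sigma_functional_jump_integral.
have h12 D : measurable D -> T1 (fun z => (\1_D z)%:E) = T2 (fun z => (\1_D z)%:E).
  move=> mD; rewrite /T1.
  transitivity (\int[Pr eta]_w (\1_(A `&` Y 1%N @^-1` D) w)%:E)%E.
    by apply: eq_integral => w _; rewrite indicI -EFinM.
  rewrite integral_indic// ?setIT; last by apply: measurableI => //; exact: mYpre.
  have := clock_joint_law eta mD (measurable_itv `[0, r * h]) measurableT.
  rewrite preimage_setT setIT setIC => ->.
  rewrite exponential_probT mule1 exponential_prob_ge0_le// muleC /T2; congr (_ * _)%E.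
  by rewrite first_jump_law// /jump_prob -/r.
have := eq_sigma_functional h1 h2 h12 (f := EFin \o g).
rewrite /T1 /T2 jump_integral_EFin// => E1.
rewrite /Rintegral; under eq_integral do rewrite EFinM.
rewrite [X in fine X]E1; last first.
  by split; [move=> z; rewrite lee_fin g0|apply/measurable_EFinP; exact: bg.1].
by rewrite /jm; case: ifP.
Qed.

Let bA : bounded_measurable (\1_A : Omega -> R).
Proof.
split; first exact: measurable_indic.
by exists 1 => w; rewrite indicE; case: (_ \in _); rewrite ?normr1 ?normr0.
Qed.

Let bA' : bounded_measurable (fun w => 1 - \1_A w : R).
Proof.
split; first by apply: measurable_funB => //; exact: measurable_indic.
exists 1 => w; rewrite indicE; case: (_ \in _); first by rewrite subrr normr0.
by rewrite subr0 normr1.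
Qed.

Let bY k : bounded_measurable (fun w => f (Y k w)).
Proof. by split; [exact: measurableT_comp|exists M]. Qed.

Let PrA : \int[Pr eta]_w \1_A w = q.
Proof.
have := first_jump_mean_ge0 (bounded_measurable_cst N 1) (fun=> ler01).
under eq_Rintegral do rewrite mulr1.
move=> ->; rewrite /jm; case: ifPn => [_|rn0]; first by rewrite mulr1.
by rewrite -(jump_rateE E_borel)// mulVf ?mulr1.
Qed.

Let first_jump_mean : \int[Pr eta]_w (\1_A w * f (Y 1%N w)) = q * jm f.
Proof.
(* Adding [M] makes the function nonnegative; the constant is subtracted again at the end. *)
have bg : bounded_measurable (fun z => f z + M).
  exact/bounded_measurableD/bounded_measurable_cst.
have g0 z : 0 <= f z + M by have := fM z; rewrite ler_norml => /andP[? _]; lra.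
have := first_jump_mean_ge0 bg g0; rewrite jmD mulrDr.
rewrite (_ : (fun w => \1_A w * (f (Y 1%N w) + M)) =
    (fun w => \1_A w * f (Y 1%N w) + M * \1_A w)); last first.
  by apply/funext => w; rewrite mulrDr [M * _]mulrC.
rewrite RintegralD//; last 2 first.
- by apply: (bounded_integrable1 (Pr1 eta)); exact: bounded_measurableM.
- apply: (bounded_integrable1 (Pr1 eta)); apply: bounded_measurableM => //.
  exact: bounded_measurable_cst.
rewrite RintegralZl//; last exact: (bounded_integrable1 (Pr1 eta)).
by rewrite PrA [M * q]mulrC => /addIr.
Qed.

Let no_jump_mean : \int[Pr eta]_w ((1 - \1_A w) * f (Y 0%N w)) = (1 - q) * f eta.
Proof.
transitivity (\int[Pr eta]_w (f eta * (1 - \1_A w))).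
  apply: (@ae_eq_Rintegral _ _ _ (Pr eta)
    (fun w => (1 - \1_A w) * f (Y 0%N w)) (fun w => f eta * (1 - \1_A w))).
  - exact: (bounded_measurableM bA' (bY 0)).1.
  - exact: (bounded_measurableM (bounded_measurable_cst _ (f eta)) bA').1.
  - have := start_ae (eta := eta) mf (measurable_set1 _).
    by apply: filterS => w ->; rewrite mulrC.
rewrite RintegralZl//; last exact: (bounded_integrable1 (Pr1 eta)).
rewrite RintegralB//; last 2 first.
- by apply: (bounded_integrable1 (Pr1 eta)); exact: bounded_measurable_cst.
- exact: (bounded_integrable1 (Pr1 eta)).
by rewrite PrA (Rintegral_cst1 (Pr1 eta)) mulrC.
Qed.

(* Unless B occurs, which has probability at most (rn * h) ^ 2, there is at most
   one jump before time h, and it happens exactly on A. *)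
Lemma semigroup_local_estimate :
  `|semigroup Pr X h f eta - euler_step alpha c h f eta| <= 4 * M * (rn * h) ^+ 2.
Proof.
(* The value of [f] on a path that is stopped after its first jump. *)
pose u w := \1_A w * f (Y 1%N w) + (1 - \1_A w) * f (Y 0%N w).
have bu : bounded_measurable u by apply: bounded_measurableD; exact: bounded_measurableM.
have uE : \int[Pr eta]_w u w = q * jm f + (1 - q) * f eta.
  rewrite /u RintegralD//; last 2 first.
  - by apply: (bounded_integrable1 (Pr1 eta)); exact: bounded_measurableM.
  - by apply: (bounded_integrable1 (Pr1 eta)); exact: bounded_measurableM.
  by rewrite first_jump_mean no_jump_mean.
have bfX : bounded_measurable (fun w => f (X h w)).
  by split; [exact: (measurableT_comp mf (mX h0))|exists M].
(* A second jump before time [h] requires both clocks to ring within [rn * h]; on that event the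
   values differ by at most [2 * M]. *)
have d1 : `|semigroup Pr X h f eta - \int[Pr eta]_w u w| <= (2 * M) * (rn * h) ^+ 2.
  apply: (@le_trans _ _ ((2 * M) * fine (Pr eta B))); last by rewrite ler_wpM2l ?mulr_ge0.
  apply: (Rintegral_ae_dist (Pr1 eta)) => //; first by rewrite mulr_ge0.
  have g1 := start_ae (eta := eta) measurable_jump_rate (measurable_set1 _).
  have g2 : {ae Pr eta, forall w, sector n (Y 1%N w)}.
    apply: (prob1_ae (Pr1 eta) (G := Y 1%N @^-1` sector n)); last exact: chain_sector.
    by apply: mYpre; exact: measurable_sector.
  have e0 w := clock_gt0 hd 0 w.
  have e1 w := clock_gt0 hd 1 w.
  move: g1 g2; apply: filterS2 => w rY0 Y1n; rewrite /u.
  have [/inA Aw|Aw] := pselect (A w).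
    rewrite (_ : \1_A w = 1); last by rewrite indicE mem_set//; exact/inA.
    rewrite mul1r subrr mul0r addr0.
    have [Bw|Bw] := pselect (B w).
      rewrite indicE mem_set// mulr1 (le_trans (ler_normB _ _))//.
      by have := fM (X h w); have := fM (Y 1%N w); lra.
    rewrite path_after_first_jump ?subrr ?normr0 ?mulr_ge0//; first by rewrite rY0.
    rewrite ltNge; apply/negP => e1h; apply: Bw; rewrite /B; split => /=; rewrite in_itv/= ltW//=.
      by rewrite (le_trans Aw)// ler_wpM2r.
    by rewrite (le_trans e1h)// ler_wpM2r// rate_le.
  rewrite (_ : \1_A w = 0); last by rewrite indicE memNset.
  rewrite mul0r add0r subr0 mul1r path_before_first_jump ?subrr ?normr0 ?mulr_ge0//.
  by rewrite rY0 ltNge; apply/negP => /inA.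
have d2 : `|\int[Pr eta]_w u w - euler_step alpha c h f eta| <= (2 * M) * (rn * h) ^+ 2.
  rewrite uE /euler_step -/r.
  have Kf := jump_mean_norm E_borel alpha mc c0 cb etan sf (fun z _ => fM z).
  have [q0 qe] := one_sub_exp_bounds rh0; rewrite -/q in q0 qe.
  rewrite /jm; case: ifPn => [/eqP rr0|rneq0].
    have -> : jump_mean f eta = 0.
      by apply/eqP; rewrite -normr_le0; move: Kf; rewrite -/r rr0 mulr0.
    rewrite rr0 (_ : _ - _ = 0); last by ring.
    by rewrite normr0; apply: mulr_ge0; [exact: mulr_ge0|exact: sqr_ge0].
  (* The Euler step replaces the jump probability [q] by its linearization [r * h], which costs at
     most [(r * h) ^+ 2] times the bound [2 * M] of the second factor. *)
  rewrite (_ : _ - _ = (r * h - q) * (f eta - r^-1 * jump_mean f eta)); last by field.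
  rewrite normrM ger0_norm; last by case/andP: q0 => _; rewrite subr_ge0.
  rewrite mulrC; apply: ler_pM => //.
  - by case/andP: q0 => _; rewrite subr_ge0.
  - rewrite (le_trans (ler_normB _ _))// mulrDl mul1r lerD//.
    rewrite normrM normfV (ger0_norm r0) mulrC ler_pdivrMr// lt_neqAle eq_sym rneq0//.
  - rewrite (le_trans qe)// lerXn2r ?nnegrE// ler_wpM2r//.
rewrite (le_trans (ler_distD (\int[Pr eta]_w u w) _ _))//.
by apply: (le_trans (lerD d1 d2)); lra.
Qed.

End local_estimate.

End jump_chain.

(** * Approximation of the semigroup *)

Lemma eq_of_harmonic_bound (R : realType) (a b C k0 : R) :
  (forall k : nat, k0 <= k.+1%:R -> `|a - b| <= C / k.+1%:R) -> a = b.
Proof.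
move=> h; apply/eqP; rewrite -subr_eq0 -normr_le0 leNgt; apply/negP => ab.
pose m := Num.max k0 (C / `|a - b|).
have hm : m < (Num.truncn m).+1%:R by exact: truncnS_gt.
have k0m : k0 <= (Num.truncn m).+1%:R.
  by apply: le_trans (ltW hm); rewrite le_max lexx.
have := h _ k0m; rewrite leNgt => /negP[].
rewrite ltr_pdivrMr// mulrC -ltr_pdivrMr//.
by apply: le_lt_trans hm; rewrite le_max lexx orbT.
Qed.

Section path_semigroup.
Context (R : realType) d (E : measurableType d).
Hypothesis E_borel : borel_space R E.
Variables (alpha : {finite_measure set E -> \bar R}) (c : E -> E -> R).
Hypothesis mc : measurable_fun [set: E * E] (fun xy : E * E => c xy.1 xy.2).
Hypothesis c0 : forall x y, 0 <= c x y.
Hypothesis cb : exists M : R, forall x y, c x y <= M.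
Local Notation N := (config R E).
Local Notation rate := (jump_rate alpha c).
Local Notation euler := (euler_step alpha c).
Context dO (Omega : measurableType dO) (Pr : R.-pker N ~> Omega).
Variables (X : R -> Omega -> N).
Hypothesis X_gSIP : gSIP alpha c Pr X.
Implicit Types (eta zeta : N) (f g : N -> R).
Local Notation sg := (semigroup Pr X).

Let Pr1 eta : Pr eta setT = 1%E. Proof. exact: prob_kernel. Qed.
Let mX t : 0 <= t -> measurable_fun [set: Omega] (X t).
Proof. by case: X_gSIP => _ [h _]; exact: h. Qed.

Definition transition_integral t (F : N -> \bar R) eta := (\int[Pr eta]_w F (X t w))%E.

Lemma measurable_transition_integral t F : 0 <= t -> nonneg_measurable F ->
  measurable_fun [set: N] (transition_integral t F).
Proof.
move=> t0 [F0 mF].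
have mFX : measurable_fun setT (fun w => F (X t w)).
  exact: (measurableT_comp mF (mX t0)).
exact: (measurable_fun_integral_kernel (measurable_kernel Pr) (fun w => F0 (X t w)) mFX).
Qed.

Lemma sigma_functional_transition t eta : 0 <= t ->
  sigma_functional (fun F => transition_integral t F eta).
Proof.
by move=> t0; apply: (sigma_functional_comp (mX t0)); exact: sigma_functional_integral.
Qed.

Lemma path_sector t n eta : sector n eta -> {ae Pr eta, forall w, sector n (X t w)}.
Proof.
case: X_gSIP => [[Y [e [hd ->]]] _].
exact: (path_sector_ae E_borel mc c0 cb hd).
Qed.

Let bfX t f : 0 <= t -> bounded_measurable f -> bounded_measurable (fun w => f (X t w)).
Proof.
move=> t0 [mf [M fM]]; split; last by exists M => w.
exact: (measurableT_comp mf (mX t0)).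
Qed.

Lemma semigroup_norm t f M eta : 0 <= t -> measurable_fun setT f ->
  (forall zeta, `|f zeta| <= M) -> `|sg t f eta| <= M.
Proof.
move=> t0 mf fM; apply: (Rintegral_bounded_norm (Pr1 eta)) => //.
exact: (measurableT_comp mf (mX t0)).
Qed.

Lemma semigroup_cst t a eta : sg t (fun=> a) eta = a.
Proof. exact: (Rintegral_cst1 (Pr1 eta)). Qed.

Lemma semigroup_eq_sector t f g n eta : 0 <= t -> sector n eta ->
  measurable_fun setT f -> measurable_fun setT g ->
  (forall zeta, sector n zeta -> f zeta = g zeta) -> sg t f eta = sg t g eta.
Proof.
move=> t0 etan mf mg fg; apply: ae_eq_Rintegral.
- exact: (measurableT_comp mf (mX t0)).
- exact: (measurableT_comp mg (mX t0)).
- by have := path_sector t etan; apply: filterS => w /fg.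
Qed.

Lemma semigroup_restrict t f n eta : 0 <= t -> sector n eta -> sector_bounded f ->
  sg t f eta = sg t (restrict_sector n f) eta.
Proof.
move=> t0 etan hf; apply: (semigroup_eq_sector t0 etan); first exact: hf.1.
  exact: (bounded_restrict_sector n hf).1.
by move=> zeta zn; rewrite restrict_sectorE.
Qed.

Lemma semigroupD_bounded t f g eta : 0 <= t -> bounded_measurable f ->
  bounded_measurable g -> sg t (fun z => f z + g z) eta = sg t f eta + sg t g eta.
Proof.
by move=> t0 bf bg; rewrite /semigroup RintegralD//;
  apply: (bounded_integrable1 (Pr1 eta)); exact: bfX.
Qed.

Lemma semigroupD t f g eta : 0 <= t -> sector_bounded f -> sector_bounded g ->
  sg t (fun z => f z + g z) eta = sg t f eta + sg t g eta.
Proof.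
move=> t0 hf hg; have [n etan] := sector_ex eta.
rewrite (semigroup_restrict t0 etan hf) (semigroup_restrict t0 etan hg).
rewrite -semigroupD_bounded//; [|exact: bounded_restrict_sector..].
apply: (semigroup_eq_sector t0 etan).
- exact: (sector_boundedD hf hg).1.
- apply: measurable_funD; first exact: (bounded_restrict_sector n hf).1.
  exact: (bounded_restrict_sector n hg).1.
- by move=> zeta zn; rewrite !restrict_sectorE.
Qed.

Lemma semigroupZ t a f eta : 0 <= t -> sector_bounded f ->
  sg t (fun z => a * f z) eta = a * sg t f eta.
Proof.
move=> t0 hf; have [n etan] := sector_ex eta.
have br := bounded_restrict_sector n hf.
transitivity (sg t (fun z => a * restrict_sector n f z) eta).
  apply: (semigroup_eq_sector t0 etan).
  - exact: (sector_boundedZ a hf).1.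
  - by apply: measurable_funM => //; exact: br.1.
  - by move=> zeta zn; rewrite restrict_sectorE.
rewrite (semigroup_restrict t0 etan hf) /semigroup RintegralZl//.
by apply: (bounded_integrable1 (Pr1 eta)); exact: bfX.
Qed.

Lemma semigroup_sum t I (l : seq I) (a : I -> R) (F : I -> N -> R) eta : 0 <= t ->
  (forall i, sector_bounded (F i)) ->
  sg t (fun z => \sum_(i <- l) a i * F i z) eta = \sum_(i <- l) a i * sg t (F i) eta.
Proof.
move=> t0 hF; elim: l => [|i l IH].
  rewrite big_nil -[RHS](semigroup_cst t 0 eta); congr (sg t _ eta).
  by apply/funext => z; rewrite big_nil.
rewrite big_cons -IH -semigroupZ// -semigroupD//.
- by congr (sg t _ eta); apply/funext => z; rewrite big_cons.
- exact: sector_boundedZ.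
- by apply: sector_bounded_sum => j; exact: sector_boundedZ.
Qed.

Lemma semigroup_EFin t f eta : 0 <= t -> bounded_measurable f ->
  (sg t f eta)%:E = transition_integral t (EFin \o f) eta.
Proof.
move=> t0 bf; rewrite /semigroup /Rintegral fineK//.
apply: integrable_fin_num => //.
by apply: (bounded_integrable1 (Pr1 eta)); exact: bfX.
Qed.

Lemma bounded_semigroup t f : 0 <= t -> bounded_measurable f ->
  bounded_measurable (sg t f).
Proof.
move=> t0 bf; have [mf [M fM]] := bf; split; last first.
  by exists M => eta; exact: semigroup_norm.
(* Measurability of [transition_integral] is available for nonnegative functions, hence the shift by
   [M]. *)
have bg : bounded_measurable (fun z => f z + M).
  exact/bounded_measurableD/bounded_measurable_cst.
rewrite (_ : sg t f = (fun eta => fine (transition_integral t (EFin \o (fun z => f z + M)) eta) - M)).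
  apply: measurable_funB => //; apply: measurableT_comp => //.
  apply: measurable_transition_integral => //; split.
    by move=> z /=; rewrite lee_fin; have := fM z; rewrite ler_norml => /andP[? _]; lra.
  by apply/measurable_EFinP; exact: bg.1.
apply/funext => eta; rewrite -semigroup_EFin//= semigroupD_bounded//; last first.
  exact: bounded_measurable_cst.
by rewrite semigroup_cst addrK.
Qed.

Lemma sector_bounded_semigroup t f : 0 <= t -> sector_bounded f -> sector_bounded (sg t f).
Proof.
move=> t0 hf; split; last first.
  move=> n; have [mr [M rM]] := bounded_restrict_sector n hf; exists M => eta etan.
  by rewrite (semigroup_restrict t0 etan hf); exact: semigroup_norm.
have -> : [set: N] = \bigcup_n sector n.
  by apply/seteqP; split => // eta _; have [n etan] := sector_ex eta; exists n.
apply/measurable_fun_bigcup => n; first exact: measurable_sector.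
apply: (eq_measurable_fun (sg t (restrict_sector n f))).
  by move=> eta /set_mem etan; rewrite -semigroup_restrict.
apply: (@measurable_funS _ _ _ _ setT) => //.
exact: (bounded_semigroup t0 (bounded_restrict_sector n hf)).1.
Qed.

(** Both sides are countably additive in a nonnegative [f], so the Markov property, a statement on
    indicators, is enough. *)
Lemma semigroup_add s t f eta : 0 <= s -> 0 <= t -> bounded_measurable f ->
  sg (s + t) f eta = sg s (sg t f) eta.
Proof.
move=> s0 t0 bf; have st0 : 0 <= s + t by exact: addr_ge0.
have [mf [M fM]] := bf.
have law F : nonneg_measurable F -> transition_integral (s + t) F eta =
    transition_integral s (transition_integral t F) eta.
  move=> hF.
  have h1 := sigma_functional_transition eta st0.
  have h2 : sigma_functional (fun F => transition_integral s (transition_integral t F) eta).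
    have K := @sigma_functional_kernel R _ _ N N (transition_integral t)
      (fun F => transition_integral s F eta).
    apply: K.
    - by move=> G; exact: measurable_transition_integral.
    - by move=> z; exact: sigma_functional_transition.
    - exact: sigma_functional_transition.
  have U := eq_sigma_functional h1 h2; apply: U => // D mD.
  rewrite /transition_integral !integral_indic_comp//; [|exact: mX..].
  (* The Markov property with the sure event as past; that event is the complement of the empty set,
     hence in the generated sigma-algebra. *)
  case: X_gSIP => _ [_ /(_ eta s t setT D s0 t0)]; rewrite setTI => ->//.
    apply: eq_integral => w _; rewrite integral_indic_comp//; exact: mX.
  by move=> Z [[Z0 ZC _] _]; have := ZC _ Z0; rewrite setD0.
have bg : bounded_measurable (fun z => f z + M).
  exact/bounded_measurableD/bounded_measurable_cst.
have g0 z : 0 <= f z + M by have := fM z; rewrite ler_norml => /andP[? _]; lra.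
have : sg (s + t) (fun z => f z + M) eta = sg s (sg t (fun z => f z + M)) eta.
  apply: EFin_inj; rewrite !semigroup_EFin//; last exact: bounded_semigroup.
  rewrite law; last first.
    by split; [move=> z; rewrite lee_fin|apply/measurable_EFinP; exact: bg.1].
  by congr (transition_integral s _ eta); apply/funext => z; rewrite /= semigroup_EFin.
rewrite semigroupD_bounded//; last exact: bounded_measurable_cst.
rewrite (_ : sg t (fun z => f z + M) = (fun z => sg t f z + M)); last first.
  apply/funext => z; rewrite semigroupD_bounded//; last exact: bounded_measurable_cst.
  by rewrite semigroup_cst.
rewrite semigroupD_bounded//; [|exact: bounded_semigroup|exact: bounded_measurable_cst].
by rewrite !semigroup_cst => /addIr.
Qed.

(** Consistency plus stability: every step commits one local error, and by contraction the error
    accumulated before is not amplified. *)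
Lemma semigroup_euler_bound n rn f M j h eta :
  (forall zeta, sector n zeta -> rate zeta <= rn) -> measurable_fun setT f ->
  (forall zeta, `|f zeta| <= M) -> 0 <= h -> h * rn <= 1 -> sector n eta ->
  `|sg (j%:R * h) f eta - iter j (euler h) f eta| <= j%:R * (4 * M * (rn * h) ^+ 2).
Proof.
move=> hr mf fM h0 h1 etan.
have local g t zeta : measurable_fun setT g -> (forall z, `|g z| <= M) -> 0 <= t ->
    sector n zeta -> `|sg t g zeta - euler t g zeta| <= 4 * M * (rn * t) ^+ 2.
  move=> mg gM t0 zn; case: X_gSIP => [[Y [e [hd XE]]] _].
  have mX' u : 0 <= u -> measurable_fun [set: Omega] (jump_path alpha c Y e u).
    by rewrite -XE; exact: mX.
  rewrite XE; exact: (semigroup_local_estimate E_borel mc c0 cb hd mX' mg gM zn t0 hr).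
have bf : bounded_measurable f by split => //; exists M.
elim: j eta etan => [|j IH] eta etan.
  (* At time 0 the bound of the local estimate is 0, so it says that the semigroup starts at the
     identity. *)
  have := local f 0 eta mf fM (lexx 0) etan.
  by rewrite /euler_step !mul0r mulr0 expr0n/= mulr0 addr0.
have jh0 : 0 <= j%:R * h by rewrite mulr_ge0.
rewrite -natr1 [in sg _]mulrDl mul1r [_ + h]addrC semigroup_add// iterS.
set g := sg (j%:R * h) f; set G := iter j (euler h) f.
have bg : bounded_measurable g by exact: bounded_semigroup.
have gM z : `|g z| <= M by exact: semigroup_norm.
have hG : sector_bounded G.
  exact/(sector_bounded_euler_iter E_borel alpha mc c0 cb)/sector_bounded_bounded.
rewrite (le_trans (ler_distD (euler h g eta) _ _))// [leRHS]mulrDl mul1r [leRHS]addrC.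
(* The local estimate is applied to [g], the semigroup at the earlier time, which satisfies the same
   bound [M]. *)
apply: lerD; first exact: local bg.1 gM h0 etan.
rewrite -(euler_stepB alpha mc c0 cb)//; last exact: sector_bounded_bounded.
apply: (euler_step_norm E_borel mc c0 cb h0 _ etan).
- by rewrite (le_trans _ h1)// ler_wpM2l// hr.
- by apply: sector_boundedB => //; exact: sector_bounded_bounded.
- by move=> zeta zn; exact: IH.
Qed.

Lemma euler_iter_sector n f g j h eta : sector n eta ->
  (forall zeta, sector n zeta -> f zeta = g zeta) ->
  iter j (euler h) f eta = iter j (euler h) g eta.
Proof.
move=> + fg; elim: j eta => [|j IH] eta etan /=; first exact: fg.
rewrite /euler_step IH// (jump_mean_sector E_borel alpha c etan
  (g := iter j (euler h) g))//.
Qed.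

Lemma semigroup_approx n f t : 0 <= t -> sector_bounded f -> exists (C k0 : R), 0 <= C /\
  forall k : nat, k0 <= k.+1%:R -> forall eta, sector n eta ->
    `|sg t f eta - iter k.+1 (euler (t / k.+1%:R)) f eta| <= C / k.+1%:R.
Proof.
move=> t0 hf; have [r [r0 hr]] := jump_rate_bound E_borel alpha mc c0 cb.
have [mr [M rM]] := bounded_restrict_sector n hf.
have M0 : 0 <= M by exact: le_trans (rM point).
(* With step [t / k.+1] the accumulated error is [k.+1] times [4 * M * (r n * t / k.+1) ^+ 2]; the
   threshold [t * r n] is the step size condition. *)
exists (4 * M * (r n * t) ^+ 2), (t * r n); split.
  by rewrite !mulr_ge0// sqr_ge0.
move=> k hk eta etan; have k0 : 0 < k.+1%:R :> R by [].
rewrite (semigroup_restrict t0 etan hf).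
rewrite (euler_iter_sector _ _ etan (g := restrict_sector n f)); last first.
  by move=> z zn; rewrite restrict_sectorE.
have := @semigroup_euler_bound n (r n) _ M k.+1 (t / k.+1%:R) eta (hr n) mr rM.
rewrite divr_ge0// => /(_ isT); rewrite mulrAC ler_pdivrMr// mul1r hk => /(_ isT etan).
rewrite mulrCA mulfV ?gt_eqF// mulr1 => /le_trans; apply.
rewrite le_eqVlt; apply/orP; left; apply/eqP; field.
by rewrite gt_eqF// -natr1 addrC; rewrite natr1.
Qed.

Hypothesis csym : forall x y, c x y = c y x.

Lemma semigroup_sum_removal t f eta : 0 <= t -> sector_bounded f ->
  sg t (sum_removal f) eta = sum_removal (sg t f) eta.
Proof.
move=> t0 hf; have [n etan] := sector_ex eta.
have es := same_atoms E_borel eta.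
have hA := sector_bounded_removal E_borel hf.
have [C1 [k1 [C10 h1]]] := semigroup_approx n t0 hA.
have [C2 [k2 [C20 h2]]] := semigroup_approx n.-1 t0 hf.
(* Both sides are compared with the same Euler iterate. The removal operator adds up [n]
   approximation errors from the sector below, whence the factor of [C2]. *)
apply: (@eq_of_harmonic_bound _ _ _ (C1 + n%:R * C2) (Num.max k1 k2)) => k.
rewrite ge_max => /andP[hk1 hk2].
set G := iter k.+1 (euler (t / k.+1%:R)).
rewrite (le_trans (ler_distD (G (sum_removal f) eta) _ _))// [leRHS]mulrDl.
apply: lerD; first exact: h1.
rewrite /G -(sum_removal_euler_iter E_borel alpha mc c0 cb csym)// -/G.
rewrite (sum_removalE E_borel _ es); last first.
  exact: (sector_bounded_euler_iter E_borel alpha mc c0 cb _ _ hf).1.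
rewrite (sum_removalE E_borel _ es); last exact: (sector_bounded_semigroup t0 hf).1.
rewrite -sumrB (le_trans (ler_norm_sum _ _ _))// -mulrA -(size_atoms E_borel etan).
rewrite big_seq (le_trans (_ : _ <= \sum_(x <- atoms eta | x \in atoms eta) (C2 / k.+1%:R)))//.
  apply: ler_sum => x xs; rewrite distrC; apply: h2 => //.
  have := sector_dirac R (rem x (atoms eta)).
  by rewrite size_rem// (size_atoms E_borel etan).
by rewrite -big_seq big_const_seq count_predT iter_addr_0 mulr_natl.
Qed.

Lemma gSIP_consistent : consistent Pr X.
Proof.
by move=> t eta f t0 bf; apply: semigroup_sum_removal => //; exact: sector_bounded_bounded.
Qed.

End path_semigroup.

(** * Intertwining of factorial functionals *)

Section injective_index_sums.
Context (R : comNzRingType).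

Let cons_ffun (T : finType) n (p : T * {ffun 'I_n -> T}) : {ffun 'I_n.+1 -> T} :=
  [ffun j => oapp p.2 p.1 (unlift ord0 j)].

Let map_cons_ffun (T : finType) n (p : T * {ffun 'I_n -> T}) :
  [seq cons_ffun p j | j <- enum 'I_n.+1] = p.1 :: [seq p.2 j | j <- enum 'I_n].
Proof.
rewrite enum_ordSl /= ffunE unlift_none -map_comp; congr (_ :: _).
by apply: eq_map => j; rewrite /= ffunE liftK.
Qed.

(** The restriction to values in [A] makes the induction possible: the index type stays fixed while
    [A] loses the element chosen first. *)
Lemma injective_ffun_sum (T : finType) n (Phi : seq T -> R) (A : seq T) : uniq A ->
  \sum_(i : {ffun 'I_n -> T} | uniq [seq i j | j <- enum 'I_n] &&
      all (mem A) [seq i j | j <- enum 'I_n]) Phi [seq i j | j <- enum 'I_n] =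
  factorial_sum n Phi A.
Proof.
elim: n Phi A => [|n IH] Phi A uA.
  have enum0 : enum 'I_0 = [::] by apply: size0nil; rewrite size_enum_ord.
  rewrite (big_pred1 (ffun0 (card_ord 0))) => [|i]; first by rewrite enum0.
  by rewrite enum0 /=; apply/esym/eqP/ffunP => -[].
rewrite (reindex (@cons_ffun T n))/=; last first.
  exists (fun g => (g ord0, [ffun k => g (lift ord0 k)])) => [[x g] _|g _].
    rewrite ffunE unlift_none/=; congr (_, _).
    by apply/ffunP => k; rewrite !ffunE liftK.
  apply/ffunP => j; rewrite ffunE.
  by case: unliftP => [k ->|->] /=; rewrite ?ffunE.
rewrite big_uniq//=.
under [RHS]eq_bigr => x xA.
  rewrite -IH ?rem_uniq//; over.
rewrite pair_big_dep/=; apply: eq_big => [[x g]|[x g] _]; rewrite map_cons_ffun//=.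
rewrite -andbA [RHS]andbCA; case: (boolP (x \in A)) => xA; rewrite ?andbF//=.
rewrite andbCA; congr (_ && _).
elim: [seq g j | j <- enum 'I_n] => [//|y l IHl] /=.
rewrite inE negb_or -IHl mem_rem_uniq// inE eq_sym.
by case: (y == x); case: (y \in A); case: (x \in l); rewrite ?andbF.
Qed.

Lemma factorial_sum_map (T U : eqType) n (h : T -> U) (F : seq U -> R) (s : seq T) :
  factorial_sum n F (map h s) = factorial_sum n (fun u => F (map h u)) s.
Proof.
elim: n F s => [//|n IH] F s /=; rewrite big_map; apply: eq_big_seq => x xs.
rewrite -(IH (fun v => F (h x :: v))); apply: perm_factorial_sum.
rewrite -(perm_cons (h x)) -map_cons perm_sym.
rewrite (perm_trans (_ : perm_eq _ (map h s)))//.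
  by rewrite perm_map// perm_sym perm_to_rem.
by apply: perm_to_rem; rewrite map_f.
Qed.

End injective_index_sums.

(** * Factorial functionals of configurations and their intertwining *)

Section factorial_functionals.
Context (R : realType) d (E : measurableType d).
Hypothesis E_borel : borel_space R E.
Local Notation N := (config R E).
Implicit Types (eta zeta : N).

Definition seq_fun n (f : n.-tuple E -> R) (u : seq E) : R :=
  f [tuple nth point u i | i < n].

Lemma seq_fun_tuple n (f : n.-tuple E -> R) (x : n.-tuple E) : seq_fun f x = f x.
Proof.
by congr f; apply: eq_from_tnth => i; rewrite tnth_mktuple (tnth_nth point).
Qed.

(** Passing from atoms to their positions makes the list duplicate free, as [injective_ffun_sum]
    requires, even when atoms coincide. *)
Lemma factorial_sum_tuple n m (f : n.-tuple E -> R) (x : m.-tuple E) :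
  factorial_sum n (seq_fun f) x =
  \sum_(i : {ffun 'I_n -> 'I_m} | injectiveb i) f [tuple tnth x (i j) | j < n].
Proof.
rewrite -[in LHS](map_tnth_enum x) factorial_sum_map -injective_ffun_sum ?enum_uniq//.
apply: eq_big => [i|i _].
  rewrite [X in _ && X](_ : _ = true) ?andbT//.
  by apply/allP => j _ /=; rewrite mem_enum.
congr f; apply: eq_from_tnth => j; rewrite !tnth_mktuple.
by rewrite -map_comp (nth_map j) ?size_enum_ord// nth_ord_enum.
Qed.

Lemma JE n (f : n.-tuple E -> R) eta s : measurable_fun setT f ->
  same_measure eta (dirac_sum s) -> J f eta = factorial_sum n (seq_fun f) s.
Proof.
move=> mf es; have ea := same_atoms E_borel eta.
transitivity (factorial_sum n (seq_fun f) (atoms eta)); last first.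
  apply: perm_factorial_sum; apply: (same_dirac_sum_perm (R := R) E_borel).
  exact: (same_measure_trans (same_measure_sym ea) es).
transitivity (\sum_(x <- injective_tuples n (atoms eta)) f x).
  exact: (Rintegral_atoms (mu := dirac_sum (injective_tuples n (atoms eta)))).
rewrite /injective_tuples big_map big_filter big_enum_cond/=.
by rewrite -(factorial_sum_tuple f (in_tuple (atoms eta))).
Qed.

Lemma factorial_sum_norm n (F : seq E -> R) M s : (forall u, `|F u| <= M) ->
  `|factorial_sum n F s| <= (size s)%:R ^+ n * M.
Proof.
elim: n F s => [|n IH] F s FM; first by rewrite expr0 mul1r FM.
have M0 : 0 <= M by exact: le_trans (FM [::]).
rewrite (le_trans (ler_norm_sum _ _ _))// exprS -mulrA.
rewrite big_seq (le_trans (_ : _ <= \sum_(x <- s | x \in s) ((size s)%:R ^+ n * M)))//.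
  apply: ler_sum => x xs; rewrite (le_trans (IH _ _ _))//.
  rewrite ler_wpM2r// lerXn2r ?nnegrE ?ler0n// ler_nat size_rem//; exact: leq_pred.
by rewrite -big_seq big_const_seq count_predT iter_addr_0 mulr_natl.
Qed.

Lemma sector_bounded_J n (f : n.-tuple E -> R) : bounded_measurable f ->
  sector_bounded (J f : N -> R).
Proof.
move=> [mf [M fM]]; split.
  apply: (measurable_config_tuple E_borel).
    move=> eta zeta ez; have zs := same_atoms E_borel zeta.
    by rewrite (JE mf zs) (JE mf (same_measure_trans ez zs)).
  move=> m; rewrite (_ : (fun _ => _) = fun x : m.-tuple E =>
      \sum_(i : {ffun 'I_n -> 'I_m}) (if injectiveb i then
          f [tuple tnth x (i j) | j < n] else 0)).
    apply: measurable_sum => i; case: (injectiveb i) => //.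
    have mi : measurable_fun [set: m.-tuple E]
        (fun x : m.-tuple E => [tuple tnth x (i j) | j < n]).
      apply/measurable_fun_tnthP => j.
      rewrite (_ : _ \o _ = fun x : m.-tuple E => tnth x (i j)).
        exact: measurable_tnth.
      by apply/funext => x; rewrite /= tnth_mktuple.
    exact: (measurableT_comp mf mi).
  apply/funext => x; rewrite -big_mkcond/= -(factorial_sum_tuple f x).
  exact: JE.
move=> m; exists (m%:R ^+ n * M) => eta etam.
rewrite (JE mf (same_atoms E_borel eta)) -(size_atoms E_borel etam).
by apply: factorial_sum_norm => u; exact: fM.
Qed.

(** The witness evaluates [f] on the measurable enumeration of the atoms; by symmetry the order of
    the enumeration is irrelevant. *)
Lemma lift_fun_ex n (f : n.-tuple E -> R) : symmetric_fun f ->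
  exists F : N -> R, bounded_measurable F /\
    forall x : n.-tuple E, F (dirac_config R x) = f x.
Proof.
move=> [[mf [M fM]] fs]; have [s hs] := measurable_sort E_borel.
exists (fun eta => f (s n eta)); split.
  by split; [exact: (measurableT_comp mf (hs n).1)|exists M].
move=> x; have xn : sector n (dirac_config R x).
  by have := sector_dirac R x; rewrite size_tuple.
have /tuple_permP[p sp] : perm_eq (s n (dirac_config R x)) x.
  apply: (same_dirac_sum_perm (R := R) E_borel); apply: same_measure_sym.
  exact: (hs n).2 xn.
by rewrite -(fs p x); congr f; apply: val_inj.
Qed.

Lemma lift_funP n (f : n.-tuple E -> R) : symmetric_fun f ->
  bounded_measurable (lift_fun f) /\
  forall x : n.-tuple E, lift_fun f (dirac_config R x) = f x.
Proof.
move=> fs; exact: (@xgetPex _ (fun=> 0) [set F : N -> R | bounded_measurable F /\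
  forall x : n.-tuple E, F (dirac_config R x) = f x] (lift_fun_ex fs)).
Qed.

Section intertwining.
Variables (alpha : {finite_measure set E -> \bar R}) (c : E -> E -> R).
Hypothesis mc : measurable_fun [set: E * E] (fun xy : E * E => c xy.1 xy.2).
Hypothesis c0 : forall x y, 0 <= c x y.
Hypothesis cb : exists M : R, forall x y, c x y <= M.
Hypothesis csym : forall x y, c x y = c y x.
Context dO (Omega : measurableType dO) (Pr : R.-pker N ~> Omega).
Variables (X : R -> Omega -> N).
Hypothesis X_gSIP : gSIP alpha c Pr X.
Local Notation sg := (semigroup Pr X).

(** An extension of the particle semigroup to functions that are not symmetric: [P_t J_n(f)] is
    restricted to [n] particles, and [n!] compensates for the orderings. Such functions are
    unavoidable, since terms of lower degree repeat arguments. *)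
Definition J_restriction t n (f : n.-tuple E -> R) (x : n.-tuple E) : R :=
  n`!%:R^-1 * sg t (J f) (dirac_config R x).

Lemma bounded_J_restriction t n (f : n.-tuple E -> R) : 0 <= t ->
  bounded_measurable f -> bounded_measurable (J_restriction t f).
Proof.
move=> t0 bf.
have [ms sb] := sector_bounded_semigroup E_borel mc c0 cb X_gSIP t0 (sector_bounded_J bf).
apply: bounded_measurableM; first exact: bounded_measurable_cst.
split; first exact: (measurableT_comp ms (@measurable_dirac_config R d E n)).
have [M hM] := sb n; exists M => x; apply: hM.
by have := sector_dirac R x; rewrite size_tuple.
Qed.

Lemma semigroup_J t n (f : n.-tuple E -> R) eta : 0 <= t -> bounded_measurable f ->
  sg t (J f) eta = J (J_restriction t f) eta.
Proof.
move=> t0 bf; have hJ := sector_bounded_J bf.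
have hg := sector_bounded_semigroup E_borel mc c0 cb X_gSIP t0 hJ.
have [mg _] := hg.
rewrite (JE (bounded_J_restriction t0 bf).1 (same_atoms E_borel eta)).
rewrite (same_config mg (same_atoms E_borel eta)).
have dd (u : seq E) : same_measure (dirac_config R u) (dirac_sum u) by [].
pose g u := sg t (J f) (dirac_config R u).
pose h u := factorial_sum n (seq_fun (J_restriction t f)) u.
rewrite -/(g _) -/(h _).
apply: (@eq_factorial_sum_removal _ R n) => [s|s|s sn].
- rewrite -(sum_removalE E_borel mg (dd s)).
  rewrite -(semigroup_sum_removal E_borel mc c0 cb X_gSIP csym)//.
  rewrite -(semigroupZ E_borel mc c0 cb X_gSIP)//.
  apply: (semigroup_eq_sector E_borel mc c0 cb X_gSIP t0 (sector_dirac R s)).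
  + exact: (sector_bounded_removal E_borel hJ).1.
  + exact: (sector_boundedZ _ hJ).1.
  + move=> z zs; have ez := same_atoms E_borel z.
    rewrite (sum_removalE E_borel hJ.1 ez) (JE bf.1 ez).
    rewrite -(size_atoms E_borel zs) -factorial_sum_removal.
    by apply: eq_bigr => x _; exact: (JE bf.1 (dd _)).
- exact: factorial_sum_removal.
(* On [n] points the factorial sum has [n!] equal terms, because [g] depends on the configuration
   only. *)
- rewrite /h (eq_factorial_sum (G := fun u => n`!%:R^-1 * g u)).
    rewrite factorial_sumZ (factorial_sum_size _ sn); last first.
      by move=> u v uv; exact: perm_config.
    by rewrite mulrA mulVf ?mul1r// pnatr_eq0 -lt0n fact_gt0.
  move=> u /eqP un; exact: (seq_fun_tuple (J_restriction t f) (Tuple un)).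
Qed.

(** On the sector of [n] particles [J f] is [n!] times the lift of [f], and the semigroup only sees
    that sector. For [n = 0] the functional is constant. *)
Lemma J_restriction_symmetric t n (f : n.-tuple E -> R) : 0 <= t -> symmetric_fun f ->
  J_restriction t f = particle_semigroup Pr X t f.
Proof.
move=> t0 fs; have [bf fp] := fs; apply/funext => x.
rewrite /particle_semigroup /J_restriction; case: ifPn => [/eqP n0|n0].
  subst n; rewrite fact0 invr1 mul1r.
  rewrite (_ : J f = fun=> f x); last first.
    apply/funext => z; rewrite (JE bf.1 (same_atoms E_borel z)) /=.
    by rewrite /seq_fun; congr f; rewrite [LHS]tuple0 [RHS]tuple0.
  exact: semigroup_cst.
have [blf lfE] := lift_funP fs.
rewrite -(semigroupZ E_borel mc c0 cb X_gSIP)//; last exact: sector_bounded_J.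
have xn : sector n (dirac_config R x).
  by have := sector_dirac R x; rewrite size_tuple.
apply: (semigroup_eq_sector E_borel mc c0 cb X_gSIP t0 xn).
- exact: (sector_boundedZ _ (sector_bounded_J bf)).1.
- exact: blf.1.
move=> z zn; have ez := same_atoms E_borel z.
have sz := size_atoms E_borel zn.
rewrite (JE bf.1 ez) (same_config blf.1 ez).
pose g u := lift_fun f (dirac_config R u).
rewrite (eq_factorial_sum (G := g)); last first.
  move=> u /eqP un; rewrite /g.
  by have := lfE (Tuple un); have := seq_fun_tuple f (Tuple un) => /= -> ->.
rewrite (factorial_sum_size _ sz); last first.
  by move=> u v uv; apply: perm_config => //; exact: blf.1.
by rewrite mulrA mulVf ?mul1r// pnatr_eq0 -lt0n fact_gt0.
Qed.

Lemma semigroup_J_symmetric t n (f : n.-tuple E -> R) eta : 0 <= t ->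
  symmetric_fun f -> sg t (J f) eta = J (particle_semigroup Pr X t f) eta.
Proof.
by move=> t0 fs; rewrite -J_restriction_symmetric//; apply: semigroup_J => //; case: fs.
Qed.

End intertwining.

End factorial_functionals.

(** * The Georgii-Nguyen-Zessin equation of the Pascal distribution *)

Section counting_cylinders.
Context (R : realType) d (E : measurableType d).
Hypothesis E_borel : borel_space R E.
Local Notation N := (config R E).
Implicit Types (eta zeta : N).

Definition count_in (B : set E) (eta : N) : nat := \sum_(x <- atoms eta) (x \in B).

Lemma count_inE B eta : measurable B -> eta B = (count_in B eta)%:R%:E.
Proof.
move=> mB; rewrite (same_atoms E_borel eta mB) /= dirac_sumE natr_sum.
by congr EFin.
Qed.

Lemma count_in_add_dirac B eta x : measurable B ->
  count_in B (add_dirac eta x) = (count_in B eta + (x \in B))%N.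
Proof.
move=> mB; apply/eqP; rewrite -(eqr_nat R) -eqe -count_inE// natrD EFinD -count_inE//.
by rewrite /= /add_dirac_measure measure_addE.
Qed.

Definition counts (T : finType) (B : T -> set E) eta : {ffun T -> nat} :=
  [ffun i => count_in (B i) eta].

Definition cell (T : finType) (B : T -> set E) (k : {ffun T -> nat}) : set N :=
  [set eta | counts B eta = k].

Record measurable_partition (T : finType) (B : T -> set E) : Prop := {
  partition_measurable : forall i, measurable (B i) ;
  partition_cover : forall x, exists i, B i x ;
  partition_disjoint : forall i j x, B i x -> B j x -> i = j }.

Lemma measurable_count_in B k : measurable B -> measurable [set eta | count_in B eta = k].
Proof.
move=> mB.
rewrite (_ : [set _ | _] = (fun eta : N => eta B) @^-1` [set k%:R%:E]); last first.
  apply/seteqP; split => eta /=; rewrite count_inE//; first by move=> ->.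
  by move=> -[] /eqP; rewrite eqr_nat => /eqP.
by rewrite -[X in measurable X]setTI; exact: measurable_config_eval.
Qed.

Lemma measurable_cell (T : finType) (B : T -> set E) k : (forall i, measurable (B i)) ->
  measurable (cell B k).
Proof.
move=> mB; rewrite (_ : cell B k = \bigcap_(i in [set: T]) [set eta | count_in (B i) eta = k i]).
  apply: fin_bigcap_measurable; first exact: finite_finset.
  by move=> i _; exact: measurable_count_in.
apply/seteqP; split => [eta <- i _|eta h]; first by rewrite /= ffunE.
by apply/ffunP => i; rewrite ffunE; exact: h.
Qed.

Definition cylinder (T : finType) (B : T -> set E) (K : set {ffun T -> nat}) : set N :=
  [set eta | K (counts B eta)].

(** Count vectors are countable: [n] runs through their codes, and the pieces split a cylinder into
    disjoint cells. *)
Let piece (T : finType) (B : T -> set E) (K : set {ffun T -> nat}) (n : nat) : set N :=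
  if pickle_inv n is Some k then (if `[<K k>] then cell B k else set0) else set0.

Let cylinder_bigcup (T : finType) (B : T -> set E) K :
  cylinder B K = \bigcup_n piece B K n.
Proof.
apply/seteqP; split => [eta Keta|eta [n _]].
  by exists (choice.pickle (counts B eta)) => //; rewrite /piece pickleK_inv asboolT.
rewrite /piece; case: (pickle_inv n) => // k; case: asboolP => // Kk.
by rewrite /cell /cylinder /= => ->.
Qed.

Let piece_disjoint (T : finType) (B : T -> set E) K : trivIset setT (piece B K).
Proof.
apply/trivIsetP => m n _ _ mn; apply/seteqP; split => // eta [].
rewrite /piece; have := @pickle_invK {ffun T -> nat} m; have := @pickle_invK {ffun T -> nat} n.
case: (pickle_inv n) => // k /= kn; case: (pickle_inv m) => // l /= lm.
case: ifP => // _; case: ifP => // _; rewrite /cell /= => ek el; move/eqP: mn; apply.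
by rewrite -kn -lm -ek -el.
Qed.

Let measurable_piece (T : finType) (B : T -> set E) K n :
  (forall i, measurable (B i)) -> measurable (piece B K n).
Proof.
move=> mB; rewrite /piece; case: (pickle_inv n) => // k; case: ifP => // _.
exact: measurable_cell.
Qed.

Lemma measurable_cylinder (T : finType) (B : T -> set E) K :
  (forall i, measurable (B i)) -> measurable (cylinder B K).
Proof.
move=> mB; rewrite cylinder_bigcup; apply: bigcupT_measurable => n.
exact: measurable_piece.
Qed.

Lemma eq_functional_cylinder (S1 S2 : (N -> \bar R) -> \bar R) (T : finType)
    (B : T -> set E) K : sigma_functional S1 -> sigma_functional S2 ->
  (forall i, measurable (B i)) ->
  (forall k, S1 (fun eta => (\1_(cell B k) eta)%:E) = S2 (fun eta => (\1_(cell B k) eta)%:E)) ->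
  S1 (fun eta => (\1_(cylinder B K) eta)%:E) = S2 (fun eta => (\1_(cylinder B K) eta)%:E).
Proof.
move=> h1 h2 mB h12.
have -> : (fun eta => (\1_(cylinder B K) eta)%:E) =
    (fun eta => \sum_(n <oo) (\1_(piece B K n) eta)%:E)%E :> (N -> \bar R).
  by apply/funext => eta; rewrite cylinder_bigcup indic_bigcup//; exact: piece_disjoint.
have ok n : nonneg_measurable (fun eta => (\1_(piece B K n) eta : R)%:E).
  by apply: nonneg_measurable_indic; exact: measurable_piece.
rewrite (sigma_functional_series h1)// (sigma_functional_series h2)//.
apply: eq_eseriesr => n _; rewrite /piece.
have E0 : (fun eta : N => (\1_set0 eta : R)%:E) = (fun=> 0%E).
  by apply/funext => eta; rewrite indic0.
case: (pickle_inv n) => [k|]; last first.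
  by rewrite E0 (sigma_functional0 h1) (sigma_functional0 h2).
case: ifP => _; first exact: h12.
by rewrite E0 (sigma_functional0 h1) (sigma_functional0 h2).
Qed.

(** Events determined by the counts over one finite partition. Disjoint blocks have independent
    counts under the Pascal law, and two partitions have a common refinement, so these events form a
    pi-system. *)
Definition cylinders : set (set N) :=
  [set D | exists (T : finType) (B : T -> set E) (K : set {ffun T -> nat}),
     measurable_partition B /\ D = cylinder B K].

Let count_in_sum (T : finType) (B : T -> set E) A eta :
  (forall x, A x -> exists i, B i x) ->
  (forall i x, B i x -> A x) -> (forall i j x, B i x -> B j x -> i = j) ->
  count_in A eta = (\sum_i count_in (B i) eta)%N.
Proof.
move=> AB BA Bd; rewrite /count_in exchange_big/=; apply: eq_bigr => x _.
have [xA|xA] := pselect (A x).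
  have [i Bi] := AB _ xA; rewrite mem_set// (bigD1 i)//= mem_set// big1// => j ji.
  by rewrite memNset// => Bj; move/eqP: ji; apply; exact: Bd Bj Bi.
rewrite memNset// big1// => i _; rewrite memNset// => Bi; apply: xA; exact: BA Bi.
Qed.

Let meet (T T' : finType) (B : T -> set E) (B' : T' -> set E) (z : T * T') : set E :=
  B z.1 `&` B' z.2.

Let meet_partition (T T' : finType) (B : T -> set E) (B' : T' -> set E) :
  measurable_partition B -> measurable_partition B' -> measurable_partition (meet B B').
Proof.
move=> [mB cB dB] [mB' cB' dB']; split.
- by move=> z; exact: measurableI.
- by move=> x; have [i Bi] := cB x; have [j Bj] := cB' x; exists (i, j).
- by move=> [i j] [i' j'] x [/= a b] [/= a' b']; congr (_, _); [exact: dB a a'|exact: dB' b b'].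
Qed.

Lemma cylinder_refine (T T' : finType) (B : T -> set E) (B' : T' -> set E) K :
  measurable_partition B -> measurable_partition B' ->
  exists K', cylinder B K = cylinder (meet B B') K'.
Proof.
move=> [mB cB dB] [mB' cB' dB'].
exists [set k : {ffun T * T' -> nat} | K [ffun i => \sum_j k (i, j)]%N].
rewrite /cylinder; apply/funext => eta /=; congr K.
apply/ffunP => i; rewrite !ffunE (@count_in_sum T' (fun j => meet B B' (i, j))).
- by apply: eq_bigr => j _; rewrite ffunE.
- by move=> x Bx; have [j Bj] := cB' x; exists j.
- by move=> j x [].
- by move=> j j' x [_ a] [_ b]; exact: dB' a b.
Qed.

Let meetC_partition (T T' : finType) (B : T -> set E) (B' : T' -> set E) K :
  measurable_partition B -> measurable_partition B' ->
  exists K', cylinder B' K = cylinder (meet B B') K'.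
Proof.
move=> [mB cB dB] [mB' cB' dB'].
exists [set k : {ffun T * T' -> nat} | K [ffun j => \sum_i k (i, j)]%N].
rewrite /cylinder; apply/funext => eta /=; congr K.
apply/ffunP => j; rewrite !ffunE (@count_in_sum T (fun i => meet B B' (i, j))).
- by apply: eq_bigr => i _; rewrite ffunE.
- by move=> x Bx; have [i Bi] := cB x; exists i.
- by move=> i x [].
- by move=> i i' x [a _] [b _]; exact: dB a b.
Qed.

Lemma cylinders_setI : setI_closed cylinders.
Proof.
move=> _ _ [T [B [K [hB ->]]]] [T' [B' [K' [hB' ->]]]].
have [L ->] := cylinder_refine K hB hB'; have [L' ->] := meetC_partition K' hB hB'.
exists (T * T')%type, (meet B B'), (L `&` L'); split => //; exact: meet_partition.
Qed.

Let halves A (b : bool) : set E := if b then A else ~` A.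

Let halves_partition A : measurable A -> measurable_partition (halves A).
Proof.
move=> mA; split.
- by case => //=; exact: measurableC.
- by move=> x; have [Ax|Ax] := pselect (A x); [exists true|exists false].
- by case=> -[] x.
Qed.

Lemma sigma_cylinders : @measurable _ N = <<s cylinders >>.
Proof.
apply/seteqP; split; last first.
  apply: smallest_sub; first exact: sigma_algebra_measurable.
  move=> _ [T [B [K [[mB _ _] ->]]]]; exact: measurable_cylinder.
apply: smallest_sub; first exact: smallest_sigma_algebra.
move=> _ [A mA [C mC <-]]; apply: sub_sigma_algebra.
exists bool, (halves A), [set k : {ffun bool -> nat} | C (k true)%:R%:E].
split; first exact: halves_partition.
apply/seteqP; split => eta /=; rewrite /cylinder/= ffunE /= -count_inE//.
by case.
Qed.

Lemma sector_cylinder n : cylinders (sector n).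
Proof.
exists unit, (fun=> setT), [set k : {ffun unit -> nat} | k tt = n]; split.
  by split; [by []|by move=> x; exists tt|by case=> -[]].
apply/seteqP; split => eta; rewrite /cylinder/= ffunE /sector/= count_inE//.
  by move=> -[] /eqP; rewrite eqr_nat => /eqP.
by move=> ->.
Qed.

(** Refining the partition of [D] by [A] makes [A] a union of blocks, so an integral over [A]
    reduces to integrals over blocks. *)
Lemma cylinder_resolve D A : cylinders D -> measurable A ->
  exists (T : finType) (B : T -> set E) (K : set {ffun T -> nat}) (I : pred T),
    [/\ measurable_partition B, D = cylinder B K &
        forall x, \1_A x = \sum_(i | I i) \1_(B i) x :> R].
Proof.
move=> [T [B [K [hB ->]]]] mA; have hh := halves_partition mA.
have [L ->] := cylinder_refine K hB hh.
exists (T * bool)%type, (meet B (halves A)), L, (fun z => z.2).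
have [mm cm dm] := meet_partition hB hh; split => // x.
have [[i b] [/= Bi hb]] := cm x.
case: b hb => hb.
  rewrite (bigD1 (i, true))//= big1 ?addr0.
    by rewrite !indicE !mem_set.
  move=> z /andP[_ /eqP zi]; rewrite indicE memNset// => zx; apply: zi.
  by apply: dm zx _; split.
rewrite indicE memNset// big1// => -[j []]//= _.
by rewrite indicE memNset// => -[_ /=].
Qed.

End counting_cylinders.

Section pascal_gnz.
Context (R : realType) d (E : measurableType d).
Hypothesis E_borel : borel_space R E.
Variable alpha : {finite_measure set E -> \bar R}.
Local Notation N := (config R E).
Variables (p : R) (rho : probability N R).
Hypotheses (p01 : 0 < p < 1) (rho_pascal : pascal alpha p rho).
Implicit Types (eta zeta : N).

Definition pascal_weight (a : R) (k : nat) : R :=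
  (1 - p) `^ a * (\prod_(j < k) (a + j%:R)) * (p ^+ k / k`!%:R).

(** The one-dimensional form of the equation: the factor [a + k%:R] will be the mass that alpha plus
    the configuration gives to a block. *)
Lemma pascal_weightS a k :
  k.+1%:R * pascal_weight a k.+1 = p * (a + k%:R) * pascal_weight a k.
Proof.
have k1 : k.+1%:R != 0 :> R by rewrite pnatr_eq0.
have kf : k`!%:R != 0 :> R by rewrite pnatr_eq0 -lt0n fact_gt0.
rewrite /pascal_weight big_ord_recr/= factS natrM exprS invfM.
set P := \prod_(i < k) _; set w := _ `^ _.
transitivity (k.+1%:R / k.+1%:R * (w * P * p ^+ k / k`!%:R * p * (a + k%:R))).
  by rewrite -!mulrA; ring.
by rewrite mulfV// mul1r; ring.
Qed.

Lemma pascal_cell (T : finType) (B : T -> set E) k : measurable_partition B ->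
  rho (cell B k) = (\prod_i pascal_weight (fine (alpha (B i))) (k i))%:E.
Proof.
move=> [mB cB dB]; have [indep law] := rho_pascal.
have tB : trivIset [set: 'I_#|T|] (fun i => B (enum_val i)).
  by move=> i j _ _ [x [Bi Bj]]; exact/enum_val_inj/(dB _ _ _ Bi Bj).
have := indep #|T| (fun i => B (enum_val i)) (fun i => [set (k (enum_val i))%:R%:E])
  (fun i => mB _) tB (fun i => emeasurable_set1 _).
rewrite (_ : \bigcap_i _ = cell B k); last first.
  apply/seteqP; split => [eta h|eta <- i _] /=; last by rewrite ffunE count_inE.
  apply/ffunP => i; rewrite ffunE; apply/eqP; rewrite -(eqr_nat R) -eqe -count_inE//.
  by have /= := h (enum_rank i) I; rewrite enum_rankK => ->.
move=> ->; rewrite -prodEFin (big_enum_val (A := T)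
  (fun i => (pascal_weight (fine (alpha (B i))) (k i))%:E))/=.
by apply: eq_bigr => i _; rewrite -law//; congr (rho _).
Qed.

Section functionals.
Local Open Scope ereal_scope.

Definition gnz_left (H : N * E -> \bar R) : \bar R :=
  \int[rho]_eta \int[eta]_x H (eta, x).

Definition gnz_right (H : N * E -> \bar R) : \bar R :=
  p%:E * \int[rho]_eta \int[measure_add alpha eta]_x H (add_dirac eta x, x).

Lemma sigma_functional_gnz_left : sigma_functional gnz_left.
Proof.
have K := @sigma_functional_kernel R _ _ N (N * E)%type
  (fun H eta => \int[eta]_x H (eta, x)) (fun F => \int[rho]_eta F eta).
apply: K; last exact: sigma_functional_integral.
- move=> H [H0 mH].
  exact: (@measurable_integral_config R d E _ N id (@measurable_id _ _ _) H).
- move=> eta; exact: (sigma_functional_comp (measurable_pair1 eta)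
    (sigma_functional_integral eta)).
Qed.

Let measurable_add_pair : measurable_fun [set: N * E]
  (fun z : N * E => (add_dirac z.1 z.2, z.2)).
Proof. by apply: measurable_fun_pair => //; exact: measurable_add_dirac. Qed.

Lemma sigma_functional_gnz_right : sigma_functional gnz_right.
Proof.
apply: sigma_functional_scale; first by case/andP: p01 => /ltW.
have K := @sigma_functional_kernel R _ _ N (N * E)%type
  (fun H eta => \int[measure_add alpha eta]_x H (add_dirac eta x, x))
  (fun F => \int[rho]_eta F eta).
apply: K; last exact: sigma_functional_integral.
- move=> H hH.
  exact: (@measurable_integral_add R d E alpha _ N id
    (fun z => H (add_dirac z.1 z.2, z.2)) (@measurable_id _ _ _)
    (nonneg_measurable_comp measurable_add_pair hH)).
- move=> eta.
  have mp : measurable_fun [set: E] (fun x => (add_dirac eta x, x)).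
    by apply: measurable_fun_pair => //; exact: measurable_add_dirac.
  exact: (sigma_functional_comp mp (sigma_functional_integral (measure_add alpha eta))).
Qed.

Let inner_indic (mu : {measure set E -> \bar R}) (A : set E) (r : R) :
  measurable A -> (0 <= r)%R ->
  \int[mu]_x ((\1_A x)%:E * r%:E) = r%:E * mu A.
Proof.
move=> mA r0; under eq_integral do rewrite muleC.
rewrite ge0_integralZl_EFin//; last exact/measurable_EFinP/measurable_indic.
by rewrite integral_indic// setIT.
Qed.

(** Both sides factor over the blocks by independence; only block [j] differs, and there the
    identity is [pascal_weightS]. *)
Lemma gnz_cell (T : finType) (B : T -> set E) j k : measurable_partition B ->
  gnz_left (fun z => (\1_(B j) z.2)%:E * (\1_(cell B k) z.1)%:E) =
  gnz_right (fun z => (\1_(B j) z.2)%:E * (\1_(cell B k) z.1)%:E).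
Proof.
move=> hB; have [mB cB dB] := hB.
have mc (k' : {ffun T -> nat}) : measurable (cell B k' : set N).
  exact: measurable_cell.
have -> : gnz_left (fun z => (\1_(B j) z.2)%:E * (\1_(cell B k) z.1)%:E) =
    (k j)%:R%:E * rho (cell B k).
  rewrite -[X in rho X]setIT -integral_indic//.
  rewrite -ge0_integralZl_EFin//; last exact/measurable_EFinP/measurable_indic.
  apply: eq_integral => eta _ /=; rewrite inner_indic// muleC.
  have [<-|nk] := pselect (counts B eta = k); first by rewrite ffunE; congr (_ * _); exact: count_inE.
  by rewrite indicE memNset// !mule0.
(* A configuration with a point added in [B j] has a positive count there, so for [k j = 0] both
   sides vanish. *)
rewrite /gnz_right /=; case kj : (k j) => [|m].
  rewrite mul0e integral0_eq ?mule0// => eta _.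
  rewrite integral0_eq// => x _; rewrite !indicE.
  have [xB|xB] := boolP (x \in B j); last by rewrite mul0e.
  rewrite [X in _ * X](_ : _ = 0) ?mule0//; rewrite memNset//= => h.
  by move: kj; rewrite -h ffunE count_in_add_dirac// xB addn1.
(* The only count vector from which a point added in [B j] leads to [k]. *)
pose k' : {ffun T -> nat} := [ffun i => if i == j then m else k i].
have a0 : (0 <= fine (alpha (B j)))%R by exact: fine_ge0.
have inner eta : \int[measure_add alpha eta]_x
    ((\1_(B j) x)%:E * (\1_(cell B k) (add_dirac eta x))%:E) =
    (fine (alpha (B j)) + m%:R)%:E * (\1_(cell B k') eta)%:E.
  transitivity (\int[measure_add alpha eta]_x
      ((\1_(B j) x)%:E * (\1_(cell B k') eta)%:E)).
    apply: eq_integral => x _; rewrite [\1_(B j) x]indicE.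
    have [xB|xB] := boolP (x \in B j); last by rewrite !mul0e.
    congr (_ * _%:E); rewrite !indicE; congr (nat_of_bool _)%:R.
    have cE i : counts B (add_dirac eta x) i = (counts B eta i + (i == j))%N.
      rewrite !ffunE count_in_add_dirac//; congr (_ + nat_of_bool _)%N.
      apply/idP/eqP => [/set_mem xi|->//].
      by apply: dB xi _; exact: set_mem.
    apply/idP/idP => /set_mem h; apply/mem_set; apply/ffunP => i.
      have := cE i; rewrite h [k' i]ffunE; case: eqP => [->|_]; last by rewrite addn0.
      by rewrite kj addn1 => -[].
    rewrite cE h ffunE; case: eqP => [->|_]; last by rewrite addn0.
    by rewrite kj addn1.
  rewrite inner_indic// [X in _ * X](_ : _ = alpha (B j) + eta (B j)); last first.
    exact: measure_addE.
  rewrite muleC.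
  have [h|nk] := pselect (counts B eta = k'); last first.
    by rewrite indicE memNset// !mule0.
  have -> : eta (B j) = m%:R%:E.
    by rewrite count_inE//; move/ffunP : h => /(_ j); rewrite !ffunE eqxx => ->.
  by rewrite EFinD fineK// fin_num_measure.
under eq_integral do rewrite inner.
rewrite ge0_integralZl_EFin ?addr_ge0//; last exact/measurable_EFinP/measurable_indic.
rewrite integral_indic// setIT (pascal_cell k hB).
rewrite [X in _ = _ * (_ * X)](pascal_cell k' hB) -!EFinM; congr EFin.
rewrite (bigD1 j)//= [in RHS](bigD1 j)//= kj [LHS]mulrA (pascal_weightS _ m).
rewrite [k' j]ffunE eqxx -!mulrA; congr (_ * (_ * (_ * _)))%R.
by do 3 congr (_ * _)%R; apply: eq_bigr => i /negbTE ij; rewrite ffunE ij.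
Qed.

(** With the set of marks frozen, [S] becomes a functional on configurations alone, to which
    uniqueness with the pi-system of cylinders applies. *)
Let marked (S : (N * E -> \bar R) -> \bar R) (A : set E) (F : N -> \bar R) :=
  S (fun z : N * E => (\1_A z.2)%:E * F z.1).

Let sigma_marked S A : measurable A -> sigma_functional S -> sigma_functional (@marked S A).
Proof.
move=> mA hS; have K := @sigma_functional_comp R _ _ (N * E)%type N fst
  (fun G : N * E -> \bar R => S (fun z => (\1_A z.2)%:E * G z)) measurable_fst.
apply: K; apply: sigma_functional_mul => //.
apply: (nonneg_measurable_comp (phi := snd) (f := fun x => (\1_A x)%:E)).
  exact: measurable_snd.
exact: nonneg_measurable_indic.
Qed.

Lemma gnz_cylinder D A : cylinders D -> measurable A ->
  marked gnz_left A (fun eta => (\1_D eta)%:E) = marked gnz_right A (fun eta => (\1_D eta)%:E).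
Proof.
move=> hD mA; have [T [B [K [I [hB DE AE]]]]] := cylinder_resolve hD mA.
have [mB _ _] := hB.
have mD : measurable D by rewrite DE; exact: (measurable_cylinder E_borel).
have split (S : (N * E -> \bar R) -> \bar R) : sigma_functional S -> marked S A (fun eta => (\1_D eta)%:E) =
    \sum_(i <- [seq i <- index_enum T | I i]) marked S (B i) (fun eta => (\1_D eta)%:E).
  move=> hS; rewrite /marked -(sigma_functional_sum hS).
    congr S; apply/funext => z; rewrite AE big_filter -sumEFin.
    by rewrite ge0_sume_distrl// => i _; rewrite lee_fin.
  move=> i; apply: nonneg_measurableM.
    apply: (nonneg_measurable_comp (phi := snd) (f := fun x => (\1_(B i) x)%:E)).
      exact: measurable_snd.
    exact: nonneg_measurable_indic.
  apply: (nonneg_measurable_comp (phi := fst) (f := fun x => (\1_D x)%:E)).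
    exact: measurable_fst.
  exact: nonneg_measurable_indic.
rewrite (split _ sigma_functional_gnz_left) (split _ sigma_functional_gnz_right).
apply: eq_bigr => i _; rewrite DE; apply: (eq_functional_cylinder E_borel) => //.
- exact: sigma_marked sigma_functional_gnz_left.
- exact: sigma_marked sigma_functional_gnz_right.
- by move=> k; exact: gnz_cell.
Qed.

Let cover_sector : \bigcup_n sector n = [set: N].
Proof. by apply/seteqP; split => // eta _; have [n etan] := sector_ex eta; exists n. Qed.

Let gnz_left_sector n A : measurable A ->
  marked gnz_left A (fun eta => (\1_(sector n) eta)%:E) < +oo.
Proof.
move=> mA; apply: (@le_lt_trans _ _ (\int[rho]_eta (cst n%:R%:E) eta)); last first.
  by rewrite integral_cst// [X in _ * X](probability_setT rho) mule1 ltry.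
have ms := @measurable_sector R d E n.
apply: ge0_le_integral => //.
- move=> eta _ /=; apply: integral_ge0 => x _; rewrite mule_ge0// lee_fin//.
- have [_ h] : nonneg_measurable (fun eta : N => (\1_(sector n) eta)%:E * eta A).
    apply: nonneg_measurableM; first exact: nonneg_measurable_indic.
    by split; [move=> eta; exact: measure_ge0|exact: measurable_config_eval].
  by apply: eq_measurable_fun h => eta _; rewrite /= inner_indic.
- move=> eta _ /=; rewrite inner_indic// indicE.
  have [etan|etan] := boolP (eta \in sector n); last by rewrite mul0e lee_fin.
  rewrite mul1e -(set_mem etan); apply: le_measure => //; exact/mem_set.
Qed.

(** Uniqueness is used twice: from cylinders to all measurable sets of configurations with the marks
    in a fixed [A], then from rectangles to the product space. The sectors are the cover of finite
    mass. *)
Lemma gnz H : nonneg_measurable H -> gnz_left H = gnz_right H.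
Proof.
have hl := sigma_functional_gnz_left; have hr := sigma_functional_gnz_right.
have rect D A : measurable D -> measurable A ->
    gnz_left (fun z => (\1_(D `*` A) z)%:E) = gnz_right (fun z => (\1_(D `*` A) z)%:E).
  move=> mD mA; have U := @sigma_functional_unique R _ N (@cylinders R d E) (@sector R d E) _ _
    (sigma_marked mA hl) (sigma_marked mA hr).
  have E1 (S : (N * E -> \bar R) -> \bar R) :
      S (fun z => (\1_(D `*` A) z)%:E) = marked S A (fun eta => (\1_D eta)%:E).
    congr S; apply/funext => z; rewrite -EFinM !indicE -natrM mulnb; congr (nat_of_bool _)%:R%:E.
    by rewrite andbC; apply/idP/andP => [/set_mem[h1 h2]|[/set_mem h1 /set_mem h2]];
      [split; exact/mem_set|apply/mem_set; split].
  rewrite !E1; apply: U => //.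
  - exact: (sigma_cylinders E_borel).
  - exact: cylinders_setI.
  - by move=> n; exact: (sector_cylinder E_borel).
  - by move=> G hG; exact: gnz_cylinder.
  - by move=> n; exact: gnz_left_sector.
  - exact: nonneg_measurable_indic.
have U := @sigma_functional_unique R _ (N * E)%type
  [set C | exists2 D, measurable D & exists2 A, measurable A & D `*` A = C]
  (fun n => @sector R d E n `*` setT) _ _ hl hr.
apply: U.
- by rewrite measurable_prod_measurableType.
- move=> _ _ [D mD [A mA <-]] [D' mD' [A' mA' <-]]; rewrite -setXI.
  by exists (D `&` D'); [exact: measurableI|exists (A `&` A') => //; exact: measurableI].
- by move=> n; exists (sector n); [exact: measurable_sector|exists setT].
- by rewrite -setX_bigcupl cover_sector setXTT.
- by move=> _ [D mD [A mA <-]]; exact: rect.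
- move=> n; have := gnz_left_sector n measurableT.
  suff -> : (fun z : N * E => (\1_(sector n `*` setT) z)%:E) =
    (fun z => (\1_setT z.2)%:E * (\1_(sector n) z.1)%:E) :> (_ -> \bar R) by [].
  apply/funext => z.
  rewrite -EFinM !indicE -natrM mulnb in_setT/=; congr (nat_of_bool _)%:R%:E.
  by apply/idP/idP => /set_mem h; apply/mem_set => //; case: h.
Qed.

End functionals.

(** * Detailed balance of the jump operator *)

Section detailed_balance.
Variable c : E -> E -> R.
Hypothesis mc : measurable_fun [set: E * E] (fun xy : E * E => c xy.1 xy.2).
Hypothesis c0 : forall x y, 0 <= c x y.
Hypothesis csym : forall x y, c x y = c y x.
Hypothesis cdiag : forall x, c x x = 0.
Local Open Scope ereal_scope.

Definition intensity (eta : N) : set E -> \bar R := measure_add alpha eta.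

HB.instance Definition _ eta := Measure.on (intensity eta).

Lemma intensity_fin_num eta : fin_num_fun (intensity eta).
Proof. by move=> B mB; rewrite /intensity measure_addE fin_numD !fin_num_measure. Qed.

HB.instance Definition _ eta :=
  @Measure_isFinite.Build _ E R (intensity eta) (@intensity_fin_num eta).

(** The equation takes the moving particle out: [eta] is what it leaves behind, [x] its site before
    the jump and [y] its site after. By symmetry of [c] this expression is symmetric in [F] and
    [G]. *)
Definition exchange (F G : N -> \bar R) eta : \bar R :=
  \int[intensity eta]_x \int[intensity eta]_y
    (F (add_dirac eta x) * (G (add_dirac eta y) * (c x y)%:E)).

Lemma jump_integral_gnz (F G : N -> \bar R) : nonneg_measurable F -> nonneg_measurable G ->
  \int[rho]_eta (F eta * jump_integral alpha c G eta) =
  p%:E * \int[rho]_eta exchange F G eta.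
Proof.
move=> hF hG.
pose inner (z : N * E) := \int[measure_add alpha z.1]_y
  (G (add_dirac (sub_dirac z.1 z.2) y) * (c z.2 y)%:E).
have hJ : nonneg_measurable (fun w : (N * E) * E =>
    G (add_dirac (sub_dirac w.1.1 w.1.2) w.2) * (c w.1.2 w.2)%:E).
  by apply: (nonneg_measurable_jump E_borel) => //; exact: measurableT_comp.
have hin : nonneg_measurable inner.
  split; first by move=> z; apply: integral_ge0 => y _; exact: (hJ.1 (z, y)).
  exact: (@measurable_integral_add R d E alpha _ (N * E)%type fst _ measurable_fst hJ).
have hFin : nonneg_measurable (fun z : N * E => F z.1 * inner z).
  by apply: nonneg_measurableM => //; exact: (nonneg_measurable_comp measurable_fst hF).
transitivity (gnz_left (fun z => F z.1 * inner z)).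
  apply: eq_integral => eta _ /=; rewrite ge0_integralZl//.
  - exact: (measurableT_comp hin.2 (measurable_pair1 eta)).
  - by move=> x _; exact: hin.1.
  - exact: hF.1.
rewrite (gnz hFin) /gnz_right.
set F1 := (fun eta => _ : \bar R); suff -> : F1 = exchange F G by [].
apply/funext => eta; rewrite /F1 /exchange /=.
apply: eq_integral => x _; rewrite /inner /=.
have mG' : nonneg_measurable (fun y => G (add_dirac eta y) * (c x y)%:E).
  apply: nonneg_measurableM.
    by apply: (nonneg_measurable_comp _ hG); exact: measurable_add_dirac.
  split; first by move=> y; rewrite lee_fin.
  exact/measurable_EFinP/(measurable_intensity mc).
have GE y : G (add_dirac (sub_dirac (add_dirac eta x) x) y) = G (add_dirac eta y).
  apply: (measurable_fun_samee hG.2); apply: same_add_dirac.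
  exact: same_sub_add_dirac.
under eq_integral do rewrite GE.
rewrite ge0_integral_measure_add//; [|by move=> y _; exact: mG'.1|exact: mG'.2].
(* The moving particle would also attract itself; the corresponding atom at [x] contributes nothing
   since [c x x = 0]. *)
rewrite (_ : \int[add_dirac eta x]_y _ = \int[eta]_y (G (add_dirac eta y) * (c x y)%:E)).
  rewrite -ge0_integral_measure_add//; [|by move=> y _; exact: mG'.1|exact: mG'.2].
  rewrite ge0_integralZl//; [exact: mG'.2|by move=> y _; exact: mG'.1|exact: hF.1].
transitivity (\int[measure_add eta \d_x]_y (G (add_dirac eta y) * (c x y)%:E)) => //.
rewrite ge0_integral_measure_add//; [|by move=> y _; exact: mG'.1|exact: mG'.2].
by rewrite integral_dirac//; [rewrite cdiag mule0 mule0 adde0|exact: mG'.2].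
Qed.

Lemma jump_integral_balance (F G : N -> \bar R) : nonneg_measurable F -> nonneg_measurable G ->
  \int[rho]_eta (F eta * jump_integral alpha c G eta) =
  \int[rho]_eta (G eta * jump_integral alpha c F eta).
Proof.
move=> hF hG.
rewrite (jump_integral_gnz hF hG).
rewrite (jump_integral_gnz hG hF).
suff -> : exchange F G = exchange G F by [].
apply/funext => eta; rewrite /exchange.
have mad : measurable_fun [set: E] (fun y => add_dirac eta y) by exact: measurable_add_dirac.
have m1 : nonneg_measurable (fun z : E * E => F (add_dirac eta z.1)).
  by apply: (nonneg_measurable_comp _ hF); exact: (measurableT_comp mad measurable_fst).
have m2 : nonneg_measurable (fun z : E * E => G (add_dirac eta z.2)).
  by apply: (nonneg_measurable_comp _ hG); exact: (measurableT_comp mad measurable_snd).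
have m3 : nonneg_measurable (fun z : E * E => (c z.1 z.2)%:E).
  by split; [move=> z; rewrite lee_fin|exact/measurable_EFinP].
have [f0 mf] := nonneg_measurableM m1 (nonneg_measurableM m2 m3).
rewrite (fubini_tonelli (m1 := intensity eta) (m2 := intensity eta) _ mf f0).
apply: eq_integral => x _; apply: eq_integral => y _ /=.
by rewrite muleCA csym.
Qed.

End detailed_balance.

End pascal_gnz.

(** * Reversibility *)

Section pascal_balance.
Context (R : realType) d (E : measurableType d).
Hypothesis E_borel : borel_space R E.
Variables (alpha : {finite_measure set E -> \bar R}) (c : E -> E -> R).
Hypothesis mc : measurable_fun [set: E * E] (fun xy : E * E => c xy.1 xy.2).
Hypothesis c0 : forall x y, 0 <= c x y.
Hypothesis cb : exists M : R, forall x y, c x y <= M.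
Hypothesis csym : forall x y, c x y = c y x.
Hypothesis cdiag : forall x, c x x = 0.
Local Notation N := (config R E).
Local Notation rate := (jump_rate alpha c).
Local Notation euler := (euler_step alpha c).
Context dO (Omega : measurableType dO) (Pr : R.-pker N ~> Omega).
Variables (X : R -> Omega -> N).
Hypothesis X_gSIP : gSIP alpha c Pr X.
Variables (p : R) (rho : probability N R).
Hypotheses (p01 : 0 < p < 1) (rho_pascal : pascal alpha p rho).
Implicit Types (eta zeta : N) (f g u v : N -> R).
Local Notation sg := (semigroup Pr X).

(** Test functions for the balance: on one sector a small Euler step keeps them nonnegative and
    bounded, so extended integrals can be split freely. *)
Record sector_fun n u : Prop := SectorFun {
  sector_fun_bounded : sector_bounded u ;
  sector_fun_ge0 : forall eta, 0 <= u eta ;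
  sector_fun_out : forall eta, ~ sector n eta -> u eta = 0 }.

Lemma bounded_sector_fun n u : sector_fun n u -> bounded_measurable u.
Proof.
move=> [hu _ out]; rewrite (_ : u = restrict_sector n u).
  exact: bounded_restrict_sector.
apply/funext => eta; rewrite /restrict_sector; case: eqP => // h.
by rewrite out.
Qed.

Lemma sector_fun_indic n (D : set N) : measurable D -> sector_fun n (\1_(D `&` sector n)).
Proof.
move=> mD; split.
- apply: sector_bounded_bounded; split.
    by apply: measurable_indic; apply: measurableI => //; exact: measurable_sector.
  by exists 1 => eta; rewrite ger0_norm ?indicE// lern1 leq_b1.
- by move=> eta; rewrite indicE.
- by move=> eta etan; rewrite indicE memNset// => -[].
Qed.

Lemma jump_mean_out n u eta : sector_fun n u -> ~ sector n eta -> jump_mean alpha c u eta = 0.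
Proof.
move=> hu etan; have [m etam] := sector_ex eta.
rewrite (jump_mean_sector E_borel alpha c etam (g := fun=> 0 * 0)); last first.
  move=> zeta zm; rewrite mul0r (sector_fun_out hu)// => zn.
  by apply: etan; move: etam zm zn; rewrite /sector/= => -> ->.
rewrite (jump_meanZ alpha mc c0 cb _ _ (sector_bounded_cst E 0)).
by rewrite mul0r.
Qed.

Lemma sector_fun_euler_step n h u : 0 <= h -> (forall eta, sector n eta -> h * rate eta <= 1) ->
  sector_fun n u -> sector_fun n (euler h u).
Proof.
move=> h0 h1 hu; have [bu u0 out] := hu; split.
- exact: sector_bounded_euler_step.
- move=> eta; have [etan|etan] := pselect (sector n eta).
    by apply: (euler_step_ge0 E_borel c0 h0 (h1 _ etan) etan).
  by rewrite /euler_step (jump_mean_out hu etan) out// mulr0 subr0 mulr0 addr0.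
- by move=> eta etan; rewrite /euler_step (jump_mean_out hu etan) out// mulr0 subr0 mulr0 addr0.
Qed.

Lemma euler_step_balance n h u v : 0 <= h ->
  (forall eta, sector n eta -> h * rate eta <= 1) -> sector_fun n u -> sector_fun n v ->
  (\int[rho]_eta (u eta * euler h v eta)%:E = \int[rho]_eta (v eta * euler h u eta)%:E)%E.
Proof.
move=> h0 h1.
have nn f : sector_fun n f -> nonneg_measurable (EFin \o f).
  by move=> hf; split; [move=> eta; rewrite lee_fin (sector_fun_ge0 hf)|
    apply/measurable_EFinP; exact: (sector_fun_bounded hf).1].
(* An Euler step is a multiplication operator plus [h] times the jump operator. For small [h] both
   parts are nonnegative, the first is symmetric by inspection, and the second by detailed
   balance. *)
have split_step f g : sector_fun n f -> sector_fun n g ->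
    (\int[rho]_eta (f eta * euler h g eta)%:E =
     \int[rho]_eta ((1 - h * rate eta) * (f eta * g eta))%:E +
     h%:E * \int[rho]_eta ((EFin \o f) eta * jump_integral alpha c (EFin \o g) eta))%E.
  move=> hf hg.
  have hj : nonneg_measurable (fun eta => (EFin \o f) eta * jump_integral alpha c (EFin \o g) eta)%E.
    apply: nonneg_measurableM; first exact: nn.
    split; last exact: (measurable_jump_integral E_borel alpha mc c0 (nn _ hg)).
    by move=> eta; apply: (sigma_functional_ge0
      (sigma_functional_jump_integral E_borel alpha mc c0 eta)); exact: nn.
  rewrite -ge0_integralZl_EFin//; [|by move=> eta _; exact: hj.1|exact: hj.2].
  rewrite -ge0_integralD//.
  - apply: eq_integral => eta _ /=.
    rewrite (jump_integral_EFin E_borel alpha mc c0 cb); last 2 first.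
    - exact: sector_fun_ge0 hg.
    - exact: sector_fun_bounded hg.
    by rewrite -!EFinM -EFinD /euler_step; congr EFin; ring.
  - move=> eta _; rewrite lee_fin; have [etan|etan] := pselect (sector n eta).
      by rewrite !mulr_ge0 ?subr_ge0 ?h1 ?(sector_fun_ge0 hf) ?(sector_fun_ge0 hg).
    by rewrite (sector_fun_out hf)// mul0r mulr0.
  - apply/measurable_EFinP; apply: measurable_funM.
      apply: measurable_funB => //; apply: measurable_funM => //.
      exact: (sector_bounded_jump_rate E_borel alpha mc c0 cb).1.
    by apply: measurable_funM; [exact: (sector_fun_bounded hf).1|
      exact: (sector_fun_bounded hg).1].
  - by move=> eta _; rewrite mule_ge0 ?lee_fin// hj.1.
  - by apply: measurable_funeM; exact: hj.2.
move=> hu hv; rewrite (split_step _ _ hu hv) (split_step _ _ hv hu).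
rewrite (jump_integral_balance E_borel p01 rho_pascal mc c0 csym cdiag (nn _ hu) (nn _ hv)).
by congr (_ + _)%E; apply: eq_integral => eta _; rewrite (mulrC (u eta)).
Qed.

Lemma euler_iter_balance n h k u v : 0 <= h ->
  (forall eta, sector n eta -> h * rate eta <= 1) -> sector_fun n u -> sector_fun n v ->
  (\int[rho]_eta (u eta * iter k (euler h) v eta)%:E =
   \int[rho]_eta (v eta * iter k (euler h) u eta)%:E)%E.
Proof.
move=> h0 h1; elim: k u v => [|k IH] u v hu hv.
  by apply: eq_integral => eta _; rewrite mulrC.
have it w j : sector_fun n w -> sector_fun n (iter j (euler h) w).
  by move=> hw; elim: j => //= j; exact: sector_fun_euler_step.
(* The outermost step passes from [v] to [u]; the induction hypothesis then transfers the others. *)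
rewrite /= (euler_step_balance h0 h1 hu (it v k hv)).
under eq_integral do rewrite mulrC.
rewrite (IH _ _ (sector_fun_euler_step h0 h1 hu) hv).
by rewrite -iterSr.
Qed.

Lemma semigroup_balance_sector n t u v : 0 <= t -> sector_fun n u -> sector_fun n v ->
  \int[rho]_eta (u eta * sg t v eta) = \int[rho]_eta (v eta * sg t u eta).
Proof.
move=> t0 hu hv.
have [r [r0 hr]] := jump_rate_bound E_borel alpha mc c0 cb.
have [C1 [k1 [C10 a1]]] := semigroup_approx E_borel mc c0 cb X_gSIP n t0 (sector_fun_bounded hv).
have [C2 [k2 [C20 a2]]] := semigroup_approx E_borel mc c0 cb X_gSIP n t0 (sector_fun_bounded hu).
have bu := bounded_sector_fun hu; have bv := bounded_sector_fun hv.
have [[mu [M1 uM]] [mv [M2 vM]]] := (bu, bv).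
have M10 : 0 <= M1 by exact: le_trans (uM point).
have M20 : 0 <= M2 by exact: le_trans (vM point).
(* Approximation error of one factor times the bound of the other, on each side. The third threshold
   [t * r n] is the step size condition that keeps Euler steps positive. *)
apply: (@eq_of_harmonic_bound _ _ _ (M1 * C1 + M2 * C2)
  (Num.max (Num.max k1 k2) (t * r n))) => k.
rewrite !ge_max => /andP[/andP[hk1 hk2] hk3].
set h := t / k.+1%:R.
have h0 : 0 <= h by rewrite divr_ge0.
have h1 eta : sector n eta -> h * rate eta <= 1.
  move=> etan; apply: (@le_trans _ _ (h * r n)); first by rewrite ler_wpM2l// hr.
  by rewrite /h mulrAC ler_pdivrMr// mul1r.
have it w j : sector_fun n w -> sector_fun n (iter j (euler h) w).
  by move=> hw; elim: j => //= j; exact: sector_fun_euler_step.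
have dist f g C M : sector_fun n f -> (forall eta, `|f eta| <= M) -> 0 <= M -> 0 <= C ->
    sector_fun n g ->
    (forall eta, sector n eta -> `|sg t g eta - iter k.+1 (euler h) g eta| <= C / k.+1%:R) ->
    `|\int[rho]_eta (f eta * sg t g eta) -
      \int[rho]_eta (f eta * iter k.+1 (euler h) g eta)| <= M * C / k.+1%:R.
  move=> hf fM M0 C0 hg a.
  have bsg : bounded_measurable (sg t g).
    exact: (bounded_semigroup X_gSIP t0 (bounded_sector_fun hg)).
  have bit := bounded_sector_fun (it g k.+1 hg); have bf := bounded_sector_fun hf.
  rewrite -RintegralB//; last 2 first.
  - exact/bounded_measurable_integrable/bounded_measurableM.
  - exact/bounded_measurable_integrable/bounded_measurableM.
  apply: (Rintegral_bounded_norm (probability_setT rho)).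
    by apply: measurable_funB; apply: measurable_funM; [exact: bf.1|exact: bsg.1|exact: bf.1|exact: bit.1].
  move=> eta; rewrite -mulrBr normrM -mulrA; have [etan|etan] := pselect (sector n eta).
    by apply: ler_pM => //; exact: a.
  by rewrite (sector_fun_out hf)// normr0 mul0r !mulr_ge0.
have := dist _ _ _ _ hu uM M10 C10 hv (a1 k hk1).
have := dist _ _ _ _ hv vM M20 C20 hu (a2 k hk2).
have -> : \int[rho]_eta (u eta * iter k.+1 (euler h) v eta) =
          \int[rho]_eta (v eta * iter k.+1 (euler h) u eta).
  by rewrite /Rintegral (euler_iter_balance k.+1 h0 h1 hu hv).
set a := \int[rho]_eta _ ; set b := \int[rho]_eta _; set z := \int[rho]_eta _.
move=> H1 H2; rewrite (le_trans (ler_distD b _ _))// [leRHS]mulrDl.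
by apply: lerD => //; rewrite distrC.
Qed.

Local Notation PP := (transition_integral Pr X).
Local Open Scope ereal_scope.

Let nnPP t F : (0 <= t)%R -> nonneg_measurable F -> nonneg_measurable (PP t F).
Proof.
move=> t0 hF; split; last exact: (measurable_transition_integral X_gSIP t0 hF).
by move=> eta; apply: integral_ge0 => w _; exact: hF.1.
Qed.

Lemma sigma_functional_pairing_left t G : (0 <= t)%R -> nonneg_measurable G ->
  sigma_functional (fun F => \int[rho]_eta (F eta * PP t G eta)).
Proof.
move=> t0 hG.
rewrite (_ : (fun _ => _) = (fun F => \int[rho]_eta (PP t G eta * F eta))); last first.
  by apply/funext => F; apply: eq_integral => eta _; rewrite muleC.
apply: (sigma_functional_mul (T := fun F => \int[rho]_eta F eta)); first exact: nnPP.
exact: sigma_functional_integral.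
Qed.

Lemma sigma_functional_pairing_right t F : (0 <= t)%R -> nonneg_measurable F ->
  sigma_functional (fun G => \int[rho]_eta (F eta * PP t G eta)).
Proof.
move=> t0 hF.
have K := @sigma_functional_kernel R _ _ N N (PP t) (fun H => \int[rho]_eta (F eta * H eta)).
apply: K.
- by move=> G hG; exact: (nnPP t0 hG).2.
- by move=> eta; exact: (sigma_functional_transition X_gSIP eta t0).
- by apply: (sigma_functional_mul (T := fun H => \int[rho]_eta H eta)) => //;
    exact: sigma_functional_integral.
Qed.

Lemma transition_out n t (D : set N) eta : (0 <= t)%R -> measurable D -> ~ sector n eta ->
  PP t (fun zeta => (\1_(D `&` sector n) zeta)%:E) eta = 0.
Proof.
move=> t0 mD etan; have hs := sector_fun_indic n mD.
have bs := bounded_sector_fun hs.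
have h := semigroup_EFin X_gSIP eta t0 bs; rewrite -[LHS]h; congr EFin.
have [m etam] := sector_ex eta.
rewrite -[RHS](semigroup_cst Pr X t 0 eta).
apply: (semigroup_eq_sector E_borel mc c0 cb X_gSIP t0 etam bs.1) => //.
move=> zeta zm; rewrite (sector_fun_out hs)// => zn.
by apply: etan; move: etam zm zn; rewrite /sector/= => -> ->.
Qed.

Lemma transition_sector n t (D : set N) eta : (0 <= t)%R -> measurable D -> sector n eta ->
  PP t (fun zeta => (\1_D zeta)%:E) eta = PP t (fun zeta => (\1_(D `&` sector n) zeta)%:E) eta.
Proof.
move=> t0 mD etan; have bs := bounded_sector_fun (sector_fun_indic n mD).
have bD : bounded_measurable (\1_D : N -> R).
  split; first exact: measurable_indic.
  by exists 1%R => zeta; rewrite ger0_norm ?indicE// lern1 leq_b1.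
rewrite -[LHS](semigroup_EFin X_gSIP eta t0 bD) -[RHS](semigroup_EFin X_gSIP eta t0 bs).
congr EFin; apply: (semigroup_eq_sector E_borel mc c0 cb X_gSIP t0 etan bD.1 bs.1).
by move=> zeta zn; rewrite indicI /= [X in (_ * X)%R]indicE mem_set// mulr1.
Qed.

Lemma indic_sector_series (D : set N) eta :
  (\1_D eta)%:E = \sum_(n <oo) (\1_(D `&` sector n) eta)%:E :> \bar R.
Proof.
have DE : D = \bigcup_n (D `&` sector n).
  apply/seteqP; split => [zeta Dz|zeta [n _ []]//].
  by have [n zn] := sector_ex zeta; exists n.
rewrite [in LHS]DE indic_bigcup//; apply/trivIsetP => i j _ _ ij.
rewrite -subset0 => zeta [[_ zi] [_ zj]]; move: ij; rewrite -(eqr_nat R) -eqe.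
by move: zi zj; rewrite /sector/= => -> ->; rewrite eqxx.
Qed.

(** For indicators, the first set is cut into sectors and the second is replaced on each by its part
    in the same sector, where the balance is known. Uniqueness of functionals then extends one
    argument after the other. *)
Lemma transition_balance t F G : (0 <= t)%R -> nonneg_measurable F -> nonneg_measurable G ->
  \int[rho]_eta (F eta * PP t G eta) = \int[rho]_eta (G eta * PP t F eta).
Proof.
move=> t0.
have nni (D : set N) : measurable D -> nonneg_measurable (fun eta => (\1_D eta)%:E : \bar R).
  exact: nonneg_measurable_indic.
have mDn (D : set N) n : measurable D -> measurable (D `&` sector n).
  by move=> mD; apply: measurableI => //; exact: measurable_sector.
have base (D1 D2 : set N) : measurable D1 -> measurable D2 ->
    \int[rho]_eta ((\1_D1 eta)%:E * PP t (fun zeta => (\1_D2 zeta)%:E) eta) =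
    \int[rho]_eta ((\1_D2 eta)%:E * PP t (fun zeta => (\1_D1 zeta)%:E) eta).
  move=> m1 m2.
  have hl := sigma_functional_pairing_left t0 (nni _ m2).
  have hr := sigma_functional_pairing_right t0 (nni _ m2).
  have E1 : (fun eta => (\1_D1 eta)%:E) =
      (fun eta => \sum_(n <oo) (\1_(D1 `&` sector n) eta)%:E) :> (N -> \bar R).
    by apply/funext => eta; exact: indic_sector_series.
  transitivity (\sum_(n <oo) \int[rho]_eta ((\1_(D1 `&` sector n) eta)%:E *
      PP t (fun zeta => (\1_D2 zeta)%:E) eta)).
    rewrite -(sigma_functional_series hl (fun n => nni _ (mDn D1 n m1))).
    by apply: eq_integral => eta _; rewrite (indic_sector_series D1).
  transitivity (\sum_(n <oo) \int[rho]_eta ((\1_D2 eta)%:E *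
      PP t (fun zeta => (\1_(D1 `&` sector n) zeta)%:E) eta)); last first.
    rewrite -(sigma_functional_series hr (fun n => nni _ (mDn D1 n m1))).
    by apply: eq_integral => eta _; congr (_ * PP t _ eta); rewrite -E1.
  apply: eq_eseriesr => n _.
  have hu := sector_fun_indic n m1; have hv := sector_fun_indic n m2.
  have bu := bounded_sector_fun hu; have bv := bounded_sector_fun hv.
  have fin f g : bounded_measurable f -> bounded_measurable g ->
      (\int[rho]_eta (f eta * sg t g eta))%:E =
      \int[rho]_eta ((f eta)%:E * PP t (EFin \o g) eta).
    move=> bf bg; rewrite /Rintegral fineK; last first.
      apply: integrable_fin_num => //; apply/bounded_measurable_integrable/bounded_measurableM => //.
      exact: (bounded_semigroup X_gSIP t0 bg).
    by apply: eq_integral => eta _; rewrite EFinM (semigroup_EFin X_gSIP eta t0 bg).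
  transitivity (\int[rho]_eta ((\1_(D1 `&` sector n) eta)%:E *
      PP t (EFin \o \1_(D2 `&` sector n)) eta)).
    (* Inside the sector, conservation of particles cuts [D2] down to it; outside, the first factor
       is 0. *)
    apply: eq_integral => eta _; have [etan|etan] := pselect (sector n eta).
      by rewrite (transition_sector t0 m2 etan).
    by rewrite (sector_fun_out hu)// !mul0e.
  rewrite -fin// (semigroup_balance_sector t0 hu hv) fin//.
  apply: eq_integral => eta _; have [etan|etan] := pselect (sector n eta).
    by rewrite indicI /= [X in (_ * X)%R]indicE mem_set// mulr1.
  by rewrite (transition_out t0 m1 etan) !mule0.
have indF (D : set N) G' : measurable D -> nonneg_measurable G' ->
    \int[rho]_eta ((\1_D eta)%:E * PP t G' eta) =
    \int[rho]_eta (G' eta * PP t (fun zeta => (\1_D zeta)%:E) eta).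
  move=> mD hG'.
  have U := eq_sigma_functional (sigma_functional_pairing_right t0 (nni _ mD))
    (sigma_functional_pairing_left t0 (nni _ mD)).
  by apply: U => // D' mD'; exact: base.
move=> hF hG.
have U := eq_sigma_functional (sigma_functional_pairing_left t0 hG)
  (sigma_functional_pairing_right t0 hG).
by apply: U => // D mD; exact: indF.
Qed.

End pascal_balance.

(** * The semigroup on square integrable functions *)

Section square_integrable.
Context (R : realType) d (T : measurableType d) (P : {measure set T -> \bar R}).
Hypothesis P1 : P setT = 1%E.
Implicit Types f g : T -> R.

Definition square_integrable f : Prop :=
  measurable_fun setT f /\ (\int[P]_x (f x ^+ 2)%:E < +oo)%E.

Lemma square_integrableP f : f \in Lfun P 2%:E <-> square_integrable f.
Proof.
split => [lf|[mf foo]].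
  by split; [move: lf => /andP[/set_mem]|have /integrableP[_] := Lfun2_integrable_sqr lf;
    under eq_integral do rewrite /= ger0_norm ?sqr_ge0//].
apply/andP; split; first exact/mem_set.
apply/mem_set; rewrite /= /finite_norm unlock /= poweR_lty//.
apply: le_lt_trans foo; apply: ge0_le_integral => //=.
- by apply/measurable_EFinP/(@measurableT_comp _ _ _ _ _ _ (fun x : R => x `^ 2))%R => //;
    exact: measurableT_comp.
- by apply/measurable_EFinP; exact: measurable_funX.
- by move=> x _; rewrite lee_fin powR_mulrn// real_normK// num_real.
Qed.

Let msqr f : measurable_fun setT f -> measurable_fun setT (fun x => (f x ^+ 2)%:E).
Proof. by move=> mf; apply/measurable_EFinP; exact: measurable_funX. Qed.

Let sqr0 f x : (0 <= (f x ^+ 2)%:E)%E. Proof. by rewrite lee_fin sqr_ge0. Qed.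

Lemma square_integrable_bounded f : bounded_measurable f -> square_integrable f.
Proof.
move=> [mf [M fM]]; split => //; apply: (@le_lt_trans _ _ (\int[P]_x (cst (M ^+ 2)%:E) x)%E).
  apply: ge0_le_integral => //; [exact: msqr|].
  by move=> x _; rewrite lee_fin -real_normK ?num_real// lerXn2r ?nnegrE// (le_trans _ (fM x)).
by rewrite integral_cst// P1 mule1 ltry.
Qed.

Lemma square_integrable_le f g : measurable_fun setT f ->
  (forall x, f x ^+ 2 <= g x ^+ 2) -> square_integrable g -> square_integrable f.
Proof.
move=> mf fg [mg goo]; split => //; apply: le_lt_trans goo.
by apply: ge0_le_integral => //; [exact: msqr|exact: msqr|move=> x _; rewrite lee_fin].
Qed.

Lemma square_integrableM f g : square_integrable f -> square_integrable g ->
  P.-integrable setT (fun x => (f x * g x)%:E).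
Proof.
move=> /square_integrableP lf /square_integrableP lg.
exact/Lfun1_integrable/(Lfun2_mul_Lfun1 lf lg).
Qed.

Lemma square_integrable_sqr f : square_integrable f ->
  P.-integrable setT (fun x => (f x ^+ 2)%:E).
Proof. by move=> hf; exact: square_integrableM. Qed.

Lemma square_integrable_integrable f : square_integrable f -> P.-integrable setT (EFin \o f).
Proof.
move=> hf; have h1 := square_integrable_bounded (bounded_measurable_cst T 1).
apply: eq_integrable (square_integrableM hf h1) => // x _; by rewrite mulr1.
Qed.

Lemma square_integrableD f g : square_integrable f -> square_integrable g ->
  square_integrable (fun x => f x + g x).
Proof.
move=> [mf foo] [mg goo]; split; first exact: measurable_funD.
apply: (@le_lt_trans _ _ (\int[P]_x (2%:E * (f x ^+ 2)%:E + 2%:E * (g x ^+ 2)%:E))%E).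
  apply: ge0_le_integral => //.
  - by move=> x _; rewrite lee_fin sqr_ge0.
  - by apply: msqr; exact: measurable_funD.
  - by apply: emeasurable_funD; apply: measurable_funeM; exact: msqr.
  - by move=> x _; rewrite -!EFinM -EFinD lee_fin -subr_ge0;
      rewrite (_ : _ - _ = (f x - g x) ^+ 2) ?sqr_ge0//; ring.
rewrite ge0_integralD//; last 4 first.
- by move=> x _; rewrite mule_ge0// lee_fin.
- by apply: measurable_funeM; exact: msqr.
- by move=> x _; rewrite mule_ge0// lee_fin.
- by apply: measurable_funeM; exact: msqr.
rewrite !ge0_integralZl_EFin//; [|exact: msqr..].
by rewrite lte_add_pinfty// lte_mul_pinfty.
Qed.

Lemma square_integrableZ (a : R) f : square_integrable f -> square_integrable (fun x => a * f x).
Proof.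
move=> [mf foo]; split; first exact: measurable_funM.
under eq_integral do rewrite exprMn EFinM.
by rewrite ge0_integralZl_EFin ?sqr_ge0//; [rewrite lte_mul_pinfty// lee_fin sqr_ge0|exact: msqr].
Qed.

Lemma square_integrableB f g : square_integrable f -> square_integrable g ->
  square_integrable (fun x => f x - g x).
Proof.
move=> hf hg; have := square_integrableD hf (square_integrableZ (-1) hg).
by under eq_fun do rewrite mulN1r.
Qed.

Lemma square_integrable_sum I (l : seq I) (F : I -> T -> R) :
  (forall i, square_integrable (F i)) -> square_integrable (fun x => \sum_(i <- l) F i x).
Proof.
move=> hF; elim: l => [|i l IH].
  under eq_fun do rewrite big_nil; exact/square_integrable_bounded/bounded_measurable_cst.
by under eq_fun do rewrite big_cons; exact: square_integrableD.
Qed.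

(** Nonnegativity of the variance, unless the right side is infinite. *)
Lemma sqr_Rintegral_le f : measurable_fun setT f ->
  (((\int[P]_x f x) ^+ 2)%:E <= \int[P]_x (f x ^+ 2)%:E)%E.
Proof.
move=> mf; have [foo|] := ltP (\int[P]_x (f x ^+ 2)%:E)%E +oo%E; last first.
  by rewrite leye_eq => /eqP ->; rewrite leey.
have hf : square_integrable f by [].
have if1 := square_integrable_integrable hf.
have if2 := square_integrable_sqr hf.
set m := \int[P]_x f x.
have hc : square_integrable (fun x => f x - m).
  exact/square_integrableB/square_integrable_bounded/bounded_measurable_cst.
have : 0 <= \int[P]_x ((f x - m) ^+ 2) by apply: Rintegral_ge0 => x _; exact: sqr_ge0.
have -> : \int[P]_x ((f x - m) ^+ 2) = \int[P]_x (f x ^+ 2) - m ^+ 2.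
  transitivity (\int[P]_x (f x ^+ 2 - ((m *+ 2) * f x - m ^+ 2))).
    by apply: eq_Rintegral => x _; ring.
  have iZ : P.-integrable setT (EFin \o (fun x => m *+ 2 * f x)).
    exact: (square_integrable_integrable (square_integrableZ _ hf)).
  have iC : P.-integrable setT (EFin \o (fun=> m ^+ 2)).
    exact/(bounded_integrable1 P1)/bounded_measurable_cst.
  have iB : P.-integrable setT (EFin \o (fun x => m *+ 2 * f x - m ^+ 2)).
    by apply: eq_integrable (integrableB _ iZ iC) => // x _; rewrite EFinB.
  rewrite RintegralB// RintegralB// RintegralZl// (Rintegral_cst1 P1) -/m; ring.
rewrite subr_ge0 -lee_fin /Rintegral fineK//.
exact: integrable_fin_num.
Qed.

Lemma orthogonal_closure (V : set (T -> R)) (w f : T -> R) : square_integrable w ->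
  V `<=` square_integrable -> (forall g, V g -> \int[P]_x (w x * g x) = 0) ->
  square_integrable f ->
  (forall eps : R, 0 < eps ->
     exists2 g, V g & (Lnorm P 2%:E (fun x => (f x - g x)%:E) < eps%:E)%E) ->
  \int[P]_x (w x * f x) = 0.
Proof.
move=> hw hV wV hf cl; apply/eqP; rewrite -normr_le0 leNgt; apply/negP.
set a := `| _ | => a0.
pose K := fine (Lnorm P 2%:E (EFin \o w)).
have Kfin : Lnorm P 2%:E (EFin \o w) \is a fin_num.
  move/square_integrableP : hw => /andP[_] /set_mem /= h.
  by rewrite ge0_fin_numE ?Lnorm_ge0.
have K0 : 0 <= K by rewrite fine_ge0// Lnorm_ge0.
(* This accuracy makes the Cauchy-Schwarz bound [K * (a / (K + 1))] smaller than [a]; the added 1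
   covers [K = 0]. *)
have [g Vg fg] := cl (a / (K + 1)) (divr_gt0 a0 (ltr_wpDl K0 ltr01)).
have hg := hV _ Vg; have hB := square_integrableB hf hg.
have aE : a = `|\int[P]_x (w x * (f x - g x))|.
  rewrite /a; congr `|_|; transitivity (\int[P]_x (w x * f x) - \int[P]_x (w x * g x)).
    by rewrite (wV g Vg) subr0.
  rewrite -RintegralB//; [|exact: square_integrableM..].
  by apply: eq_Rintegral => x _; rewrite mulrBr.
have : (a%:E <= Lnorm P 2%:E (EFin \o w) * Lnorm P 2%:E (EFin \o (fun x => f x - g x)%R))%E.
  have p2 : 2^-1 + 2^-1 = 1 :> R by rewrite [RHS]splitr !div1r.
  apply: le_trans (hoelder P hw.1 hB.1 (ltr0Sn R 1) (ltr0Sn R 1) p2).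
  rewrite Lnorm1 aE EFin_normr_Rintegral//; last exact: square_integrableM.
  apply: le_abse_integral => //; apply/measurable_EFinP.
  by apply: measurable_funM; [exact: hw.1|exact: hB.1].
apply/negP; rewrite -ltNge -(fineK Kfin) -/K.
apply: (@le_lt_trans _ _ (K%:E * (a / (K + 1))%:E)%E).
  by apply: lee_wpmul2l; [rewrite lee_fin|exact: ltW].
rewrite -EFinM lte_fin mulrA ltr_pdivrMr ?ltr_wpDl//.
by rewrite mulrC ltr_pM2l// ltrDl.
Qed.

End square_integrable.

(** * Symmetry of the semigroup on square integrable functions *)

Section symmetric_semigroup.
Context (R : realType) d (E : measurableType d).
Variables (alpha : {finite_measure set E -> \bar R}) (c : E -> E -> R).
Local Notation N := (config R E).
Context dO (Omega : measurableType dO) (Pr : R.-pker N ~> Omega).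
Variables (X : R -> Omega -> N).
Hypothesis X_gSIP : gSIP alpha c Pr X.
Variable rho : probability N R.
Local Notation sg := (semigroup Pr X).
Local Notation PP := (transition_integral Pr X).
Hypothesis balance : forall t (F G : N -> \bar R), 0 <= t ->
  nonneg_measurable F -> nonneg_measurable G ->
  (\int[rho]_eta (F eta * PP t G eta) = \int[rho]_eta (G eta * PP t F eta))%E.
Implicit Types (u v : N -> R) (t : R).

Let Pr1 eta : Pr eta setT = 1%E. Proof. exact: prob_kernel. Qed.
Let rho1 : rho setT = 1%E. Proof. exact: probability_setT. Qed.
Let mX t : 0 <= t -> measurable_fun [set: Omega] (X t).
Proof. by case: X_gSIP => _ [h _]; exact: h. Qed.

(** Balance against the constant 1, which the transition kernel preserves. *)
Lemma stationary t (F : N -> \bar R) : 0 <= t -> nonneg_measurable F ->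
  (\int[rho]_eta PP t F eta = \int[rho]_eta F eta)%E.
Proof.
move=> t0 hF; transitivity (\int[rho]_eta ((cst 1 eta) * PP t F eta))%E.
  by apply: eq_integral => eta _; rewrite mul1e.
rewrite balance//; apply: eq_integral => eta _.
rewrite (_ : PP t _ eta = 1%E) ?mule1// /transition_integral.
by rewrite integral_cst// mul1e; exact: Pr1.
Qed.

Let nonneg_sqr v : measurable_fun setT v -> nonneg_measurable (fun eta => (v eta ^+ 2)%:E).
Proof.
move=> mv; split; first by move=> eta; rewrite lee_fin sqr_ge0.
by apply/measurable_EFinP; exact: measurable_funX.
Qed.

(** By stationarity [P_t] of the square of [v] has a finite integral, hence is finite almost
    everywhere. This gives the points at which [semigroup] is a genuine and additive integral of the
    unbounded [v]. *)
Lemma path_square_integrable t v : 0 <= t -> square_integrable rho v ->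
  {ae rho, forall eta, square_integrable (Pr eta) (fun w => v (X t w))}.
Proof.
move=> t0 [mv voo]; have hv := nonneg_sqr mv.
have iPv : rho.-integrable setT (PP t (fun eta => (v eta ^+ 2)%:E)).
  apply/integrableP; split; first exact: (measurable_transition_integral X_gSIP t0 hv).
  under eq_integral => eta _.
    rewrite gee0_abs; last by apply: integral_ge0 => w _; exact: hv.1.
    over.
  by rewrite stationary.
have := integrable_ae measurableT iPv; apply: filterS => eta /(_ I) fin.
split; first exact: (measurableT_comp mv (mX t0)).
by rewrite ltey_eq fin.
Qed.

Lemma measurable_semigroup t v : 0 <= t -> measurable_fun setT v ->
  measurable_fun setT (sg t v).
Proof.
move=> t0 mv; apply: (measurableT_comp (@fine_measurable R _ measurableT)) => /=.
have mve : measurable_fun setT (EFin \o v) by exact/measurable_EFinP.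
rewrite (_ : (fun _ => _) = (fun eta => PP t ((EFin \o v)^\+)%E eta - PP t ((EFin \o v)^\-)%E eta)%E).
  apply: emeasurable_funB; apply: (measurable_transition_integral X_gSIP t0); split.
  - by move=> eta; exact: funepos_ge0.
  - exact: measurable_funepos.
  - by move=> eta; exact: funeneg_ge0.
  - exact: measurable_funeneg.
by apply/funext => eta; rewrite [LHS]integralE; congr (_ - _)%E;
  apply: eq_integral => w _; rewrite ?funeposE ?funenegE.
Qed.

(** Jensen's inequality under each path measure, followed by stationarity. *)
Lemma square_integrable_semigroup t v : 0 <= t -> square_integrable rho v ->
  square_integrable rho (sg t v).
Proof.
move=> t0 [mv voo]; have hv := nonneg_sqr mv.
split; first exact: measurable_semigroup.
apply: le_lt_trans voo; rewrite -(stationary t0 hv); apply: ge0_le_integral => //.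
- by move=> eta _; rewrite lee_fin sqr_ge0.
- exact: (nonneg_sqr (measurable_semigroup t0 mv)).2.
- exact: (measurable_transition_integral X_gSIP t0 hv).
- by move=> eta _; apply: (sqr_Rintegral_le (Pr1 eta)); exact: (measurableT_comp mv (mX t0)).
Qed.

Lemma semigroupB_ae t u v : 0 <= t -> square_integrable rho u -> square_integrable rho v ->
  {ae rho, forall eta, sg t (fun z => u z - v z) eta = sg t u eta - sg t v eta}.
Proof.
move=> t0 hu hv; move: (path_square_integrable t0 hu) (path_square_integrable t0 hv).
apply: filterS2 => eta iu iv.
by rewrite /semigroup RintegralB//; exact: (square_integrable_integrable (Pr1 eta)).
Qed.

Let pairing t u v := \int[rho]_eta (u eta * sg t v eta).

Let pairing_ge0 t u v : 0 <= t -> square_integrable rho u -> square_integrable rho v ->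
  (forall eta, 0 <= u eta) -> (forall eta, 0 <= v eta) -> pairing t u v = pairing t v u.
Proof.
move=> t0 + + + +.
have eqPP f g : square_integrable rho f -> square_integrable rho g ->
    (forall eta, 0 <= f eta) -> (forall eta, 0 <= g eta) ->
    (\int[rho]_eta (f eta * sg t g eta)%:E = \int[rho]_eta ((f eta)%:E * PP t (EFin \o g) eta))%E.
  move=> hf hg f0 g0.
  have hG : nonneg_measurable (EFin \o g).
    by split; [move=> eta; rewrite /= lee_fin|apply/measurable_EFinP; exact: hg.1].
  apply: ae_eq_integral => //.
  - by apply/measurable_EFinP/measurable_funM; [exact: hf.1|apply: measurable_semigroup => //; exact: hg.1].
  - apply: emeasurable_funM; first by apply/measurable_EFinP; exact: hf.1.
    exact: (measurable_transition_integral X_gSIP t0 hG).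
  - move: (path_square_integrable t0 hg); apply: filterS => eta ig _.
    rewrite EFinM /semigroup /Rintegral fineK//.
    by apply: integrable_fin_num => //; exact: (square_integrable_integrable (Pr1 eta)).
move=> hu hv u0 v0; rewrite /pairing /Rintegral (eqPP _ _ hu hv u0 v0) (eqPP _ _ hv hu v0 u0) balance//.
- by split; [move=> eta; rewrite /= lee_fin|apply/measurable_EFinP; exact: hu.1].
- by split; [move=> eta; rewrite /= lee_fin|apply/measurable_EFinP; exact: hv.1].
Qed.

Let pairingBl t u u' v : 0 <= t -> square_integrable rho u -> square_integrable rho u' ->
  square_integrable rho v ->
  pairing t (fun z => u z - u' z) v = pairing t u v - pairing t u' v.
Proof.
move=> t0 hu hu' hv; have hsv := square_integrable_semigroup t0 hv.
rewrite /pairing -RintegralB//; [|exact: square_integrableM..].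
by apply: eq_Rintegral => eta _; rewrite mulrBl.
Qed.

Let pairingBr t u v v' : 0 <= t -> square_integrable rho u -> square_integrable rho v ->
  square_integrable rho v' ->
  pairing t u (fun z => v z - v' z) = pairing t u v - pairing t u v'.
Proof.
move=> t0 hu hv hv'; have hsv := square_integrable_semigroup t0 hv.
have hsv' := square_integrable_semigroup t0 hv'.
rewrite /pairing -RintegralB//; [|exact: square_integrableM..].
apply: ae_eq_Rintegral.
- apply: measurable_funM; first exact: hu.1.
  by apply: measurable_semigroup => //; exact: (square_integrableB hv hv').1.
- apply: measurable_funB; apply: measurable_funM;
    [exact: hu.1|exact: hsv.1|exact: hu.1|exact: hsv'.1].
- by move: (semigroupB_ae t0 hv hv'); apply: filterS => eta ->; rewrite mulrBr.
Qed.

Let pos u eta := Num.max (u eta) 0.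
Let neg u eta := Num.max (- u eta) 0.

Let pos_neg u : u = (fun eta => pos u eta - neg u eta).
Proof. by apply/funext => eta; rewrite /pos /neg; case: (leP (u eta) 0); case: (leP (- u eta) 0); lra. Qed.

Let pos_square u : square_integrable rho u -> square_integrable rho (pos u).
Proof.
move=> hu; apply: (square_integrable_le _ _ hu).
  exact: (@measurable_maxr _ _ _ setT u (cst 0) hu.1).
by move=> eta; rewrite /pos; case: (leP (u eta) 0) => // _; rewrite expr0n/= sqr_ge0.
Qed.

Let neg_square u : square_integrable rho u -> square_integrable rho (neg u).
Proof.
move=> hu; have := pos_square (square_integrableZ (-1) hu).
by rewrite /pos /neg; under eq_fun do rewrite mulN1r.
Qed.

(** The balance concerns nonnegative functions, so both arguments are split into positive and
    negative parts. *)
Lemma semigroup_symmetric t u v : 0 <= t -> square_integrable rho u -> square_integrable rho v ->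
  \int[rho]_eta (u eta * sg t v eta) = \int[rho]_eta (v eta * sg t u eta).
Proof.
move=> t0 hu hv; rewrite -/(pairing t u v) -/(pairing t v u).
have p0 f eta : 0 <= pos f eta by rewrite /pos le_max lexx orbT.
have n0 f eta : 0 <= neg f eta by rewrite /neg le_max lexx orbT.
have split f g : square_integrable rho f -> square_integrable rho g ->
    pairing t f g = pairing t (pos f) (pos g) - pairing t (pos f) (neg g) -
                    (pairing t (neg f) (pos g) - pairing t (neg f) (neg g)).
  move=> hf hg; have [hpf hnf] := (pos_square hf, neg_square hf).
  have [hpg hng] := (pos_square hg, neg_square hg).
  rewrite -(pairingBr t0 hpf hpg hng) -(pairingBr t0 hnf hpg hng) -(pos_neg g).
  by rewrite -(pairingBl t0 hpf hnf hg) -(pos_neg f).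
rewrite (split _ _ hu hv) (split _ _ hv hu).
have hpu := pos_square hu; have hnu := neg_square hu.
have hpv := pos_square hv; have hnv := neg_square hv.
rewrite (pairing_ge0 t0 hpu hpv (p0 u) (p0 v)) (pairing_ge0 t0 hpu hnv (p0 u) (n0 v)).
rewrite (pairing_ge0 t0 hnu hpv (n0 u) (p0 v)) (pairing_ge0 t0 hnu hnv (n0 u) (n0 v)).
have alg (x1 x2 x3 x4 : R) : x1 - x2 - (x3 - x4) = x1 - x3 - (x2 - x4) by ring.
exact: alg.
Qed.

Lemma symmetric_reversible : reversible Pr X rho.
Proof.
by move=> t f g t0 bf bg; apply: semigroup_symmetric => //;
  exact: (square_integrable_bounded rho1).
Qed.

End symmetric_semigroup.

(** * Moments and polynomials *)

(** If [n] exceeds [2 * k], every factor [n - i] of the falling factorial with [i < k] is at least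
    half of [n]. Moments are thereby reduced to factorial moments. *)
Lemma leq_expn_ffact n k : (n ^ k <= (2 * k) ^ k + 2 ^ k * n ^_ k)%N.
Proof.
have [nk|kn] := leqP n (2 * k).
  apply: leq_trans (leq_addr _ _).
  by case: k nk => // k nk; rewrite leq_exp2r.
apply: leq_trans (leq_addl _ _).
have h i : (i <= k)%N -> (n ^ i <= 2 ^ i * n ^_ i)%N.
  elim: i => [|i IH] ik; first by rewrite !expn0 ffactn0.
  rewrite !expnS ffactnSr; have /IH {}IH := ltnW ik.
  rewrite mulnACA -[(2 * _ * _)%N]mulnA (mulnC n).
  have : (n <= 2 * (n - i))%N by lia.
  nia.
exact: h.
Qed.

Section pascal_moments.
Context (R : realType) d (E : measurableType d).
Hypothesis E_borel : borel_space R E.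
Variable alpha : {finite_measure set E -> \bar R}.
Local Notation N := (config R E).
Variables (p : R) (rho : probability N R).
Hypotheses (p01 : 0 < p < 1) (rho_pascal : pascal alpha p rho).
Implicit Types (eta : N) (f : N -> R).
Local Notation w := (pascal_weight p (fine (alpha setT))).

Lemma pascal_sector n : rho (sector n) = (w n)%:E.
Proof. by have [_ law] := rho_pascal; exact: law. Qed.

Let w0 n : 0 <= w n. Proof. by rewrite -lee_fin -pascal_sector. Qed.

Let series_size (g : nat -> R) eta : (forall n, 0 <= g n) ->
  ((g (size (atoms eta)))%:E = \sum_(n <oo) (g n)%:E * (\1_(sector n) eta)%:E)%E.
Proof.
move=> g0; rewrite (@nneseriesD1 _ _ (size (atoms eta)))//; last first.
  by move=> n _; rewrite -EFinM lee_fin mulr_ge0.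
rewrite eseries0 ?adde0.
  by rewrite indicE mem_set ?mule1//; exact: sector_atoms.
move=> n _ /eqP nn; rewrite indicE memNset ?mule0// => etan.
by apply: nn; rewrite (size_atoms E_borel etan).
Qed.

Let term_measurable (g : nat -> R) n : 0 <= g n ->
  nonneg_measurable (fun eta : N => (g n)%:E * (\1_(sector n) eta)%:E)%E.
Proof.
move=> g0; apply: nonneg_measurableZ => //; apply: nonneg_measurable_indic.
exact: measurable_sector.
Qed.

Lemma nonneg_measurable_size (g : nat -> R) : (forall n, 0 <= g n) ->
  nonneg_measurable (fun eta : N => (g (size (atoms eta)))%:E).
Proof.
move=> g0; under eq_fun do rewrite series_size//.
by apply: nonneg_measurable_series => n; exact: term_measurable.
Qed.

Lemma integral_size (g : nat -> R) : (forall n, 0 <= g n) ->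
  (\int[rho]_eta (g (size (atoms eta)))%:E = \sum_(n <oo) (g n * w n)%:E)%E.
Proof.
move=> g0; under eq_integral do rewrite series_size//.
rewrite (sigma_functional_series (sigma_functional_integral rho)); last first.
  by move=> n; exact: term_measurable.
apply: eq_eseriesr => n _.
have mn : measurable (@sector R d E n) by exact: measurable_sector.
rewrite ge0_integralZl_EFin//; last exact/measurable_EFinP/measurable_indic.
by rewrite integral_indic// setIT [X in (_ * X)%E]pascal_sector.
Qed.

(** With [S_k] for the partial sums, the recursion of the weights gives
    [S_(k+1) <= p (a + k) S_k + p S_(k+1)], and the last term is absorbed because [p < 1]. *)
Lemma pascal_ffact_bound k : exists C : R, forall m,
  \sum_(n < m) (n ^_ k)%:R * w n <= C.
Proof.
have [p0 p1] := andP p01.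
elim: k => [|k [C hC]].
  exists 1 => m; rewrite -lee_fin -(probability_setT rho).
  rewrite (_ : rho setT = \int[rho]_eta (cst 1 eta))%E; last first.
    by rewrite integral_cst// mul1e.
  rewrite (integral_size (g := fun=> 1))//.
  rewrite -sumEFin; under eq_eseriesr do rewrite mul1r.
  under eq_bigr do rewrite ffactn0 mul1r.
  rewrite -(big_mkord xpredT (fun n => (w n)%:E)).
  by apply: nneseries_lim_ge => n _; rewrite lee_fin.
set a := fine (alpha setT).
have a0 : 0 <= a by exact: fine_ge0.
(* The solution [C'] of [C' = p (a + k) C + p C']. *)
exists (p * (a + k%:R) * C / (1 - p)) => m.
rewrite ler_pdivlMr ?subr_gt0// mulrBr mulr1 lerBlDr.
apply: (@le_trans _ _ (\sum_(n < m.+1) (n ^_ k.+1)%:R * w n)).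
  by rewrite big_ord_recr/= lerDl mulr_ge0.
rewrite big_ord_recl /= mul0r add0r.
apply: (@le_trans _ _ (\sum_(n < m) (p * (a + k%:R) * ((n ^_ k)%:R * w n) +
    (n ^_ k.+1)%:R * w n * p))).
  apply: ler_sum => n _; rewrite /bump/= add1n ffactnS/= natrM.
  rewrite mulrAC pascal_weightS -/a.
  have [nk|kn] := ltnP n k; first by rewrite (ffact_small nk) mulr0 mul0r mulr0 add0r;
    apply: mulr_ge0; [exact: mulr_ge0|exact: ltW].
  rewrite ffactnSr natrM natrB// le_eqVlt; apply/orP; left; apply/eqP; ring.
rewrite big_split/= -mulr_sumr -mulr_suml lerD2r.
apply: ler_wpM2l; last exact: hC.
by apply: mulr_ge0; [exact: ltW|exact: addr_ge0].
Qed.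

Lemma pascal_moment k : (\int[rho]_eta ((size (atoms eta) ^ k)%:R : R)%:E < +oo)%E.
Proof.
pose g n : R := ((2 * k) ^ k + 2 ^ k * n ^_ k)%:R.
apply: (@le_lt_trans _ _ (\int[rho]_eta (g (size (atoms eta)))%:E)%E).
  apply: ge0_le_integral => //.
  - exact: (nonneg_measurable_size (g := fun n => (n ^ k)%:R) _).2.
  - exact: (nonneg_measurable_size (g := g) _).2.
  - by move=> eta _; rewrite lee_fin ler_nat leq_expn_ffact.
rewrite integral_size//.
have [C0 h0] := pascal_ffact_bound 0; have [Ck hk] := pascal_ffact_bound k.
apply: (@le_lt_trans _ _ (((2 * k) ^ k)%:R * C0 + (2 ^ k)%:R * Ck)%:E); last exact: ltry.
apply: lime_le; first by apply: is_cvg_nneseries => n _ _; rewrite lee_fin mulr_ge0.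
apply: nearW => m; rewrite sumEFin lee_fin big_mkord.
apply: (@le_trans _ _ (\sum_(n < m) (((2 * k) ^ k)%:R * ((n ^_ 0)%:R * w n) +
    (2 ^ k)%:R * ((n ^_ k)%:R * w n)))).
  by apply: ler_sum => n _; rewrite /g ffactn0 natrD natrM le_eqVlt; apply/orP; left; apply/eqP; ring.
rewrite big_split -!mulr_sumr; apply: lerD; apply: ler_wpM2l => //.
by have := h0 m; rewrite -mulr_sumr.
Qed.

Lemma pascal_square_integrable f M k : measurable_fun setT f -> 0 <= M ->
  (forall eta, `|f eta| <= M * (size (atoms eta))%:R ^+ k) -> square_integrable rho f.
Proof.
move=> mf M0 fM; split => //.
apply: (@le_lt_trans _ _ (\int[rho]_eta ((M ^+ 2)%:E * ((size (atoms eta) ^ (2 * k))%:R : R)%:E))%E).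
  apply: ge0_le_integral => //.
  - by move=> eta _; rewrite lee_fin sqr_ge0.
  - by apply/measurable_EFinP; exact: measurable_funX.
  - apply: measurable_funeM.
    exact: (nonneg_measurable_size (g := fun n => (n ^ (2 * k))%:R) _).2.
  - move=> eta _; rewrite lee_fin -real_normK ?num_real//.
    rewrite mulnC expnM natrX natrX -exprMn.
    by rewrite lerXn2r ?nnegrE// ?mulr_ge0// ?exprn_ge0.
rewrite ge0_integralZl_EFin ?sqr_ge0//; last first.
  exact: (nonneg_measurable_size (g := fun n => (n ^ (2 * k))%:R) _).2.
by rewrite lte_mul_pinfty// ?lee_fin ?sqr_ge0//; exact: pascal_moment.
Qed.

End pascal_moments.

(** * Polynomials of configurations and the action of the semigroup on them *)

Section polynomials.
Context (R : realType) d (E : measurableType d).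
Hypothesis E_borel : borel_space R E.
Local Notation N := (config R E).
Implicit Types (eta : N) (s : seq E).

Fixpoint all_tuples n s : seq (n.-tuple E) :=
  if n is m.+1 then [seq tcons (x, y) | x <- s, y <- all_tuples m s] else [:: [tuple]].

Lemma pow_measure_atoms (mu : {finite_measure set E -> \bar R}) s n :
  same_measure mu (dirac_sum s) ->
  same_measure (pow_measure mu n) (dirac_sum (all_tuples n s)).
Proof.
move=> es; elim: n => [//|n IH] B mB.
have mC : measurable (@tcons _ E n @^-1` B).
  by rewrite -[X in measurable X]setTI; exact: measurable_tcons.
transitivity (\int[mu]_x (pow_measure mu n (xsection (@tcons _ E n @^-1` B) x)))%E; first by [].
rewrite (ge0_integral_atoms es); last first.
  by split => //; exact: (measurable_fun_xsection (pow_measure mu n) mC).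
rewrite /= dirac_sumE big_allpairs_dep/= -sumEFin; apply: eq_bigr => x _.
rewrite IH /= ?dirac_sumE; last exact: measurable_xsection.
congr EFin; apply: eq_bigr => y _; rewrite !indicE; congr (nat_of_bool _)%:R.
by rewrite /xsection; apply/idP/idP => /set_mem h; apply/mem_set; move: h => /=;
  [move/set_mem|move=> h; apply/mem_set].
Qed.

Lemma sum_all_tuples n (f : n.-tuple E -> R) s :
  \sum_(x <- all_tuples n s) f x = power_sum n (seq_fun f) s.
Proof.
elim: n f => [|n IH] f /=.
  by rewrite big_seq1; congr f; apply: eq_from_tnth => -[].
rewrite big_allpairs_dep/=; apply: eq_bigr => x _; rewrite IH.
apply: eq_power_sum => u _; congr f; apply: val_inj => /=.
by rewrite enum_ordSl/= -map_comp.
Qed.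

Lemma monomialE n (f : n.-tuple E -> R) eta s : measurable_fun setT f ->
  same_measure eta (dirac_sum s) -> monomial f eta = power_sum n (seq_fun f) s.
Proof.
move=> mf es; rewrite /monomial (Rintegral_atoms (pow_measure_atoms (n := n) es) mf).
exact: sum_all_tuples.
Qed.

Lemma power_sum_norm n (F : seq E -> R) M s : (forall u, `|F u| <= M) ->
  `|power_sum n F s| <= M * (size s)%:R ^+ n.
Proof.
elim: n F => [|n IH] F FM; first by rewrite expr0 mulr1 FM.
rewrite (le_trans (ler_norm_sum _ _ _))// exprS mulrCA.
by apply: ler_sum_size => x; apply: IH => u; exact: FM.
Qed.

Definition reindex_fun k n (l : seq nat) (f : n.-tuple E -> R) (y : k.-tuple E) : R :=
  f [tuple nth point y (nth 0%N l i) | i < n].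

Lemma bounded_reindex_fun k n l (f : n.-tuple E -> R) :
  bounded_measurable f -> bounded_measurable (@reindex_fun k n l f).
Proof.
move=> [mf [M fM]]; split; last by exists M => y; exact: fM.
apply: (measurableT_comp mf); apply/measurable_fun_tnthP => i.
rewrite (_ : _ \o _ = fun y : k.-tuple E => nth point y (nth 0%N l i)); last first.
  by apply/funext => y; rewrite /= tnth_mktuple.
have [ik|ik] := ltnP (nth 0%N l i) k.
  rewrite (_ : (fun _ => _) = fun y : k.-tuple E => tnth y (Ordinal ik)).
    exact: measurable_tnth.
  by apply/funext => y; rewrite (tnth_nth point).
rewrite (_ : (fun _ => _) = cst point)//.
by apply/funext => y; rewrite nth_default// size_tuple.
Qed.

Lemma reindex_seqE k n l (f : n.-tuple E -> R) w : size w = k -> size l = n ->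
  seq_fun f (reindex_seq point l w) = seq_fun (@reindex_fun k n l f) w.
Proof.
move=> wk ln; congr f; apply: eq_from_tnth => i; rewrite !tnth_mktuple.
rewrite (nth_map 0%N) ?ln//.
have [ik|ik] := ltnP (nth 0%N l i) k.
  by rewrite -[RHS](@tnth_nth _ _ _ _ (Ordinal ik)) tnth_mktuple.
by rewrite nth_default ?wk// nth_default ?size_tuple.
Qed.

Lemma J_expansion n : exists e, lower_terms (R := R) n e /\
  forall (f : n.-tuple E -> R) eta, bounded_measurable f ->
  J f eta = monomial f eta +
    \sum_(t <- e) t.1.1 * monomial (@reindex_fun t.1.2 n t.2 f) eta.
Proof.
have [e [he hE]] := factorial_sum_expansion R (point : E) n; exists e; split => // f eta bf.
have es := same_atoms E_borel eta; rewrite (JE E_borel bf.1 es) hE (monomialE bf.1 es).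
congr (_ + _); apply: eq_big_seq => t /he[_ ln _]; congr (_ * _).
rewrite (monomialE (bounded_reindex_fun t.1.2 t.2 bf).1 es).
by apply: eq_power_sum => w wk; rewrite -reindex_seqE.
Qed.

Lemma monomial_expansion n : exists e, lower_terms (R := R) n e /\
  forall (f : n.-tuple E -> R) eta, bounded_measurable f ->
  monomial f eta = J f eta +
    \sum_(t <- e) t.1.1 * J (@reindex_fun t.1.2 n t.2 f) eta.
Proof.
have [e [he hE]] := power_sum_expansion R (point : E) n; exists e; split => // f eta bf.
have es := same_atoms E_borel eta; rewrite (monomialE bf.1 es) hE (JE E_borel bf.1 es).
congr (_ + _); apply: eq_big_seq => t /he[_ ln _]; congr (_ * _).
rewrite (JE E_borel (bounded_reindex_fun t.1.2 t.2 bf).1 es).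
by apply: eq_factorial_sum => w wk; rewrite -reindex_seqE.
Qed.

Lemma sector_bounded_monomial n (f : n.-tuple E -> R) : bounded_measurable f ->
  sector_bounded (monomial f : N -> R).
Proof.
move=> bf; have [e [he hE]] := monomial_expansion n.
rewrite (_ : monomial f = fun eta : N => J f eta +
    \sum_(t <- e) t.1.1 * J (@reindex_fun t.1.2 n t.2 f) eta); last first.
  by apply/funext => eta; exact: hE.
apply: sector_boundedD; first exact: sector_bounded_J.
apply: sector_bounded_sum => t; apply: sector_boundedZ.
exact/sector_bounded_J/bounded_reindex_fun.
Qed.

Lemma polynomials_monomial k n (f : k.-tuple E -> R) : (k <= n)%N ->
  bounded_measurable f -> polynomials n (monomial f : N -> R).
Proof.
move=> kn bf; exists 1%N, (fun=> 1), (fun=> monomial f); split.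
  by move=> _; exists k, f.
by apply/funext => eta; rewrite big_ord1 mul1r.
Qed.

Lemma polynomialsD n (F G : N -> R) : polynomials n F -> polynomials n G ->
  polynomials n (fun eta => F eta + G eta).
Proof.
move=> [m [a [f [hf ->]]]] [m' [a' [f' [hf' ->]]]].
exists (m + m')%N, (fun i => match fintype.split i with inl j => a j | inr j => a' j end),
  (fun i => match fintype.split i with inl j => f j | inr j => f' j end); split.
  by move=> i; case: (fintype.split i) => j; [exact: hf|exact: hf'].
apply/funext => eta; rewrite big_split_ord/=; congr (_ + _); apply: eq_bigr => i _.
  by rewrite -[lshift _ _]/(unsplit (inl i)) unsplitK.
by rewrite -[rshift _ _]/(unsplit (inr i)) unsplitK.
Qed.

Lemma polynomialsZ n (b : R) (F : N -> R) : polynomials n F ->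
  polynomials n (fun eta => b * F eta).
Proof.
move=> [m [a [f [hf ->]]]]; exists m, (fun i => b * a i), f; split => //.
by apply/funext => eta; rewrite mulr_sumr; apply: eq_bigr => i _; rewrite mulrA.
Qed.

Lemma polynomials_sum n (I : eqType) (l : seq I) (a : I -> R) (F : I -> N -> R) :
  (forall i, i \in l -> polynomials n (F i)) ->
  polynomials n (fun eta => \sum_(i <- l) a i * F i eta).
Proof.
elim: l => [|i l IH] hF.
  exists 0%N, (fun=> 0), (fun=> fun=> 0); split; first by case.
  by apply/funext => eta; rewrite big_nil big_ord0.
under eq_fun do rewrite big_cons.
apply: polynomialsD; first by apply/polynomialsZ/hF; exact: mem_head.
by apply: IH => j jl; apply: hF; rewrite inE jl orbT.
Qed.

Lemma J_sub_monomial n (f : n.-tuple E -> R) : bounded_measurable f ->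
  polynomials n.-1 (fun eta : N => J f eta - monomial f eta).
Proof.
move=> bf; have [e [he hE]] := J_expansion n.
rewrite (_ : (fun eta : N => _) = fun eta : N =>
    \sum_(t <- e) t.1.1 * monomial (@reindex_fun t.1.2 n t.2 f) eta); last first.
  by apply/funext => eta; rewrite hE// addrC addKr.
apply: polynomials_sum => t /he[kn _ _]; apply: polynomials_monomial.
  by case: n kn {f bf e he hE}.
exact: bounded_reindex_fun.
Qed.

Lemma polynomials_J k n (f : k.-tuple E -> R) : (k <= n)%N ->
  bounded_measurable f -> polynomials n (J f : N -> R).
Proof.
move=> kn bf; have [e [he hE]] := J_expansion k.
rewrite (_ : J f = fun eta : N => monomial f eta +
    \sum_(t <- e) t.1.1 * monomial (@reindex_fun t.1.2 k t.2 f) eta); last first.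
  by apply/funext => eta; exact: hE.
apply: polynomialsD; first exact: polynomials_monomial.
apply: polynomials_sum => t /he[tk _ _]; apply: polynomials_monomial.
  exact: leq_trans (ltnW tk) kn.
exact: bounded_reindex_fun.
Qed.

Section square_integrability.
Variables (alpha : {finite_measure set E -> \bar R}) (p : R) (rho : probability N R).
Hypotheses (p01 : 0 < p < 1) (rho_pascal : pascal alpha p rho).

Lemma square_integrable_monomial n (f : n.-tuple E -> R) : bounded_measurable f ->
  square_integrable rho (monomial f).
Proof.
move=> bf; have [mf [M fM]] := bf; have [mm _] := sector_bounded_monomial bf.
apply: (pascal_square_integrable E_borel p01 rho_pascal (M := M) (k := n)) => //.
  exact: le_trans (fM point).
move=> eta; rewrite (monomialE mf (same_atoms E_borel eta)).
by apply: power_sum_norm => u; exact: fM.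
Qed.

Lemma square_integrable_polynomials n : polynomials n `<=` square_integrable rho.
Proof.
move=> _ [m [a [F [hF ->]]]]; apply: (square_integrable_sum (probability_setT rho)) => i.
apply: square_integrableZ; have [k [f [_ bf ->]]] := hF i.
exact: square_integrable_monomial.
Qed.

End square_integrability.

Section semigroup_polynomials.
Variables (alpha : {finite_measure set E -> \bar R}) (c : E -> E -> R).
Hypothesis mc : measurable_fun [set: E * E] (fun xy : E * E => c xy.1 xy.2).
Hypothesis c0 : forall x y, 0 <= c x y.
Hypothesis cb : exists M : R, forall x y, c x y <= M.
Hypothesis csym : forall x y, c x y = c y x.
Context dO (Omega : measurableType dO) (Pr : R.-pker N ~> Omega).
Variables (X : R -> Omega -> N).
Hypothesis X_gSIP : gSIP alpha c Pr X.
Local Notation sg := (semigroup Pr X).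
Local Notation Jr := (J_restriction Pr X).

(** Monomials are rewritten through the functionals [J], on which the semigroup acts without
    changing the degree. *)
Lemma semigroup_monomial_expansion t n : 0 <= t -> exists e, lower_terms (R := R) n e /\
  forall f : n.-tuple E -> R, bounded_measurable f ->
  sg t (monomial f) = fun eta => J (Jr t f) eta +
    \sum_(u <- e) u.1.1 * J (Jr t (@reindex_fun u.1.2 n u.2 f)) eta.
Proof.
move=> t0; have [e [he hE]] := monomial_expansion n.
exists e; split => // f bf; apply/funext => eta.
have bJ k (g : k.-tuple E -> R) : bounded_measurable g -> sector_bounded (J g : N -> R).
  exact: sector_bounded_J.
have bt (u : R * nat * seq nat) : sector_bounded (J (@reindex_fun u.1.2 n u.2 f) : N -> R).
  exact/bJ/bounded_reindex_fun.
rewrite (_ : monomial f = fun eta : N => J f eta +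
    \sum_(u <- e) u.1.1 * J (@reindex_fun u.1.2 n u.2 f) eta); last first.
  by apply/funext => zeta; exact: hE.
rewrite (semigroupD E_borel mc c0 cb X_gSIP eta t0 (bJ _ _ bf)); last first.
  by apply: sector_bounded_sum => u; exact: sector_boundedZ.
rewrite (semigroup_J E_borel mc c0 cb csym X_gSIP eta t0 bf); congr (_ + _).
rewrite (semigroup_sum E_borel mc c0 cb X_gSIP e (fun u => u.1.1) eta t0 bt).
apply: eq_bigr => u _; congr (_ * _).
exact: (semigroup_J E_borel mc c0 cb csym X_gSIP eta t0 (bounded_reindex_fun u.1.2 u.2 bf)).
Qed.

Let bJr t k (g : k.-tuple E -> R) : 0 <= t -> bounded_measurable g -> bounded_measurable (Jr t g).
Proof. exact: (bounded_J_restriction E_borel mc c0 cb X_gSIP). Qed.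

Lemma semigroup_monomial_sub t n (f : n.-tuple E -> R) : 0 <= t -> bounded_measurable f ->
  polynomials n.-1 (fun eta => sg t (monomial f) eta - monomial (Jr t f) eta).
Proof.
move=> t0 bf; have [e [he hE]] := semigroup_monomial_expansion n t0.
rewrite (_ : (fun eta => _) = fun eta => (J (Jr t f) eta - monomial (Jr t f) eta) +
    \sum_(u <- e) u.1.1 * J (Jr t (@reindex_fun u.1.2 n u.2 f)) eta); last first.
  by apply/funext => eta; rewrite hE// addrAC.
apply: polynomialsD; first exact/J_sub_monomial/bJr.
apply: polynomials_sum => u /he[kn _ _]; apply: polynomials_J.
  by case: n kn {f bf e he hE}.
exact/bJr/bounded_reindex_fun.
Qed.

Lemma semigroup_polynomials t n (g : N -> R) : 0 <= t -> polynomials n g ->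
  polynomials n (sg t g).
Proof.
move=> t0 [m [a [F [hF ->]]]].
have sF i : sector_bounded (F i).
  by have [k [f [_ bf ->]]] := hF i; exact: sector_bounded_monomial.
rewrite (_ : sg t _ = fun eta => \sum_(i < m) a i * sg t (F i) eta); last first.
  apply/funext => eta; exact: (semigroup_sum E_borel mc c0 cb X_gSIP _ a eta t0 sF).
apply: polynomials_sum => i _; have [k [f [kn bf ->]]] := hF i.
have [e [he hE]] := semigroup_monomial_expansion k t0; rewrite hE//.
apply: polynomialsD; first exact/polynomials_J/bJr.
apply: polynomials_sum => u /he[uk _ _]; apply: polynomials_J.
  exact: leq_trans (ltnW uk) kn.
exact/bJr/bounded_reindex_fun.
Qed.

End semigroup_polynomials.

End polynomials.

(** * Orthogonal polynomials *)

Section orthogonal_projections.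
Context (R : realType) d (E : measurableType d).
Hypothesis E_borel : borel_space R E.
Local Notation N := (config R E).
Variables (alpha : {finite_measure set E -> \bar R}) (p : R) (rho : probability N R).
Hypotheses (p01 : 0 < p < 1) (rho_pascal : pascal alpha p rho).
Implicit Types (u v w : N -> R).
Local Notation W n := (orthogonal_complement rho (L2_closure rho (polynomials n))).

(** Orthogonality to the polynomials passes to their closure by Cauchy-Schwarz; conversely each
    polynomial lies in the closure, since it is square integrable under the Pascal law. *)
Lemma orthogonal_polynomialsP n w :
  W n w <-> square_integrable rho w /\
            forall q, polynomials n q -> \int[rho]_eta (w eta * q eta) = 0.
Proof.
have sP := square_integrable_polynomials E_borel p01 rho_pascal (n := n).
split=> [[lw ow]|[hw ow]]; (split; [exact/square_integrableP|]) => q hq.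
  apply: ow; split; first exact/square_integrableP/sP.
  move=> eps eps0; exists q => //.
  rewrite (_ : (fun eta => _) = cst 0%E) ?Lnorm0 ?lte_fin//.
  by apply/funext => eta; rewrite subrr.
case: hq => /square_integrableP lq cl.
exact: (orthogonal_closure hw sP ow lq cl).
Qed.

Lemma Rintegral_mulB_eq0 u v w : square_integrable rho u -> square_integrable rho v ->
  square_integrable rho w -> \int[rho]_eta ((u eta - v eta) * w eta) = 0 ->
  \int[rho]_eta (w eta * u eta) = \int[rho]_eta (w eta * v eta).
Proof.
move=> hu hv hw h; apply/eqP; rewrite -subr_eq0 -RintegralB//;
  [|exact: square_integrableM..].
by rewrite -[X in _ == X]h; apply/eqP/eq_Rintegral => eta _; rewrite [RHS]mulrC mulrBr.
Qed.

Lemma square_integrable_eq0 u : square_integrable rho u ->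
  \int[rho]_eta (u eta * u eta) = 0 -> {ae rho, forall eta, u eta = 0}.
Proof.
move=> hu h; have iu := square_integrableM hu hu.
have mu : measurable_fun setT (fun eta => (u eta * u eta)%:E).
  by apply/measurable_EFinP; apply: measurable_funM; exact: hu.1.
have : (\int[rho]_eta `|(u eta * u eta)%:E| = 0)%E.
  under eq_integral do rewrite gee0_abs ?lee_fin -?expr2 ?sqr_ge0//.
  by rewrite -(fineK (integrable_fin_num _ iu))//; congr EFin.
move/(ae_eq_integral_abs rho measurableT mu); apply: filterS => eta /(_ I) /eqP.
by rewrite eqe mulf_eq0 orbb => /eqP.
Qed.

Variable c : E -> E -> R.
Hypothesis mc : measurable_fun [set: E * E] (fun xy : E * E => c xy.1 xy.2).
Hypothesis c0 : forall x y, 0 <= c x y.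
Hypothesis cb : exists M : R, forall x y, c x y <= M.
Hypothesis csym : forall x y, c x y = c y x.
Hypothesis cdiag : forall x, c x x = 0.
Context dO (Omega : measurableType dO) (Pr : R.-pker N ~> Omega).
Variables (X : R -> Omega -> N).
Hypothesis X_gSIP : gSIP alpha c Pr X.
Local Notation sg := (semigroup Pr X).

Let balance := transition_balance E_borel mc c0 cb csym cdiag X_gSIP p01 rho_pascal.

Lemma pascal_reversible : reversible Pr X rho.
Proof. exact: (symmetric_reversible X_gSIP balance). Qed.

Let sym t u v : 0 <= t -> square_integrable rho u -> square_integrable rho v ->
  \int[rho]_eta (u eta * sg t v eta) = \int[rho]_eta (v eta * sg t u eta).
Proof. exact: (semigroup_symmetric X_gSIP balance). Qed.

Let sq t u : 0 <= t -> square_integrable rho u -> square_integrable rho (sg t u).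
Proof. exact: (square_integrable_semigroup X_gSIP balance). Qed.

Lemma semigroup_orthogonal n t w : 0 <= t -> W n w -> W n (sg t w).
Proof.
move=> t0 /orthogonal_polynomialsP[hw ow]; apply/orthogonal_polynomialsP; split; first exact: sq.
move=> q hq; have hq2 := square_integrable_polynomials E_borel p01 rho_pascal hq.
under eq_Rintegral do rewrite mulrC.
by rewrite sym//; exact/ow/(semigroup_polynomials E_borel mc c0 cb csym X_gSIP t0 hq).
Qed.

Lemma semigroup_orthogonal_polynomial t n (f : n.-tuple E -> R) (g h : N -> R) :
  0 <= t -> symmetric_fun f -> orthogonal_polynomial rho f g ->
  orthogonal_polynomial rho (particle_semigroup Pr X t f) h ->
  {ae rho, forall eta, sg t g eta = h eta}.
Proof.
move=> t0 fs [Wg og] [Wh oh]; have [bf _] := fs.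
pose ft := particle_semigroup Pr X t f.
have bft : bounded_measurable ft.
  rewrite /ft -(J_restriction_symmetric E_borel mc c0 cb X_gSIP t0 fs).
  exact: (bounded_J_restriction E_borel mc c0 cb X_gSIP t0 bf).
have hf := square_integrable_monomial E_borel p01 rho_pascal bf.
have hft := square_integrable_monomial E_borel p01 rho_pascal bft.
have [hg _] := (orthogonal_polynomialsP _ _).1 Wg.
have [hh qh] := (orthogonal_polynomialsP _ _).1 Wh.
have Wsg := semigroup_orthogonal t0 Wg.
have [hsg qsg] := (orthogonal_polynomialsP _ _).1 Wsg.
have key w : W n.-1 w -> \int[rho]_eta (w eta * sg t g eta) = \int[rho]_eta (w eta * h eta).
  move=> Ww; have [hw qw] := (orthogonal_polynomialsP _ _).1 Ww.
  have [hsw _] := (orthogonal_polynomialsP _ _).1 (semigroup_orthogonal t0 Ww).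
  (* The projection property of [g] is tested against [sg t w], which is again in the orthogonal
     complement. *)
  have E1 := Rintegral_mulB_eq0 hf hg hsw (og _ (semigroup_orthogonal t0 Ww)).
  have E2 := Rintegral_mulB_eq0 hft hh hw (oh _ Ww).
  have E3 : \int[rho]_eta ((sg t (monomial f) eta - monomial ft eta) * w eta) = 0.
    under eq_Rintegral do rewrite mulrC.
    apply: qw; rewrite /ft -(J_restriction_symmetric E_borel mc c0 cb X_gSIP t0 fs).
    exact: (semigroup_monomial_sub E_borel mc c0 cb csym X_gSIP t0 bf).
  have {}E3 := Rintegral_mulB_eq0 (sq t0 hf) hft hw E3.
  rewrite -E2 -E3 (sym t0 hw hg) (sym t0 hw hf).
  under eq_Rintegral do rewrite mulrC.
  by under [RHS]eq_Rintegral do rewrite mulrC.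
have hB := square_integrableB hsg hh.
(* The difference lies in the complement, so it may serve as its own test function and has norm
   0. *)
have WB : W n.-1 (fun eta => sg t g eta - h eta).
  apply/orthogonal_polynomialsP; split => // q hq.
  have hq2 := square_integrable_polynomials E_borel p01 rho_pascal hq.
  rewrite -[RHS](subrr 0) -[X in _ = X - _](qsg _ hq) -[X in _ = _ - X](qh _ hq).
  rewrite -RintegralB//; [|exact: square_integrableM..].
  by apply: eq_Rintegral => eta _; rewrite mulrBl.
have : {ae rho, forall eta, sg t g eta - h eta = 0}.
  apply: (square_integrable_eq0 hB).
  have := key _ WB => /eqP; rewrite -subr_eq0 -RintegralB//; [|exact: square_integrableM..].
  by move=> /eqP <-; apply: eq_Rintegral => eta _; rewrite mulrBr.
by apply: filterS => eta /eqP; rewrite subr_eq0 => /eqP.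
Qed.

End orthogonal_projections.
Theorem theorem5p2 (R : realType) (d : measure_display) (E : measurableType d)
  (E_borel : borel_space R E)
  (alpha : {finite_measure set E -> \bar R})
  (alpha_neq0 : alpha [set: E] != 0%E)
  (c : E -> E -> R)
  (c_measurable : measurable_fun [set: E * E] (fun xy : E * E => c xy.1 xy.2))
  (c_ge0 : forall x y, 0 <= c x y)
  (c_bounded : exists M : R, forall x y, c x y <= M)
  (c_sym : forall x y, c x y = c y x)
  (c_diag : forall x, c x x = 0)
  (dO : measure_display) (Omega : measurableType dO)
  (Pr : R.-pker (config R E) ~> Omega) (X : R -> Omega -> config R E)
  (X_gSIP : gSIP alpha c Pr X) :
  ((markov_process Pr X /\ consistent Pr X) /\
   forall (eta : config R E) (n : nat) (f : n.-tuple E -> R) (t : R),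
     symmetric_fun f -> 0 <= t ->
     semigroup Pr X t (J f) eta = J (particle_semigroup Pr X t f) eta) /\
  (forall (p : R) (rho : probability (config R E) R),
     0 < p < 1 -> pascal alpha p rho ->
     reversible Pr X rho /\
     forall (t : R) (n : nat) (f : n.-tuple E -> R) (g h : config R E -> R),
       0 <= t -> (1 <= n)%N -> symmetric_fun f ->
       orthogonal_polynomial rho f g ->
       orthogonal_polynomial rho (particle_semigroup Pr X t f) h ->
       {ae rho, forall eta, semigroup Pr X t g eta = h eta}).

Proof.
split.
  split; first exact: conj X_gSIP.2 (gSIP_consistent E_borel c_measurable c_ge0 c_bounded X_gSIP c_sym).
  move=> eta n f t fs t0.
  exact: (semigroup_J_symmetric E_borel c_measurable c_ge0 c_bounded c_sym X_gSIP eta t0 fs).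
move=> p rho p01 rho_pascal; split.
  exact: (pascal_reversible E_borel p01 rho_pascal c_measurable c_ge0 c_bounded c_sym c_diag X_gSIP).
move=> t n f g h t0 _ fs fg fh.
exact: (semigroup_orthogonal_polynomial E_borel p01 rho_pascal c_measurable c_ge0
  c_bounded c_sym c_diag X_gSIP t0 fs fg fh).
Qed.
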